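(* Let $k$ be a field, let $R = k[x,y,z]$ with the standard grading, and let $I \subseteq R$ be a homogeneous ideal which is Cohen-Macaulay (i.e. $R/I$ is Cohen-Macaulay) of codimension two. Let $0 \to F \xrightarrow{\phi} G \xrightarrow{\psi} I \to 0$ be the Hilbert-Burch graded free resolution of $I$, where $F$ and $G$ are graded free $R$-modules of ranks $m$ and $m+1$. Then the following conditions are equivalent: (1) $I$ is a local complete intersection. (2) The natural map $\mathrm{Sym}_2\, I \to I^2$ is an isomorphism. (3) $\mathrm{Sym}_2\, I$ is torsion free. (4) The complex $$0 \longrightarrow \wedge^2 F \longrightarrow F \otimes G \longrightarrow \mathrm{Sym}_2\, G \longrightarrow I^2 \longrightarrow 0$$ is a free resolution of $I^2$.
   Context: $I$ is a local complete intersection if it is locally generated by a regular sequence on $\mathbb{P}^2$ (the projective plane over $k$ with homogeneous coordinate ring $R$): for every point $p$ of $\mathbf{V}(I) \subseteq \mathbb{P}^2$, the localization $\mathcal{I}_p \subseteq \mathcal{O}_{\mathbb{P}^2,p}$ of (the ideal sheaf of) $I$ at $p$ is generated by a regular sequence. All tensor, exterior and symmetric powers are over $R$. $\mathrm{Sym}_2\, I$ is the second symmetric power of the $R$-module $I$, and the natural map $\mathrm{Sym}_2\, I \to I^2$ is induced by multiplication $a\cdot b \mapsto ab$. The maps in the complex of (4) are the natural ones induced by $\phi$ and $\psi$: $\wedge^2 F \to F\otimes G$ sends $u\wedge u' \mapsto u\otimes\phi(u') - u'\otimes\phi(u)$; $F\otimes G \to \mathrm{Sym}_2\, G$ sends $u\otimes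 g \mapsto \phi(u)\cdot g$; and $\mathrm{Sym}_2\, G \to I^2$ is the composition of $\mathrm{Sym}_2\,\psi : \mathrm{Sym}_2\, G \to \mathrm{Sym}_2\, I$ with the natural map $\mathrm{Sym}_2\, I \to I^2$, i.e. $g\cdot g' \mapsto \psi(g)\psi(g')$. *)

(* Defs.v *)
(* Submodules, ideals and subrings are boolean predicates; with the classical
   reflection `[< _ >] of boolp this is no restriction. *)
From HB Require Import structures.
From mathcomp Require Import all_boot all_order all_algebra.
From mathcomp Require Import generic_quotient ring_quotient boolp.
From mathcomp Require Import freeg mpoly.

Set Implicit Arguments.
Unset Strict Implicit.
Unset Printing Implicit Defensive.

Import GRing.Theory.

Local Open Scope ring_scope.
Local Open Scope quotient_scope.

Section SpanPred.
Variables (A : comNzRingType) (V : lmodType A) (G : V -> Prop).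

Definition span_pred : {pred V} := fun x =>
  `[< exists n (c : 'I_n -> A) (g : 'I_n -> V),
        (forall i, G (g i)) /\ x = \sum_i c i *: g i >].

Lemma span_predP x :
  reflect (exists n (c : 'I_n -> A) (g : 'I_n -> V),
             (forall i, G (g i)) /\ x = \sum_i c i *: g i)
          (x \in span_pred).
Proof. exact: asboolP. Qed.

Lemma span_pred_submod : submod_closed span_pred.
Proof.
split; first by apply/span_predP; exists 0, (fun=> 0), (fun=> 0); split=> [[]|];
  rewrite ?big_ord0.
move=> a _ _ /span_predP[n [c [g [Gg ->]]]] /span_predP[p [d [h [Gh ->]]]].
apply/span_predP; exists (n + p)%N.
exists (fun i => match split i with inl j => a * c j | inr j => d j end).
exists (fun i => match split i with inl j => g j | inr j => h j end).
split=> [i|]; first by case: split.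
rewrite big_split_ord scaler_sumr; congr (_ + _); apply: eq_bigr => i _.
  by rewrite (unsplitK (inl i)) scalerA.
by rewrite (unsplitK (inr i)).
Qed.

HB.instance Definition _ := GRing.isSubmodClosed.Build A V span_pred
  span_pred_submod.

Lemma span_pred_gen x : G x -> x \in span_pred.
Proof.
move=> Gx; apply/span_predP; exists 1%N, (fun=> 1), (fun=> x).
by rewrite big_ord_recl big_ord0 addr0 scale1r.
Qed.

Definition modquot := Quotient.quot (span_pred : zmodClosed V).
HB.instance Definition _ := GRing.Zmodule.on modquot.
HB.instance Definition _ := EqQuotient.on modquot.

Definition to_modquot (x : V) : modquot := \pi_modquot x.

Lemma to_modquot_eq x y : (to_modquot x = to_modquot y) <-> (x - y \in span_pred).
Proof. by split=> [/eqP|h]; [|apply/eqP]; rewrite /to_modquot eqmodE. Qed.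

Lemma to_modquot_is_zmod : zmod_morphism to_modquot.
Proof. by move=> x y; rewrite /to_modquot !piE. Qed.

HB.instance Definition _ := GRing.isZmodMorphism.Build V modquot to_modquot
  to_modquot_is_zmod.

Definition modquot_scale (a : A) (q : modquot) : modquot :=
  to_modquot (a *: repr q).

Lemma to_modquot_repr q : to_modquot (repr q) = q.
Proof. exact: reprK. Qed.

Lemma modquot_scaleE a x : modquot_scale a (to_modquot x) = to_modquot (a *: x).
Proof.
apply/to_modquot_eq; rewrite -scalerBr rpredZ //.
by apply/to_modquot_eq; rewrite to_modquot_repr.
Qed.

Lemma modquot_scaleA a b q :
  modquot_scale a (modquot_scale b q) = modquot_scale (a * b) q.
Proof. by rewrite -[q]to_modquot_repr !modquot_scaleE scalerA. Qed.

Lemma modquot_scale1 : left_id 1 modquot_scale.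
Proof. by move=> q; rewrite -[q]to_modquot_repr modquot_scaleE scale1r. Qed.

Lemma modquot_scaleDr : right_distributive modquot_scale +%R.
Proof.
move=> a p q; rewrite -[p]to_modquot_repr -[q]to_modquot_repr.
by rewrite -raddfD !modquot_scaleE scalerDr raddfD.
Qed.

Lemma modquot_scaleDl q : {morph modquot_scale^~ q : a b / a + b}.
Proof.
by move=> a b; rewrite -[q]to_modquot_repr !modquot_scaleE scalerDl raddfD.
Qed.

HB.instance Definition _ := GRing.Zmodule_isLmodule.Build A modquot
  modquot_scaleA modquot_scale1 modquot_scaleDr modquot_scaleDl.

Lemma to_modquot_is_scalable : scalable to_modquot.
Proof. by move=> a x; rewrite -modquot_scaleE. Qed.

HB.instance Definition _ := GRing.isScalable.Build A V modquot _ to_modquot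
  to_modquot_is_scalable.

Section Lift.
Variables (L : lmodType A) (f : {linear V -> L}) (fG : forall x, G x -> f x = 0).

Definition modquot_lift_fun (q : modquot) : L := f (repr q).

Lemma modquot_lift_funE x : modquot_lift_fun (to_modquot x) = f x.
Proof using fG.
apply/eqP; rewrite -subr_eq0 -linearB.
have /to_modquot_eq/span_predP[n [c [g [Gg ->]]]] :
  to_modquot (repr (to_modquot x)) = to_modquot x by rewrite to_modquot_repr.
by rewrite linear_sum big1 // => i _; rewrite linearZ_LR fG ?scaler0.
Qed.

Lemma modquot_lift_fun_linear : linear modquot_lift_fun.
Proof using fG.
move=> a p q; rewrite -[p]to_modquot_repr -[q]to_modquot_repr -linearP.
by rewrite !modquot_lift_funE linearP.
Qed.

Definition modquot_lift : {linear modquot -> L} :=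
  HB.pack modquot_lift_fun
    (GRing.isLinear.Build A modquot L _ modquot_lift_fun modquot_lift_fun_linear).

Lemma modquot_liftE x : modquot_lift (to_modquot x) = f x.
Proof. exact: modquot_lift_funE. Qed.

End Lift.
End SpanPred.

Section FreeLift.
Variables (A : comNzRingType) (K : choiceType) (L : lmodType A) (f : K -> L).

Definition free_lift_fun (D : {freeg K / A}) : L := fglift f D.

Lemma free_lift_fun_linear : linear free_lift_fun.
Proof.
have fB : zmod_morphism free_lift_fun by exact: lift_is_additive.
pose fA : {additive {freeg K / A} -> L} := HB.pack free_lift_fun
  (GRing.isZmodMorphism.Build {freeg K / A} L free_lift_fun fB).
have fU c x : fA << c *g x >> = c *: f x by exact: liftU.
have UZ a c x : a *: << c *g x >> = << (a * c) *g x >> :> {freeg K / A}.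
  by apply/eqP/freeg_eqP => y; rewrite coeffZ !coeffU mulrA.
move=> a D E; rewrite -[free_lift_fun]/(fA : _ -> _) raddfD; congr (_ + _).
suff fZ (s : seq K) (c : K -> A) : fA (a *: \sum_(z <- s) << c z *g z >>) =
    a *: fA (\sum_(z <- s) << c z *g z >>).
  by have := fZ (dom D) (fun x => coeff x D); rewrite freeg_sumE.
elim: s => [|x s IHs]; first by rewrite big_nil scaler0 raddf0 scaler0.
by rewrite big_cons scalerDr raddfD IHs raddfD UZ !fU scalerDr scalerA.
Qed.

Definition free_lift : {linear {freeg K / A} -> L} :=
  HB.pack free_lift_fun
    (GRing.isLinear.Build A {freeg K / A} L _ free_lift_fun free_lift_fun_linear).

Lemma free_liftU x : free_lift << x >> = f x.
Proof. by rewrite /= /free_lift_fun liftU scale1r. Qed.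

End FreeLift.

Section Tensor.
Variables (A : comNzRingType) (M N : lmodType A).

Inductive tensor_rel : {freeg (M * N)%type / A} -> Prop :=
| TensorAddl x x' y :
    tensor_rel (<< (x + x', y) >> - << (x, y) >> - << (x', y) >>)
| TensorAddr x y y' :
    tensor_rel (<< (x, y + y') >> - << (x, y) >> - << (x, y') >>)
| TensorScalel a x y : tensor_rel (<< (a *: x, y) >> - a *: << (x, y) >>)
| TensorScaler a x y : tensor_rel (<< (x, a *: y) >> - a *: << (x, y) >>).

Definition tensor := modquot tensor_rel.
HB.instance Definition _ := GRing.Lmodule.on tensor.

Definition tens (x : M) (y : N) : tensor := to_modquot tensor_rel << (x, y) >>.

Lemma tens_bilinear : bilinear_for *:%R *:%R tens.
Proof.
pose q := to_modquot tensor_rel.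
have qB D E : q (D - E) = q D - q E by exact: to_modquot_is_zmod.
have qZ a D : q (a *: D) = a *: q D by exact: to_modquot_is_scalable.
have rel D : tensor_rel D -> q D = 0.
  move=> rD; rewrite -[0](subrr (q 0)) -qB.
  by apply/to_modquot_eq; rewrite subrr subr0 span_pred_gen.
split=> [y a x x'|x a y y'] /=; rewrite /tens -/q.
- have /rel/eqP := TensorAddl (a *: x) x' y.
  rewrite !qB subr_eq add0r subr_eq => /eqP ->.
  have /rel/eqP := TensorScalel a x y.
  by rewrite qB qZ subr_eq0 => /eqP ->; rewrite addrC.
- have /rel/eqP := TensorAddr x (a *: y) y'.
  rewrite !qB subr_eq add0r subr_eq => /eqP ->.
  have /rel/eqP := TensorScaler a x y.
  by rewrite qB qZ subr_eq0 => /eqP ->; rewrite addrC.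
Qed.

HB.instance Definition _ :=
  bilinear_isBilinear.Build A M N tensor *:%R *:%R tens tens_bilinear.

Variables (L : lmodType A) (f : {bilinear M -> N -> L}).

Lemma tensor_lift_subproof D :
  tensor_rel D -> free_lift (fun p : M * N => f p.1 p.2) D = 0.
Proof.
case=> [x x' y|x y y'|c x y|c x y]; rewrite !linearB ?linearZZ !free_liftU /=.
- by rewrite linearDl addrAC addrK subrr.
- by rewrite linearDr addrAC addrK subrr.
- by rewrite linearZl_LR scalerN subrr.
- by rewrite linearZr_LR scalerN subrr.
Qed.

Definition tensor_lift : {linear tensor -> L} := modquot_lift tensor_lift_subproof.

Lemma tensor_liftE x y : tensor_lift (tens x y) = f x y.
Proof. by rewrite [LHS]modquot_liftE free_liftU. Qed.

End Tensor.

Section Sym2.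
Variables (A : comNzRingType) (M : lmodType A).

Definition sym2_rel (t : tensor M M) : Prop :=
  exists x y, t = tens x y - tens y x.

Definition sym2 := modquot sym2_rel.
HB.instance Definition _ := GRing.Lmodule.on sym2.

Definition sym2_mul (x y : M) : sym2 := to_modquot sym2_rel (tens x y).

Lemma sym2_mul_bilinear : bilinear_for *:%R *:%R sym2_mul.
Proof.
have qL := linearP (to_modquot sym2_rel).
by split=> [y a x x'|x a y y'] /=; rewrite /sym2_mul ?linearPl ?linearPr qL.
Qed.

HB.instance Definition _ :=
  bilinear_isBilinear.Build A M M sym2 *:%R *:%R sym2_mul sym2_mul_bilinear.

Lemma sym2_mulC x y : sym2_mul x y = sym2_mul y x.
Proof. by apply/to_modquot_eq/span_pred_gen; exists x, y. Qed.

Section Lift.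
Variables (L : lmodType A) (f : {bilinear M -> M -> L}).
Hypothesis fC : forall x y, f x y = f y x.

Lemma sym2_lift_subproof t : sym2_rel t -> tensor_lift f t = 0.
Proof using fC.
by case=> [x [y ->]]; rewrite linearB !tensor_liftE fC subrr.
Qed.

Definition sym2_lift : {linear sym2 -> L} := modquot_lift sym2_lift_subproof.

Lemma sym2_liftE x y : sym2_lift (sym2_mul x y) = f x y.
Proof. by rewrite [LHS]modquot_liftE tensor_liftE. Qed.
End Lift.
End Sym2.

Section Sym2Map.
Variables (A : comNzRingType) (M N : lmodType A) (h : {linear M -> N}).

Definition sym2_map_bil (x y : M) : sym2 N := sym2_mul (h x) (h y).

Lemma sym2_map_bilinear : bilinear_for *:%R *:%R sym2_map_bil.
Proof.
by split=> [y a x x'|x a y y'] /=;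
  rewrite /sym2_map_bil linearP ?linearPl ?linearPr.
Qed.

HB.instance Definition _ := bilinear_isBilinear.Build A M M (sym2 N) *:%R *:%R
  sym2_map_bil sym2_map_bilinear.

Lemma sym2_map_bilC x y : sym2_map_bil x y = sym2_map_bil y x.
Proof. exact: sym2_mulC. Qed.

Definition sym2_map : {linear sym2 M -> sym2 N} := sym2_lift sym2_map_bilC.

Lemma sym2_mapE x y : sym2_map (sym2_mul x y) = sym2_mul (h x) (h y).
Proof. exact: sym2_liftE. Qed.
End Sym2Map.

Section Ext2.
Variables (A : comNzRingType) (M : lmodType A).

Definition ext2_rel (t : tensor M M) : Prop := exists x, t = tens x x.

Definition ext2 := modquot ext2_rel.
HB.instance Definition _ := GRing.Lmodule.on ext2.

Definition wedge (x y : M) : ext2 := to_modquot ext2_rel (tens x y).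

Variables (L : lmodType A) (f : {bilinear M -> M -> L}).
Hypothesis fxx : forall x, f x x = 0.

Lemma ext2_lift_subproof t : ext2_rel t -> tensor_lift f t = 0.
Proof using fxx. by case=> [x ->]; rewrite tensor_liftE. Qed.

Definition ext2_lift : {linear ext2 -> L} := modquot_lift ext2_lift_subproof.

Lemma ext2_liftE x y : ext2_lift (wedge x y) = f x y.
Proof. by rewrite [LHS]modquot_liftE tensor_liftE. Qed.
End Ext2.

Definition surjective (T U : Type) (f : T -> U) := forall y, exists x, f x = y.

Section ModuleProps.
Variable A : comNzRingType.

Definition exact_at (U V W : lmodType A) (f : {linear U -> V})
  (g : {linear V -> W}) := forall v, g v = 0 <-> exists u, f u = v.

Definition finite_free (V : lmodType A) :=
  exists n (e : {linear 'rV[A]_n -> V}), bijective e.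

(* The usual notion when A is a domain. *)
Definition torsion_free (V : lmodType A) :=
  forall (a : A) (v : V), a *: v = 0 -> a = 0 \/ v = 0.

Definition short_exact (P1 P0 M : lmodType A) (d1 : {linear P1 -> P0})
    (e : {linear P0 -> M}) :=
  [/\ injective d1, exact_at d1 e & surjective e].

(* 0 -> P2 -> P1 -> P0 -> M -> 0 *)
Definition free_resolution2 (P2 P1 P0 M : lmodType A) (d2 : {linear P2 -> P1})
    (d1 : {linear P1 -> P0}) (e : {linear P0 -> M}) :=
  [/\ finite_free P2, finite_free P1 & finite_free P0] /\
  [/\ injective d2, exact_at d2 d1, exact_at d1 e & surjective e].
End ModuleProps.

Section CommAlg.
Variable A : comNzRingType.

Definition in_ideal_gen (s : seq A) (x : A) :=
  exists c : 'I_(size s) -> A, x = \sum_i c i * s`_i.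

Definition regular_seq (s : seq A) :=
  (forall i, (i < size s)%N -> forall x,
     in_ideal_gen (take i s) (s`_i * x) -> in_ideal_gen (take i s) x) /\
  ~ in_ideal_gen s 1.

(* depth(J, A) = n, as the maximal length of a regular sequence in J. *)
Definition depth_is (J : idealr A) (n : nat) :=
  (exists s, [/\ regular_seq s, {subset s <= J} & size s = n]) /\
  (forall s, regular_seq s -> {subset s <= J} -> (size s <= n)%N).

Definition prime_chain (P : prime_idealr A) (n : nat) :=
  exists c : 'I_n.+1 -> prime_idealr A,
    (forall i j : 'I_n.+1, (i < j)%N ->
       {subset c i <= c j} /\ ~ {subset c j <= c i}) /\
    c ord_max =i P.

Definition height_is (P : prime_idealr A) (n : nat) :=
  prime_chain P n /\ (forall p, prime_chain P p -> (p <= n)%N).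

(* The codimension of J is the least height of a prime containing it. *)
Definition codim_is (J : idealr A) (n : nat) :=
  (exists P : prime_idealr A, {subset J <= P} /\ height_is P n) /\
  (forall (P : prime_idealr A) p,
     {subset J <= P} -> height_is P p -> (n <= p)%N).

(* [idealr] includes properness. *)
Definition maximal_ideal (J : idealr A) :=
  forall K : idealr A, {subset J <= K} -> {subset K <= J}.

(* Eisenbud's definition, for a Noetherian ring A: depth(P, A) = codim P for
   every maximal ideal P. *)
Definition cohen_macaulay :=
  forall P : prime_idealr A, maximal_ideal P ->
    exists n, depth_is P n /\ height_is P n.

Section IdealMod.
Variable I : idealr A.

Definition ideal_pred : {pred A^o} := fun x => x \in (I : {pred A}).

Lemma ideal_pred_submod : submod_closed ideal_pred.
Proof.
by split=> [|a u v uI vI]; rewrite /ideal_pred unfold_in ?rpred0 // rpredD // idealMr.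
Qed.

HB.instance Definition _ :=
  GRing.isSubmodClosed.Build A A^o ideal_pred ideal_pred_submod.

Record ideal_mod := IdealMod { ideal_val : A^o; _ : ideal_val \in ideal_pred }.

HB.instance Definition _ := [isSub for ideal_val].
HB.instance Definition _ := [Choice of ideal_mod by <:].
HB.instance Definition _ := [SubChoice_isSubLmodule of ideal_mod by <:].

Definition ideal_elt (x : ideal_mod) : A := ideal_val x.

Lemma ideal_eltP (x : ideal_mod) : ideal_elt x \in (I : {pred A}).
Proof. exact: valP. Qed.

Lemma ideal_elt_inj : injective ideal_elt.
Proof. exact: val_inj. Qed.

Lemma ideal_eltD : {morph ideal_elt : x y / x + y}.
Proof. exact: (raddfD (\val : ideal_mod -> A^o)). Qed.

Lemma ideal_eltZ a x : ideal_elt (a *: x) = a * ideal_elt x.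
Proof. exact: (linearZZ (\val : ideal_mod -> A^o)). Qed.
End IdealMod.

Coercion ideal_elt : ideal_mod >-> GRing.ComNzRing.sort.

Section IdealProd.
Variables I J : idealr A.

Definition ideal_prod : {pred A} := fun x =>
  `[< exists n (a b : 'I_n -> A),
        (forall i, (a i \in (I : {pred A})) && (b i \in (J : {pred A}))) /\
        x = \sum_i a i * b i >].

Lemma ideal_prodP x :
  reflect (exists n (a b : 'I_n -> A),
        (forall i, (a i \in (I : {pred A})) && (b i \in (J : {pred A}))) /\
        x = \sum_i a i * b i) (x \in ideal_prod).
Proof. exact: asboolP. Qed.

Lemma ideal_prod_closed : idealr_closed ideal_prod.
Proof.
split.
- by apply/ideal_prodP; exists 0, (fun=> 0), (fun=> 0); split=> [[]|];
    rewrite ?big_ord0.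
- apply/ideal_prodP=> -[n [a [b [abI one]]]]; have := idealr1 I.
  by rewrite [1]one rpred_sum // => i _; rewrite mulrC idealMr //; case/andP: (abI i).
move=> x _ _ /ideal_prodP[n [a [b [abI ->]]]] /ideal_prodP[p [c [d [cdI ->]]]].
apply/ideal_prodP; exists (n + p)%N.
exists (fun i => match split i with inl j => x * a j | inr j => c j end).
exists (fun i => match split i with inl j => b j | inr j => d j end).
split=> [i|].
  by case: split => j //; case/andP: (abI j) => aI ->; rewrite idealMr.
rewrite big_split_ord mulr_sumr; congr (_ + _); apply: eq_bigr => i _.
  by rewrite (unsplitK (inl i)) mulrA.
by rewrite (unsplitK (inr i)).
Qed.

HB.instance Definition _ := isIdealr.Build A ideal_prod ideal_prod_closed.

Lemma ideal_prodM x y : x \in (I : {pred A}) -> y \in (J : {pred A}) ->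
  x * y \in ideal_prod.
Proof.
move=> xI yJ; apply/ideal_prodP; exists 1%N, (fun=> x), (fun=> y).
by split=> [i|]; rewrite ?xI // big_ord_recl big_ord0 addr0.
Qed.
End IdealProd.

Section Sym2Square.
Variable I : idealr A.

Definition ideal_sq : idealr A := ideal_prod I I.

Definition ideal_mul (x y : ideal_mod I) : ideal_mod ideal_sq :=
  IdealMod (ideal_prodM (ideal_eltP x) (ideal_eltP y)).

Lemma ideal_mul_bilinear : bilinear_for *:%R *:%R ideal_mul.
Proof.
have elt_mul (x y : ideal_mod I) : ideal_mul x y = (x : A) * (y : A) :> A by [].
split=> [y a x x'|x a y y'] /=; apply: ideal_elt_inj; rewrite ideal_eltD ideal_eltZ.
  by rewrite !elt_mul ideal_eltD ideal_eltZ mulrDl mulrA.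
by rewrite !elt_mul ideal_eltD ideal_eltZ mulrDr mulrCA.
Qed.

HB.instance Definition _ := bilinear_isBilinear.Build A (ideal_mod I)
  (ideal_mod I) (ideal_mod ideal_sq) *:%R *:%R ideal_mul ideal_mul_bilinear.

Lemma ideal_mulC x y : ideal_mul x y = ideal_mul y x.
Proof. by apply: val_inj; rewrite /= mulrC. Qed.

Definition sym2_to_sq : {linear sym2 (ideal_mod I) -> ideal_mod ideal_sq} :=
  sym2_lift ideal_mulC.

Lemma sym2_to_sqE (x y : ideal_mod I) :
  sym2_to_sq (sym2_mul x y) = (x : A) * (y : A) :> A.
Proof. by rewrite sym2_liftE. Qed.
End Sym2Square.
End CommAlg.

Section Complex.
Variables (A : comNzRingType) (F G : lmodType A) (I : idealr A).
Variables (phi : {linear F -> G}) (psi : {linear G -> ideal_mod I}).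

Definition cplx2_bil (u u' : F) : tensor F G :=
  tens u (phi u') - tens u' (phi u).

Lemma cplx2_bilinear : bilinear_for *:%R *:%R cplx2_bil.
Proof.
split=> [y a x x'|x a y y'] /=; rewrite /cplx2_bil !linearP /=;
  rewrite linearPl linearPr scalerBr opprD addrACA //.
Qed.

HB.instance Definition _ := bilinear_isBilinear.Build A F F (tensor F G)
  *:%R *:%R cplx2_bil cplx2_bilinear.

Lemma cplx2_bilxx u : cplx2_bil u u = 0.
Proof. exact: subrr. Qed.

Definition cplx2 : {linear ext2 F -> tensor F G} := ext2_lift cplx2_bilxx.

Lemma cplx2E u u' :
  cplx2 (wedge u u') = tens u (phi u') - tens u' (phi u).
Proof. exact: ext2_liftE. Qed.

Definition cplx1_bil (u : F) (g : G) : sym2 G := sym2_mul (phi u) g.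

Lemma cplx1_bilinear : bilinear_for *:%R *:%R cplx1_bil.
Proof.
split=> [y a x x'|x a y y'] /=; rewrite /cplx1_bil ?linearPr //.
by rewrite linearP linearPl.
Qed.

HB.instance Definition _ := bilinear_isBilinear.Build A F G (sym2 G)
  *:%R *:%R cplx1_bil cplx1_bilinear.

Definition cplx1 : {linear tensor F G -> sym2 G} := tensor_lift cplx1_bil.

Lemma cplx1E u g : cplx1 (tens u g) = sym2_mul (phi u) g.
Proof. exact: tensor_liftE. Qed.

Definition cplx0 : {linear sym2 G -> ideal_mod (ideal_sq I)} :=
  sym2_to_sq I \o sym2_map psi.

Lemma cplx0E g g' :
  cplx0 (sym2_mul g g') = (psi g : A) * (psi g' : A) :> A.
Proof.
have -> : cplx0 (sym2_mul g g') = sym2_to_sq I (sym2_map psi (sym2_mul g g')) by [].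
by rewrite sym2_mapE sym2_to_sqE.
Qed.
End Complex.

Section Graded.
Variables (k : fieldType) (n : nat).
Local Notation R := {mpoly k[n]}.

Definition homogeneous_ideal (J : idealr R) :=
  forall d (f : R), f \in (J : {pred R}) -> pihomog mdeg d f \in (J : {pred R}).

Definition zhomog (d : int) (f : R) : bool :=
  match d with
  | Posz e => f \is e.-homog
  | Negz _ => f == 0
  end.

(* A degree sequence a : 'I_p -> int makes 'rV[R]_p the graded free module
   \bigoplus_i R(-a_i), in which the i-th basis vector has degree a_i. *)
Definition free_homog p (a : 'I_p -> int) (d : int) (v : 'rV[R]_p) :=
  forall i, zhomog (d - a i) (v 0 i).

(* 0 -> \bigoplus_j R(-b_j) -> \bigoplus_i R(-a_i) -> I -> 0, exact with maps
   homogeneous of degree 0. *)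
Definition hilbert_burch_resolution (I : idealr R) m
    (b : 'I_m -> int) (a : 'I_m.+1 -> int)
    (phi : {linear 'rV[R]_m -> 'rV[R]_m.+1})
    (psi : {linear 'rV[R]_m.+1 -> ideal_mod I}) :=
  [/\ forall d v, free_homog b d v -> free_homog a d (phi v),
      forall d v, free_homog a d v -> zhomog d (ideal_elt (psi v))
    & short_exact phi psi].

(* A (scheme-theoretic) point of Proj R. *)
Record proj_point := ProjPoint {
  point_ideal :> prime_idealr R;
  _ : homogeneous_ideal point_ideal;
  _ : exists i, 'X_i \notin (point_ideal : {pred R})
}.

Section LocalRing.
Variable p : proj_point.
Local Notation "f %:F" := (@tofrac R f).

(* As R is a domain, the local ring of Proj R at p is the subring of Frac R of
   degree-zero fractions with denominator outside p. *)
Definition local_pred : {pred {fraction R}} := fun x =>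
  `[< exists d (f g : R), [/\ f \is d.-homog, g \is d.-homog,
        g \notin (p : {pred R}) & x = f%:F / g%:F] >].

Lemma local_predP x :
  reflect (exists d (f g : R), [/\ f \is d.-homog, g \is d.-homog,
             g \notin (p : {pred R}) & x = f%:F / g%:F]) (x \in local_pred).
Proof. exact: asboolP. Qed.

Lemma tofrac_neq0 (g : R) : g \notin (p : {pred R}) -> @tofrac R g != 0.
Proof. by rewrite tofrac_eq0; apply: contraNneq => ->; rewrite idealr0. Qed.

Lemma local_pred_subring : subring_closed local_pred.
Proof.
split.
- apply/local_predP; exists 0%N, 1, 1; rewrite dhomog1 idealr1 tofrac1 divr1.
  by split.
- move=> _ _ /local_predP[d [f [g [hf hg gp ->]]]]
    /local_predP[e [f' [g' [hf' hg' gp' ->]]]].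
  apply/local_predP; exists (d + e)%N, (f * g' - f' * g), (g * g').
  have hfg' := dhomogM hf hg'; have hfg := dhomogM hf' hg.
  rewrite addnC in hfg.
  rewrite prime_idealrM negb_or gp gp' dhomogM // rpredB //.
  split=> //; rewrite tofracB !tofracM -mulNr addf_div ?tofrac_neq0 //.
  by rewrite mulNr.
move=> _ _ /local_predP[d [f [g [hf hg gp ->]]]]
  /local_predP[e [f' [g' [hf' hg' gp' ->]]]].
apply/local_predP; exists (d + e)%N, (f * f'), (g * g').
rewrite prime_idealrM negb_or gp gp' !dhomogM //.
by split=> //; rewrite !tofracM mulf_div.
Qed.

HB.instance Definition _ :=
  GRing.isSubringClosed.Build {fraction R} local_pred local_pred_subring.

Record local_ring := LocalElt {
  local_val :> {fraction R}; _ : local_val \in local_pred }.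

HB.instance Definition _ := [isSub for local_val].
HB.instance Definition _ := [Choice of local_ring by <:].
HB.instance Definition _ := [SubChoice_isSubComNzRing of local_ring by <:].

(* The stalk at p of the ideal sheaf of I. *)
Definition in_stalk (I : idealr R) (x : local_ring) :=
  exists d (f g : R), [/\ f \is d.-homog, g \is d.-homog,
    f \in (I : {pred R}), g \notin (p : {pred R}) & local_val x = f%:F / g%:F].
End LocalRing.

Definition local_complete_intersection (I : idealr R) :=
  forall p : proj_point, {subset I <= p} ->
    exists s : seq (local_ring p),
      regular_seq s /\ (forall x, in_stalk I x <-> in_ideal_gen s x).
End Graded.

(* Main.v *)
(** The sequence [0 -> /\^2 F -> F * G -> Sym_2 G -> Sym_2 I -> 0] is always
    exact, so (4) says that [mu : Sym_2 I -> I^2] is injective. Since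
    [x^2 s = mu(s) x.x] for [x] in [I], the kernel of [mu] is the torsion of
    [Sym_2 I]; hence (2), (3) and (4) are equivalent.

    (1) => (2): an ideal generated by a regular sequence satisfies [Sym_2 = I^2],
    so the kernel of [mu] vanishes at all points of the plane, and its elements
    are killed by powers of the variables. As [Sym_2 I] has a free resolution of
    length two, it contains no nonzero such element.

    (4) => (1): at a point [p] of [V(I)] the ideal [p] is locally generated by a
    regular sequence [(s, t)]. If [phi] had rank less than [m - 1] at [p], two
    independent vectors [u, u'] of its kernel at [p] would give a nonzero class of
    [u /\ u'] in [Tor_2(Sym_2 I, R/p)], whereas this module vanishes at
    [p] since [Sym_2 I] is torsion free. So two of the given generators generate [I] at [p],
    and they form a regular sequence because [I] has codimension two. *)

Require Import Defs.
From HB Require Import structures.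
From mathcomp Require Import all_boot all_order all_algebra.
From mathcomp Require Import generic_quotient ring_quotient boolp.
From mathcomp Require classical_sets.
From mathcomp Require Import freeg mpoly.
From mathcomp Require Import ring zify.

Set Implicit Arguments.
Unset Strict Implicit.
Unset Printing Implicit Defensive.

Import GRing.Theory.
Local Open Scope ring_scope.

(** * Presented modules and free modules *)

(** No localization of [R] or of a module is formed: a statement at [p] is expressed by a multiplier
    outside [p], and finitely many multipliers are combined into a product. On the side of (1) the
    multipliers have to be homogeneous, since the local ring consists of fractions of degree zero.

    The regular pair at [p] comes from a situation in two variables. Some [X_i] lies outside [p],
    and homogeneity then forces [p] to meet [k[X_i]] only in zero; so [p] behaves as a prime of
    [k(X_i)[x][y]]. Division with remainder, in [x] and then in [y], shows either that no nonzero
    prime lies strictly below [p], or that [p] is locally generated by some [s] free of [y] and some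
    [t]. Codimension two excludes the former; in the latter case [p] is minimal over [I], so every
    element of [p] has a power with a multiple in [I].

    The module Tor is not formed either: its vanishing is a chase through the Koszul relations on
    [(s, t)], and the depth statement for [Sym_2 I] is the same chase with the three variables.
    Characteristic two is allowed, which is why alternating matrices have their diagonal treated
    separately. *)

Section Induction.
Variable A : comNzRingType.

(** Scalars move into the first factor and [tens 0 0] is zero, so neither scalar multiples nor zero
    need a case of their own. *)
Lemma tensor_ind (M N : lmodType A) (P : tensor M N -> Prop) :
  (forall x y, P (tens x y)) -> (forall t u, P t -> P u -> P (t + u)) ->
  forall t, P t.
Proof.
move=> Pt PD t; rewrite -[t]to_modquot_repr.
have P0 : P 0 by have := Pt 0 0; rewrite linear0l.
move: (repr t) => D; rewrite -[D]freeg_sumE.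
elim: (dom D) => [|[x y] s IHs]; first by rewrite big_nil raddf0.
rewrite big_cons raddfD; apply: PD => //=.
have -> : << coeff (x, y) D *g (x, y) >> = coeff (x, y) D *: << (x, y) >>
    :> {freeg (M * N)%type / A}.
  by apply/eqP/freeg_eqP => z; rewrite coeffZ !coeffU mul1r.
have := Pt (coeff (x, y) D *: x) y; rewrite linearZl_LR.
by rewrite (linearZ_LR (to_modquot (@tensor_rel A M N))).

Qed.

Lemma sym2_ind (M : lmodType A) (P : sym2 M -> Prop) :
  (forall x y, P (sym2_mul x y)) -> (forall t u, P t -> P u -> P (t + u)) ->
  forall t, P t.
Proof.
move=> Pt PD t; rewrite -[t]to_modquot_repr.
elim/tensor_ind: (repr t) => [x y|{}t u Pt' Pu]; first exact: Pt.
by rewrite raddfD; apply: PD.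
Qed.

Lemma ext2_ind (M : lmodType A) (P : ext2 M -> Prop) :
  (forall x y, P (wedge x y)) -> (forall t u, P t -> P u -> P (t + u)) ->
  forall t, P t.
Proof.
move=> Pt PD t; rewrite -[t]to_modquot_repr.
elim/tensor_ind: (repr t) => [x y|{}t u Pt' Pu]; first exact: Pt.
by rewrite raddfD; apply: PD.
Qed.

Lemma wedge_bilinear (M : lmodType A) :
  bilinear_for *:%R *:%R (@wedge A M).
Proof.
have qL := linearP (to_modquot (@ext2_rel A M)).
by split=> [y a x x'|x a y y'] /=; rewrite /wedge ?linearPl ?linearPr qL.
Qed.

HB.instance Definition _ (M : lmodType A) := bilinear_isBilinear.Build A M M
  (ext2 M) *:%R *:%R (@wedge A M) (@wedge_bilinear M).

Lemma wedgexx (M : lmodType A) (x : M) : wedge x x = 0.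
Proof.
rewrite -[0](raddf0 (to_modquot (@ext2_rel A M))); apply/to_modquot_eq.
by rewrite subr0 span_pred_gen //; exists x.
Qed.

Lemma wedgeC (M : lmodType A) (x y : M) : wedge x y = - wedge y x.
Proof.
apply/eqP; rewrite -addr_eq0 addrC; have := wedgexx (x + y).
by rewrite linearDl !linearDr /= !wedgexx add0r addr0 addrC => ->.
Qed.

Lemma tensZl (M N : lmodType A) a (x : M) (y : N) : tens (a *: x) y = a *: tens x y.
Proof. exact: linearZl_LR. Qed.

Lemma tensZr (M N : lmodType A) a (x : M) (y : N) : tens x (a *: y) = a *: tens x y.
Proof. exact: linearZr_LR. Qed.

Lemma tensDr (M N : lmodType A) (x : M) (y y' : N) : tens x (y + y') = tens x y + tens x y'.
Proof. exact: linearDr. Qed.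

Lemma tens_suml (M N : lmodType A) (I : finType) (F : I -> M) (y : N) :
  tens (\sum_i F i) y = \sum_i tens (F i) y.
Proof. exact: linear_sumlz. Qed.

Lemma tens_sumr (M N : lmodType A) (I : finType) (x : M) (F : I -> N) :
  tens x (\sum_i F i) = \sum_i tens x (F i).
Proof. exact: linear_sumr. Qed.

Lemma sym2_mulZl (M : lmodType A) a (x : M) (y : M) : sym2_mul (a *: x) y = a *: sym2_mul x y.
Proof. exact: linearZl_LR. Qed.

Lemma sym2_mulZr (M : lmodType A) a (x : M) (y : M) : sym2_mul x (a *: y) = a *: sym2_mul x y.
Proof. exact: linearZr_LR. Qed.

Lemma sym2_mulDl (M : lmodType A) (x x' : M) (y : M) :
  sym2_mul (x + x') y = sym2_mul x y + sym2_mul x' y.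
Proof. exact: linearDl. Qed.

Lemma sym2_mulDr (M : lmodType A) (x : M) (y y' : M) :
  sym2_mul x (y + y') = sym2_mul x y + sym2_mul x y'.
Proof. exact: linearDr. Qed.

Lemma sym2_mul_suml (M : lmodType A) (I : finType) (F : I -> M) (y : M) :
  sym2_mul (\sum_i F i) y = \sum_i sym2_mul (F i) y.
Proof. exact: linear_sumlz. Qed.

Lemma sym2_mul_sumr (M : lmodType A) (I : finType) (x : M) (F : I -> M) :
  sym2_mul x (\sum_i F i) = \sum_i sym2_mul x (F i).
Proof. exact: linear_sumr. Qed.

Lemma wedgeZl (M : lmodType A) a (x : M) (y : M) : wedge (a *: x) y = a *: wedge x y.
Proof. exact: linearZl_LR. Qed.

Lemma wedgeZr (M : lmodType A) a (x : M) (y : M) : wedge x (a *: y) = a *: wedge x y.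
Proof. exact: linearZr_LR. Qed.

Lemma wedge_suml (M : lmodType A) (I : finType) (F : I -> M) (y : M) :
  wedge (\sum_i F i) y = \sum_i wedge (F i) y.
Proof. exact: linear_sumlz. Qed.

Lemma wedge_sumr (M : lmodType A) (I : finType) (x : M) (F : I -> M) :
  wedge x (\sum_i F i) = \sum_i wedge x (F i).
Proof. exact: linear_sumr. Qed.

End Induction.

Section Bases.
Variable A : comNzRingType.

(** Freeness is certified by coordinate functionals: on a module given by generators and relations
    they come from its universal property, so independence of the [e t] never requires a look at the
    relations. *)
Definition dual_bases (V : lmodType A) (T : finType) (e : T -> V)
    (c : T -> {linear V -> A^o}) :=
  (forall v, v = \sum_t (c t v : A) *: e t) /\
  (forall s t, c t (e s) = (s == t)%:R).

Lemma dual_bases_free (V : lmodType A) (T : finType) (e : T -> V) c :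
  dual_bases e c -> finite_free V.
Proof.
case=> sp du; pose f (v : 'rV[A]_#|T|) := \sum_t v 0 (enum_rank t) *: e t.
have fL : linear f.
  move=> a u v; rewrite /f scaler_sumr -big_split; apply: eq_bigr => t _.
  by rewrite !mxE scalerDl scalerA.
pose F : {linear 'rV[A]_#|T| -> V} := HB.pack f (GRing.isLinear.Build _ _ _ _ f fL).
exists #|T|, F; exists (fun v => \row_i (c (enum_val i) v : A)) => v.
  apply/rowP=> i; rewrite mxE /= /f linear_sum (bigD1 (enum_val i)) //=.
  rewrite linearZ_LR du eqxx enum_valK [_ *: _]mulr1 big1 ?addr0 // => t ne.
  by rewrite linearZ_LR du (negPf ne) [_ *: _]mulr0.
rewrite /= /f [RHS]sp; apply: eq_bigr => t _.
by rewrite mxE enum_rankK.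
Qed.

Lemma dual_bases_spanP (V : lmodType A) (T : finType) (e : T -> V)
    (c : T -> {linear V -> A^o}) v w :
  v = \sum_t (c t v : A) *: e t -> w = \sum_t (c t w : A) *: e t ->
  v + w = \sum_t (c t (v + w) : A) *: e t.
Proof.
move=> {1}-> {1}->; rewrite -big_split; apply: eq_bigr => t _.
by rewrite linearD scalerDl.
Qed.

Definition rv m (i : 'I_m) : 'rV[A]_m := delta_mx 0 i.

Lemma rvE m (i j : 'I_m) : rv i 0 j = (i == j)%:R.
Proof. by rewrite mxE eqxx eq_sym. Qed.

Lemma row_sum_rv m (u : 'rV[A]_m) : u = \sum_i u 0 i *: rv i.
Proof. exact: row_sum_delta. Qed.

Section Tens.
Variables m n : nat.
Implicit Types (u : 'rV[A]_m) (v : 'rV[A]_n).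

Definition tcoord_bil (p : 'I_m * 'I_n) u v : A^o := u 0 p.1 * v 0 p.2.

Lemma tcoord_bilinear p : bilinear_for *:%R *:%R (tcoord_bil p).
Proof.
by split=> [y a x x'|x a y y'] /=; rewrite /tcoord_bil !mxE /GRing.scale /=; ring.
Qed.

HB.instance Definition _ p := bilinear_isBilinear.Build A _ _ A^o *:%R *:%R
  (tcoord_bil p) (tcoord_bilinear p).

Definition tcoord p : {linear tensor 'rV[A]_m 'rV[A]_n -> A^o} :=
  locked (tensor_lift (tcoord_bil p)).

Lemma tcoordE p u v : tcoord p (tens u v) = u 0 p.1 * v 0 p.2.
Proof. by rewrite /tcoord -lock tensor_liftE. Qed.

Lemma tens_dual_bases : dual_bases (fun p => tens (rv p.1) (rv p.2)) tcoord.
Proof.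
split=> [|[i j] [i' j']]; last by rewrite tcoordE /= !rvE xpair_eqE -natrM mulnb.
elim/tensor_ind=> [u v|]; last exact: dual_bases_spanP.
rewrite [u in LHS]row_sum_rv [v in LHS]row_sum_rv tens_suml.
under [RHS]eq_bigr do rewrite tcoordE.
rewrite -(pair_bigA _ (fun i j => (u 0 i * v 0 j) *: tens (rv i) (rv j))) /=.
apply: eq_bigr => i _.
rewrite tensZl tens_sumr scaler_sumr; apply: eq_bigr => j _.
by rewrite tensZr scalerA.
Qed.

Lemma tensor_free : finite_free (tensor 'rV[A]_m 'rV[A]_n).
Proof. exact: dual_bases_free tens_dual_bases. Qed.

End Tens.

Section SymExt.
Variable m : nat.
Implicit Types u v : 'rV[A]_m.

(** The coefficient of a basis monomial in the product; on the diagonal the symmetrized formula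
    would count it twice. *)
Definition scoord_bil (p : 'I_m * 'I_m) u v : A^o :=
  if p.1 == p.2 then u 0 p.1 * v 0 p.1
  else u 0 p.1 * v 0 p.2 + u 0 p.2 * v 0 p.1.

Lemma scoord_bilinear p : bilinear_for *:%R *:%R (scoord_bil p).
Proof.
by split=> [y a x x'|x a y y'] /=; rewrite /scoord_bil; case: eqP => _;
  rewrite !mxE /GRing.scale /=; ring.
Qed.

HB.instance Definition _ p := bilinear_isBilinear.Build A _ _ A^o *:%R *:%R
  (scoord_bil p) (scoord_bilinear p).

Lemma scoord_bilC p u v : scoord_bil p u v = scoord_bil p v u.
Proof. by rewrite /scoord_bil; case: eqP => _; ring. Qed.

Definition scoord p : {linear sym2 'rV[A]_m -> A^o} := 
  locked (sym2_lift (scoord_bilC p)).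

Lemma scoordE p u v : scoord p (sym2_mul u v) = scoord_bil p u v.
Proof. by rewrite /scoord -lock sym2_liftE. Qed.

Definition wcoord_bil (p : 'I_m * 'I_m) u v : A^o :=
  u 0 p.1 * v 0 p.2 - u 0 p.2 * v 0 p.1.

Lemma wcoord_bilinear p : bilinear_for *:%R *:%R (wcoord_bil p).
Proof.
by split=> [y a x x'|x a y y'] /=; rewrite /wcoord_bil;
  rewrite !mxE /GRing.scale /=; ring.
Qed.

HB.instance Definition _ p := bilinear_isBilinear.Build A _ _ A^o *:%R *:%R
  (wcoord_bil p) (wcoord_bilinear p).

Lemma wcoord_bilxx p u : wcoord_bil p u u = 0.
Proof. by rewrite /wcoord_bil; ring. Qed.

Definition wcoord p : {linear ext2 'rV[A]_m -> A^o} := 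
  locked (ext2_lift (wcoord_bilxx p)).

Lemma wcoordE p u v :
  wcoord p (wedge u v) = u 0 p.1 * v 0 p.2 - u 0 p.2 * v 0 p.1.
Proof. by rewrite /wcoord -lock ext2_liftE. Qed.

Definition le_pair : {pred 'I_m * 'I_m} := [pred p : 'I_m * 'I_m | (p.1 <= p.2)%N].
Definition lt_pair : {pred 'I_m * 'I_m} := [pred p : 'I_m * 'I_m | (p.1 < p.2)%N].

Lemma sum_diag (V : zmodType) (F : 'I_m * 'I_m -> V) :
  \sum_(p | p.1 == p.2) F p = \sum_(i < m) F (i, i).
Proof.
rewrite (reindex_onto (fun i => (i, i)) fst) /=.
  by apply: eq_bigl => i; rewrite !eqxx.
by move=> [i j] /= /eqP ->.
Qed.

Lemma sum_split_pairs (V : zmodType) (F : 'I_m * 'I_m -> V) :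
  \sum_p F p = \sum_(i < m) F (i, i) +
    \sum_(p : 'I_m * 'I_m | (p.1 < p.2)%N) (F p + F (p.2, p.1)).
Proof.
rewrite (bigID (fun p => p.1 == p.2)) /=; congr (_ + _).
  exact: sum_diag.
rewrite (bigID (fun p : 'I_m * 'I_m => p.1 < p.2)%N) big_split /=; congr (_ + _).
  by apply: eq_bigl => p; rewrite -(inj_eq val_inj) neq_ltn; case: ltngtP.
rewrite (reindex_inj (h := fun p : 'I_m * 'I_m => (p.2, p.1))).
  by apply: eq_bigl => p /=; rewrite -(inj_eq val_inj) neq_ltn; case: ltngtP.
by move=> [? ?] [? ?] [-> ->].
Qed.

Lemma sum_le_pairs (V : zmodType) (F : 'I_m * 'I_m -> V) :
  \sum_(p : 'I_m * 'I_m | (p.1 <= p.2)%N) F p = \sum_(i < m) F (i, i) +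
    \sum_(p : 'I_m * 'I_m | (p.1 < p.2)%N) F p.
Proof.
rewrite (bigID (fun p => p.1 == p.2)) /=; congr (_ + _).
  rewrite -sum_diag; apply: eq_bigl => p.
  by case: eqP => [->|_]; rewrite ?leqnn ?andbF.
by apply: eq_bigl => p; rewrite -(inj_eq val_inj) neq_ltn; case: ltngtP.
Qed.

Lemma sym2_dual_bases : dual_bases
  (fun p : {p | p \in le_pair} => sym2_mul (rv (val p).1) (rv (val p).2))
  (fun p => scoord (val p)).
Proof.
split=> [|[[i j] /= ij] [[i' j'] /= ij']]; last first.
  rewrite scoordE /scoord_bil /= !rvE -[exist _ _ _ == _]val_eqE /= xpair_eqE.
  rewrite inE /= in ij; rewrite inE /= in ij'.
  case: (i' =P j') => [<-|ne].
    by rewrite -natrM mulnb.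
  rewrite -!natrM -natrD !mulnb; congr _%:R.
  case: (i =P j') => [eij'|_]; rewrite ?addn0 //.
  rewrite eij' in ij *; case: (j =P i') => [eji'|_]; rewrite ?andbF ?addn0 //.
  by case: ne; apply/val_inj/eqP; rewrite eqn_leq ij' -eji' ij.
elim/sym2_ind=> [u v|]; last exact: dual_bases_spanP.
rewrite -(big_sub _ (fun p => (scoord p (sym2_mul u v) : A) *:
   sym2_mul (rv p.1) (rv p.2))) sum_le_pairs.
rewrite [u in LHS]row_sum_rv [v in LHS]row_sum_rv sym2_mul_suml.
under eq_bigr do rewrite sym2_mulZl sym2_mul_sumr scaler_sumr.
rewrite (pair_bigA _ (fun i j => u 0 i *: sym2_mul (rv i) (v 0 j *: rv j))) /=.
rewrite sum_split_pairs /=; congr (_ + _); apply: eq_bigr => p.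
  by rewrite sym2_mulZr scalerA scoordE /scoord_bil eqxx.
move=> lt; rewrite !sym2_mulZr !scalerA scoordE /scoord_bil -val_eqE ltn_eqF //.
by rewrite (sym2_mulC (rv p.2)) scalerDl.
Qed.

Lemma sym2_free : finite_free (sym2 'rV[A]_m).
Proof. exact: dual_bases_free sym2_dual_bases. Qed.

Lemma ext2_dual_bases : dual_bases
  (fun p : {p | p \in lt_pair} => wedge (rv (val p).1) (rv (val p).2))
  (fun p => wcoord (val p)).
Proof.
split=> [|[[i j] /= ij] [[i' j'] /= ij']]; last first.
  rewrite wcoordE /= !rvE -[exist _ _ _ == _]val_eqE /= xpair_eqE.
  rewrite inE /= in ij; rewrite inE /= in ij'.
  rewrite -!natrM !mulnb.
  case: (i =P j') => [eij'|_]; rewrite ?subr0 //.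
  rewrite eij' in ij *; case: (j =P i') => [eji'|_]; rewrite ?andbF ?subr0 //.
  by rewrite eji' ltnNge ltnW in ij.
elim/ext2_ind=> [u v|]; last exact: dual_bases_spanP.
rewrite -(big_sub _ (fun p => (wcoord p (wedge u v) : A) *:
   wedge (rv p.1) (rv p.2))).
rewrite [u in LHS]row_sum_rv [v in LHS]row_sum_rv wedge_suml.
under [LHS]eq_bigr do rewrite wedgeZl wedge_sumr scaler_sumr.
rewrite (pair_bigA _ (fun i j => u 0 i *: wedge (rv i) (v 0 j *: rv j))) /=.
rewrite sum_split_pairs /= big1 ?add0r => [|i _]; last first.
  by rewrite wedgeZr wedgexx !scaler0.
apply: eq_bigr => p lt; rewrite !wedgeZr !scalerA wcoordE.
by rewrite (wedgeC (rv p.2)) scalerN scalerBl.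
Qed.

Lemma ext2_free : finite_free (ext2 'rV[A]_m).
Proof. exact: dual_bases_free ext2_dual_bases. Qed.

End SymExt.
End Bases.

Arguments rv {A m} i.
Arguments tcoord {A m n} p.
Arguments scoord {A m} p.
Arguments wcoord {A m} p.
Arguments tens_dual_bases {A m n}.
Arguments sym2_dual_bases {A m}.
Arguments ext2_dual_bases {A m}.

(** * Exactness of the complex *)

Section ClearDenominators.
Variables (A : comNzRingType) (K : fieldType) (iota : {rmorphism A -> K}).
Hypothesis iota_frac : forall x, exists a b, iota b != 0 /\ x = iota a / iota b.

Lemma clear_denominators p q (M : 'M[K]_(p, q)) :
  exists c (N : 'M[A]_(p, q)), iota c != 0 /\ iota c *: M = map_mx iota N.
Proof using iota_frac.
have /choice[ab abP] : forall t : 'I_p * 'I_q, exists ab : A * A,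
    iota ab.2 != 0 /\ M t.1 t.2 = iota ab.1 / iota ab.2.
  by move=> t; have [a [b [nz e]]] := iota_frac (M t.1 t.2); exists (a, b).
exists (\prod_t (ab t).2).
exists (\matrix_(i, j) ((ab (i, j)).1 * \prod_(t | t != (i, j)) (ab t).2)).
split; first by rewrite rmorph_prod; apply/prodf_neq0 => t _; case: (abP t).
apply/matrixP=> i j; rewrite !mxE (bigD1 (i, j)) //= !rmorphM.
have [nz ->] := abP (i, j); rewrite /= mulrC -mulrA; congr (_ * _).
by rewrite mulrA mulVf ?mul1r.
Qed.

End ClearDenominators.

Lemma tofrac_frac (A : idomainType) (x : {fraction A}) :
  exists a b : A, tofrac b != 0 /\ x = tofrac a / tofrac b.
Proof.
elim/quotW: x => -[[a b] /= nz]; exists a, b.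
have nzF : tofrac b != 0 :> {fraction A} by rewrite tofrac_eq0.
split=> //; apply: (canRL (mulfK nzF)); unlock FracField.tofrac.
rewrite -[LHS]FracField.pi_mul; apply/eqmodP => /=.
rewrite /equivf /FracField.mulf /= !numden_Ratio ?oner_eq0 ?mulf_neq0 //=.
  by rewrite !mulr1 mulrC.
all: exact: oner_neq0.
Qed.

Section Resolution.
Variables (A : idomainType) (m n : nat) (I : idealr A).
Local Notation F := 'rV[A]_m.
Local Notation G := 'rV[A]_n.
Variables (phi : {linear F -> G}) (psi : {linear G -> ideal_mod I}).
Hypothesis phi_inj : injective phi.

Lemma phi_eq0 u : phi u = 0 -> u = 0.
Proof using phi_inj. by move=> e; apply: phi_inj; rewrite e raddf0. Qed.

(** Identifies the tensor product of [F] and [G] with [m]-tuples of elements of [G]. *)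
Definition row_bil (i : 'I_m) (u : F) (g : G) : G := u 0 i *: g.

Lemma row_bilinear i : bilinear_for *:%R *:%R (row_bil i).
Proof.
split=> [y a x x'|x a y y'] /=; rewrite /row_bil.
  by rewrite !mxE scalerDl scalerA.
by rewrite scalerDr !scalerA mulrC.
Qed.

HB.instance Definition _ i := bilinear_isBilinear.Build A F G G *:%R *:%R
  (row_bil i) (row_bilinear i).

Definition trow i : {linear tensor F G -> G} := locked (tensor_lift (row_bil i)).

Lemma trowE i u g : trow i (tens u g) = u 0 i *: g.
Proof. by rewrite /trow -lock tensor_liftE. Qed.

Lemma tensor_rows t : t = \sum_i tens (rv i) (trow i t).
Proof.
elim/tensor_ind: t => [u g|t t' {1}-> {1}->]; last first.
  by rewrite -big_split; apply: eq_bigr => i _; rewrite linearD tensDr.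
rewrite {1}[u]row_sum_rv tens_suml; apply: eq_bigr => i _.
by rewrite trowE tensZl tensZr.
Qed.

(** Contraction of a bivector with the [i]-th coordinate form: row [i] of its alternating matrix. *)
Definition wrow_bil (i : 'I_m) (u v : F) : F := u 0 i *: v - v 0 i *: u.

Lemma wrow_bilinear i : bilinear_for *:%R *:%R (wrow_bil i).
Proof.
by split=> [y a x x'|x a y y']; apply/rowP => j;
  rewrite /wrow_bil !mxE; ring.
Qed.

HB.instance Definition _ i := bilinear_isBilinear.Build A F F F *:%R *:%R
  (wrow_bil i) (wrow_bilinear i).

Lemma wrow_bilxx i u : wrow_bil i u u = 0.
Proof. exact: subrr. Qed.

Definition wrow i : {linear ext2 F -> F} := locked (ext2_lift (wrow_bilxx i)).

Lemma wrowE i u v : wrow i (wedge u v) = u 0 i *: v - v 0 i *: u.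
Proof. by rewrite /wrow -lock ext2_liftE. Qed.

Lemma wrow_coord i j w : wrow i w 0 j = wcoord (i, j) w.
Proof.
elim/ext2_ind: w => [u v|w w' IH IH'].
  by rewrite wrowE wcoordE !mxE /= [v 0 i * _]mulrC.
by rewrite !linearD mxE IH IH'.
Qed.

(** Row by row [cplx2] is [phi], which reduces its injectivity to that of [phi]. *)
Lemma trow_cplx2 i w : trow i (cplx2 phi w) = phi (wrow i w).
Proof.
elim/ext2_ind: w => [u v|w w' IH IH']; last by rewrite !linearD IH IH'.
by rewrite cplx2E linearB !trowE wrowE linearB !linearZ.
Qed.

Lemma cplx2_inj : injective (cplx2 phi).
Proof using phi_inj.
move=> w w' /eqP; rewrite -subr_eq0 -linearB => /eqP; set v := (w - w') => dv0.
suff: v = 0 by move/eqP; rewrite subr_eq0 => /eqP.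
have rv0 i : wrow i v = 0 by apply: phi_eq0; rewrite -trow_cplx2 dv0 linear0.
rewrite (ext2_dual_bases.1 v) big1 // => -[[i j] /= ij] _.
by rewrite -wrow_coord rv0 mxE scale0r.
Qed.

Hypothesis exact_phi_psi : exact_at phi psi.

(** Comultiplication from [Sym_2 G] to the tensor square of [G], followed by [psi] on one factor. On
    [phi u . g] the term with [psi (phi u)] drops out, so the value lies in the image of [phi],
    where injectivity can be used. *)
Definition spair_bil (g g' : G) : G := ideal_elt (psi g') *: g + ideal_elt (psi g) *: g'.

Lemma spair_bilinear : bilinear_for *:%R *:%R spair_bil.
Proof.
by split=> [y a x x'|x a y y']; apply/rowP => j;
  rewrite /spair_bil (linearP psi) ideal_eltD ideal_eltZ !mxE; ring.
Qed.

HB.instance Definition _ := bilinear_isBilinear.Build A G G G *:%R *:%R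
  spair_bil spair_bilinear.

Lemma spair_bilC g g' : spair_bil g g' = spair_bil g' g.
Proof. exact: addrC. Qed.

Definition spair : {linear sym2 G -> G} := locked (sym2_lift spair_bilC).

Lemma spairE g g' :
  spair (sym2_mul g g') = ideal_elt (psi g') *: g + ideal_elt (psi g) *: g'.
Proof. by rewrite /spair -lock sym2_liftE. Qed.

Lemma psi_phi u : psi (phi u) = 0.
Proof using exact_phi_psi. by apply/exact_phi_psi; exists u. Qed.

Lemma spair_cplx1 t :
  spair (cplx1 phi t) = phi (\row_i ideal_elt (psi (trow i t))).
Proof using exact_phi_psi.
elim/tensor_ind: t => [u g|t t' IH IH'].
  rewrite cplx1E spairE psi_phi [ideal_elt 0]/(0 : A) scale0r addr0 -linearZ.
  congr (phi _); apply/rowP => i.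
  by rewrite !mxE trowE linearZ ideal_eltZ mulrC.
rewrite !linearD IH IH' -linearD; congr (phi _); apply/rowP => i.
by rewrite !mxE !linearD ideal_eltD.
Qed.

(** A kernel vector over the fraction field, cleared of denominators, is a kernel vector over [A];
    hence the matrix of [phi] has full row rank over that field. *)
Lemma phi_right_inverse :
  exists B : 'M[{fraction A}]_(n, m), map_mx (@tofrac A) (lin1_mx phi) *m B = 1%:M.
Proof using phi_inj.
apply/row_freeP; rewrite -kermx_eq0; apply/eqP/row_matrixP => i; rewrite row0.
have /eqP := mulmx_ker (map_mx (@tofrac A) (lin1_mx phi)).
move/eqP/(congr1 (row i)); rewrite row0 row_mul.
set v := row i _ => v0.
have [c [N [nz eN]]] := clear_denominators (@tofrac_frac A) v.
have : phi N = 0.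
  have : map_mx (@tofrac A) (phi N) = 0.
    by rewrite -mul_rV_lin1 map_mxM -eN -scalemxAl v0 scaler0.
  move=> /rowP e; apply/rowP => j; have /eqP := e j.
  by rewrite !mxE tofrac_eq0 => /eqP.
move/phi_eq0 => N0; apply/eqP; move/eqP: eN.
by rewrite N0 map_mx0 scaler_eq0 (negPf nz).
Qed.

(* If [d1 t = 0], the map [g.g' |-> psi(g') g + psi(g) g'] shows that [t] comes from
   [F * F]; as [Sym_2 phi] is injective, the coordinates of [t] there form an
   alternating matrix. *)
Lemma exact_cplx2_cplx1 : exact_at (cplx2 phi) (cplx1 phi).
Proof using phi_inj exact_phi_psi.
move=> t; split=> [d0|[w <-]]; last first.
  elim/ext2_ind: w => [u v|w w' IH IH']; last by rewrite !linearD IH IH' addr0.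
  by rewrite cplx2E linearB !cplx1E sym2_mulC subrr.
have psi0 i : psi (trow i t) = 0.
  have := spair_cplx1 t; rewrite d0 linear0 => /esym/phi_eq0/rowP/(_ i).
  by rewrite !mxE => e; apply: ideal_elt_inj.
have /choice[h hP] : forall i, exists u, phi u = trow i t.
  by move=> i; apply/exact_phi_psi.
have tE : t = \sum_i \sum_j h i 0 j *: tens (rv i) (phi (rv j)).
  rewrite {1}[t]tensor_rows; apply: eq_bigr => i _.
  rewrite -hP {1}[h i]row_sum_rv linear_sum tens_sumr.
  by apply: eq_bigr => j _; rewrite linearZ tensZr.
(* [M] is the coordinate matrix of [t] after [phi] is applied to its first factor. The vanishing of
   [cplx1 phi t] makes [M] alternating; the diagonal is read off from the squares, as antisymmetry
   would not give it in characteristic two. *)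
pose M k l := \sum_i phi (rv i) 0 k * phi (h i) 0 l.
have d1E : cplx1 phi t = \sum_i sym2_mul (phi (rv i)) (phi (h i)).
  rewrite {1}[t]tensor_rows linear_sum; apply: eq_bigr => i _.
  by rewrite cplx1E hP.
have Mkk k : M k k = 0.
  have := congr1 (scoord (k, k)) d1E; rewrite d0 linear0 linear_sum => ->.
  by apply: eq_bigr => i _; rewrite scoordE /scoord_bil /= eqxx.
have Mkl k l : M k l + M l k = 0.
  have [->|ne] := eqVneq k l; first by rewrite Mkk addr0.
  have := congr1 (scoord (k, l)) d1E; rewrite d0 linear0 linear_sum => ->.
  rewrite -big_split; apply: eq_bigr => i _.
  by rewrite scoordE /scoord_bil /= (negPf ne).
have [B PB] := phi_right_inverse.
pose x : {rmorphism A -> {fraction A}} := @tofrac A.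
have phiB (v : F) j : x (v 0 j) = \sum_k x (phi v 0 k) * B k j.
  have := congr1 (mulmx (map_mx x v)) PB.
  rewrite mulmxA -map_mxM mul_rV_lin1 mulmx1 => /rowP/(_ j).
  by rewrite !mxE => <-; apply: eq_bigr => k _; rewrite !mxE.
(* The right inverse [B] undoes [phi] on both sides: the matrix of the [h i] is [B^T M B], hence
   alternating as well. *)
have SE i j : x (h i 0 j) = \sum_k \sum_l B k i * B l j * x (M k l).
  transitivity (\sum_i' x (rv i' 0 i) * x (h i' 0 j)).
    rewrite (bigD1 i) //= rvE eqxx mul1r big1 ?addr0 // => i' ne.
    by rewrite rvE (negPf ne) rmorph0 mul0r.
  under eq_bigr do rewrite !phiB big_distrlr /=.
  rewrite exchange_big; apply: eq_bigr => k _ /=.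
  rewrite exchange_big; apply: eq_bigr => l _ /=.
  rewrite /M rmorph_sum mulr_sumr; apply: eq_bigr => i' _.
  by rewrite rmorphM /=; ring.
have xM k l : x (M k l) + x (M l k) = 0 by rewrite -rmorphD Mkl rmorph0.
have x_eq0 a : x a = 0 -> a = 0 by move/eqP; rewrite tofrac_eq0 => /eqP.
have Sii i : h i 0 i = 0.
  apply: x_eq0; rewrite SE (pair_bigA _ (fun k l => B k i * B l i * x (M k l))) /=.
  rewrite sum_split_pairs /= big1 => [|k _]; last by rewrite Mkk rmorph0 mulr0.
  rewrite big1 ?addr0 // => p _.
  by rewrite [B p.2 i * _]mulrC -mulrDr xM mulr0.
have Sij i j : h i 0 j + h j 0 i = 0.
  apply: x_eq0; rewrite rmorphD /= !SE [X in _ + X]exchange_big -big_split big1 //= => k _.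
  rewrite -big_split big1 //= => l _.
  by rewrite [B l j * _]mulrC -mulrDr xM mulr0.
have {}tE : t = \sum_(p : 'I_m * 'I_m | (p.1 < p.2)%N)
    (h p.1 0 p.2 *: tens (rv p.1) (phi (rv p.2)) +
     h p.2 0 p.1 *: tens (rv p.2) (phi (rv p.1))).
  rewrite tE (pair_bigA _ (fun i j => h i 0 j *: tens (rv i) (phi (rv j)))) /=.
  rewrite sum_split_pairs /= [X in X + _]big1 ?add0r // => i _.
  by rewrite Sii scale0r.
exists (\sum_(p : 'I_m * 'I_m | (p.1 < p.2)%N) h p.1 0 p.2 *: wedge (rv p.1) (rv p.2)).
rewrite tE linear_sum; apply: eq_bigr => p _; rewrite linearZ_LR cplx2E scalerBr.
congr (_ + _); rewrite -scaleNr; congr (_ *: _).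
by apply/eqP; rewrite eq_sym -addr_eq0 addrC Sij.
Qed.

End Resolution.

Section RightExact.
Variables (A : comNzRingType) (F G : lmodType A).
Variables (I : idealr A) (phi : {linear F -> G}) (psi : {linear G -> ideal_mod I}).
Hypothesis exact_phi_psi : exact_at phi psi.
Hypothesis psi_surj : surjective psi.

(** A map from [Sym_2 I] back to the cokernel of [cplx1] is built from chosen preimages under [psi].
    Two preimages differ by some [phi u], so the choice does not matter there; and whatever
    [sym2_map psi] kills is zero in that cokernel. *)
Lemma sym2_right_exact : exact_at (cplx1 phi) (sym2_map psi).
Proof using exact_phi_psi psi_surj.
move=> s; split=> [|[t <-]]; last first.
  elim/tensor_ind: t => [u g|w w' IH IH']; last by rewrite !linearD IH IH' addr0.
  rewrite cplx1E sym2_mapE.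
  have -> : psi (phi u) = 0 by apply/exact_phi_psi; exists u.
  by rewrite linear0l.
pose rel (x : sym2 G) := exists t, cplx1 phi t = x.
pose q := to_modquot rel.
have [sg sgP] := choice psi_surj.
have qP x y : q x = q y <-> exists t, cplx1 phi t = x - y.
  rewrite /q to_modquot_eq; split=> [/span_predP[p [c [g [gP ->]]]]|[t tE]].
    have /choice[h hP] := gP; exists (\sum_i c i *: h i).
    by rewrite linear_sum; apply: eq_bigr => i _; rewrite linearZ_LR hP.
  by apply: span_pred_gen; exists t.
have q_congr g1 g2 h : psi g1 = psi g2 -> q (sym2_mul g1 h) = q (sym2_mul g2 h).
  move=> e; apply/qP; have /exact_phi_psi[u uE] : psi (g1 - g2) = 0.
    by rewrite linearB e subrr.
  by exists (tens u h); rewrite cplx1E uE linearBl.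
have q_congr' g1 g2 h : psi g1 = psi g2 -> q (sym2_mul h g1) = q (sym2_mul h g2).
  by move=> /q_congr e; rewrite !(sym2_mulC h).
pose f (a b : ideal_mod I) := q (sym2_mul (sg a) (sg b)).
have fL : bilinear_for *:%R *:%R f.
  split=> [y a x x'|x a y y'] /=; rewrite /f -linearZ_LR -linearD.
    rewrite -sym2_mulZl -sym2_mulDl; apply: q_congr.
    by rewrite linearP !sgP.
  rewrite -sym2_mulZr -sym2_mulDr; apply: q_congr'.
  by rewrite linearP !sgP.
pose fb : {bilinear ideal_mod I -> ideal_mod I -> modquot rel} := HB.pack f
  (bilinear_isBilinear.Build _ _ _ _ _ _ f fL).
have fC a b : fb a b = fb b a by rewrite /fb /= /f sym2_mulC.
have liftP (x : sym2 G) : sym2_lift fC (sym2_map psi x) = q x.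
  elim/sym2_ind: x => [g g'|x y IH IH'].
    rewrite sym2_mapE sym2_liftE; change (f (psi g) (psi g') = q (sym2_mul g g')).
    rewrite /f (q_congr _ g) ?sgP //.
    by rewrite (q_congr' _ g') ?sgP.
  by rewrite !linearD IH IH' [RHS](raddfD (to_modquot rel)).
move=> s0; have := liftP s; rewrite s0 linear0 => /esym.
by rewrite -(raddf0 (to_modquot rel)) => /qP; rewrite subr0.
Qed.

End RightExact.

(** * Prime ideals and residue fields *)

Section Primes.
Variable A : comNzRingType.

Definition is_ideal (J : A -> Prop) :=
  J 0 /\ forall a x y, J x -> J y -> J (a * x + y).

Lemma mk_prime (J : A -> Prop) :
  is_ideal J -> ~ J 1 -> (forall u v, J (u * v) -> J u \/ J v) ->
  exists P : prime_idealr A, forall x, x \in P <-> J x.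
Proof.
move=> [J0 JL] J1 JM; pose p : {pred A} := fun x => `[< J x >].
have pP x : reflect (J x) (x \in p) by apply: asboolP.
have pI : idealr_closed p.
  split; [exact/pP | exact/pP |].
  by move=> a u v /pP Ju /pP Jv; apply/pP/JL.
have pM : prime_idealr_closed p.
  by move=> u v /pP/JM[] h; apply/orP; [left|right]; apply/pP.
pose P : prime_idealr A := HB.pack p (isIdealr.Build A p pI)
  (isPrimeIdealrClosed.Build A p pM).
by exists P => x; split=> /pP.
Qed.

Lemma ideal_is_ideal (I : idealr A) : is_ideal (fun x => x \in I).
Proof.
split; first exact: idealr0.
by move=> a x y xI yI; rewrite rpredD // idealMr.
Qed.

(** Krull's argument: an ideal maximal among those that contain [J] and avoid [S] is prime, because
    adjoining any further element makes it meet [S]. *)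
Lemma prime_avoiding (J S : A -> Prop) :
  is_ideal J -> S 1 -> (forall s t, S s -> S t -> S (s * t)) ->
  (forall x, S x -> ~ J x) ->
  exists P : prime_idealr A, (forall x, J x -> x \in P) /\
    (forall x, S x -> x \notin P).
Proof.
move=> [J0 JL] S1 SM SJ.
(* Sets are joined with [J] because the union of the empty chain is empty, which is not an ideal. *)
pose U (X : A -> Prop) x := X x \/ J x.
pose good (X : A -> Prop) := is_ideal (U X) /\ forall x, S x -> ~ U X x.
have [|M [[MI SMn] Mmax]] := @classical_sets.Zorn_bigcup A good.
  move=> F Fgood Ftot; set B := classical_sets.bigcup _ _.
  have UB x : U B x -> J x \/ exists2 X, F X & X x.
    by case=> [[X FX Xx]|Jx]; [right; exists X | left].
  have UF X x : F X -> U X x -> U B x.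
    by move=> FX [Xx|Jx]; [left; exists X | right].
  split; last first.
    move=> x Sx /UB[/(SJ _ Sx)//|[X FX Xx]].
    by have [_ /(_ x Sx)] := Fgood X FX; apply; left.
  split; first by right.
  move=> a x y /UB[Jx|[X FX Xx]] /UB[Jy|[Y FY Yy]].
  - by right; apply: JL.
  - by apply: (UF Y) => //; have [[_ YL] _] := Fgood Y FY; apply: YL; [right|left].
  - by apply: (UF X) => //; have [[_ XL] _] := Fgood X FX; apply: XL; [left|right].
  - have [XY|YX] := Ftot X Y FX FY.
      apply: (UF Y) => //; have [[_ YL] _] := Fgood Y FY.
      by apply: YL; left => //; apply: XY.
    apply: (UF X) => //; have [[_ XL] _] := Fgood X FX.
    by apply: XL; left => //; apply: YX.
have [M0 ML] := MI.
have meet c : ~ U M c -> exists a x, U M x /\ S (a * c + x).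
  move=> Mc; apply: contrapT => nS.
  pose N x := exists a y, U M y /\ x = a * c + y.
  have MN x : U M x -> N x by exists 0, x; rewrite mul0r add0r.
  have NU x : U N x <-> N x.
    by split=> [[//|Jx]|]; [apply: MN; right | left].
  apply: (Mmax N).
    split=> [x Mx|NM]; first by apply: MN; left.
    by apply: Mc; left; apply: NM; exists 1, 0; rewrite mul1r addr0.
  split.
    split; first by apply/NU/MN.
    move=> a x y /NU[b [x' [Mx' ->]]] /NU[d [y' [My' ->]]]; apply/NU.
    by exists (a * b + d), (a * x' + y'); split; [exact: ML | ring].
  by move=> x Sx /NU[a [y [My xE]]]; apply: nS; exists a, y; rewrite -xE.
have [||u v uvM|P PP] := @mk_prime (U M) => //.
- exact: SMn.
- apply: contrapT => /not_orP[Mu Mv].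
  have [a [x [Mx Sx]]] := meet u Mu; have [b [y [My Sy]]] := meet v Mv.
  apply: (SMn _ (SM _ _ Sx Sy)).
  have -> : (a * u + x) * (b * v + y) =
    (a * b) * (u * v) + ((b * v + y) * x + (((a * u) * y) + 0)) by ring.
  by apply: (ML _ _ _ uvM); apply: (ML _ _ _ Mx); apply: (ML _ _ _ My).
exists P; split=> [x Jx|x Sx]; first by apply/PP; right.
by apply/negP => /PP; exact: SMn.
Qed.

End Primes.

Section ResidueField.
Variables (A : comNzRingType) (P : prime_idealr A).

(** A copy of the quotient that can carry classically chosen inverses of units: the fraction field
    is formed over an [idomainType], whose structure includes inversion. *)
Definition quot_dom := {ideal_quot P}.
HB.instance Definition _ := GRing.ComNzRing.on quot_dom.

Definition quot_unit : {pred quot_dom} := fun x => `[< exists y, y * x = 1 >].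
Definition quot_inv (x : quot_dom) : quot_dom :=
  if pselect (exists y, y * x = 1) is left e then sval (cid e) else x.

Lemma quot_mulVx : {in quot_unit, left_inverse 1 quot_inv *%R}.
Proof.
move=> x /asboolP e; rewrite /quot_inv; case: pselect => // e'.
by case: (cid e').
Qed.

Lemma quot_unitPl (x y : quot_dom) : y * x = 1 -> quot_unit x.
Proof. by move=> e; apply/asboolP; exists y. Qed.

Lemma quot_inv_out : {in [predC quot_unit], quot_inv =1 id}.
Proof.
by move=> x /asboolP ne; rewrite /quot_inv; case: pselect.
Qed.

HB.instance Definition _ := GRing.ComNzRing_hasMulInverse.Build quot_dom
  quot_mulVx quot_unitPl quot_inv_out.

Lemma quot_dom_axiom : GRing.integral_domain_axiom quot_dom.
Proof. by move=> x y /(@Quotient.rquot_IdomainAxiom _ P). Qed.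

HB.instance Definition _ := GRing.ComUnitRing_isIntegral.Build quot_dom
  quot_dom_axiom.

Lemma residue_field : exists (K : fieldType) (iota : {rmorphism A -> K}),
  (forall a, (iota a == 0) = (a \in P)) /\
  (forall x, exists a b, iota b != 0 /\ x = iota a / iota b).
Proof.
pose pi : {rmorphism A -> quot_dom} := \pi_{ideal_quot P}%qT.
exists {fraction quot_dom}, (@tofrac quot_dom \o pi : {rmorphism _ -> _}).
split=> [a|x] /=.
  rewrite tofrac_eq0 -(rmorph0 pi) /pi /=.
  by rewrite -[RHS](congr1 (fun z => z \in P) (subr0 a)) Quotient.idealrBE.
have [a [b [nz ->]]] := tofrac_frac x.
exists (repr (a : {ideal_quot P})), (repr (b : {ideal_quot P})).
by rewrite /pi /= !reprK.
Qed.

End ResidueField.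

(** * Primes in iterated polynomial rings *)

Lemma minimize (T : Type) (P : T -> Prop) (f : T -> nat) :
  (exists x, P x) -> exists x, P x /\ forall y, P y -> (f x <= f y)%N.
Proof.
move=> [x Px]; have [n] := ubnP (f x); elim: n x Px => // n IHn x Px ltx.
have [[y [Py lty]]|no] := pselect (exists y, P y /\ (f y < f x)%N).
  by apply: (IHn y Py); lia.
exists x; split=> // y Py; rewrite leqNgt; apply/negP => lt.
by apply: no; exists y.
Qed.

Lemma contraction (A B : comNzRingType) (h : {rmorphism A -> B})
    (P : prime_idealr B) :
  exists Q : prime_idealr A, forall x, (x \in Q) = (h x \in P).
Proof.
have [|||Q QP] := @mk_prime A (fun x => h x \in P).
- split=> [|a x y]; first by rewrite rmorph0 idealr0.
  by move=> hx hy; rewrite rmorphD rmorphM rpredD ?idealMr.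
- by rewrite rmorph1 idealr1.
- by move=> u v; rewrite rmorphM prime_idealrM => /orP.
- by exists Q => x; apply/idP/idP => /QP.
Qed.

Lemma prime_mul_notin (A : comNzRingType) (P : prime_idealr A) x y :
  x \notin P -> y \notin P -> x * y \notin P.
Proof. by move=> xP yP; rewrite prime_idealrM negb_or xP. Qed.

Section Level.
Variables (E : comNzRingType) (K : fieldType) (iota : {rmorphism E -> K}).
Hypothesis iota_frac : forall x, exists a b, iota b != 0 /\ x = iota a / iota b.
Local Notation "p ^i" := (map_poly iota p) (at level 2, format "p ^i").

Lemma clear_denominators_poly (p : {poly K}) :
  exists c (q : {poly E}), iota c != 0 /\ iota c *: p = q^i.
Proof using iota_frac.
have [c [N [nz e]]] := clear_denominators iota_frac (poly_rV p : 'rV_(size p)).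
exists c, (rVpoly N); split=> //.
have := congr1 rVpoly e; rewrite linearZ /= poly_rV_K // => ->.
by by rewrite map_rVpoly.
Qed.

(* [iota] identifies the residue field of the contraction of [P] to [E]. *)
Definition residue_of (P : prime_idealr {poly E}) :=
  forall c, (iota c == 0) = (c%:P \in P).

Lemma map0_in (P : prime_idealr {poly E}) b : residue_of P -> b^i = 0 -> b \in P.
Proof.
move=> rP b0; rewrite -[b]coefK poly_def rpred_sum // => i _.
rewrite -mul_polyC mulrC idealMr // -rP -coef_map.
by rewrite -[X in _ == X](coef0 _ i) -b0.
Qed.

(** Euclidean division over [K]: the image of [t] has least degree among the nonzero images of
    elements of [P], so the remainder of any [b], cleared of denominators, must vanish. *)
Lemma level_generator (P : prime_idealr {poly E}) :
  residue_of P -> (exists b, b \in P /\ b^i != 0) ->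
  exists t, [/\ t \in P, t^i != 0 &
    forall b, b \in P -> exists c q, iota c != 0 /\ (c%:P * b - q * t)^i = 0].
Proof using iota_frac.
move=> rP exb; have [t [[tP t0] tmin]] := minimize (fun b => size b^i) exb.
exists t; split=> // b bP.
have [c [q [nzc cq]]] := clear_denominators_poly (b^i %/ t^i).
exists c, q; split=> //; apply/eqP; apply: contraT => nz.
have cbP : c%:P * b - q * t \in P by rewrite rpredB ?idealMr.
have := tmin _ (conj cbP nz).
rewrite rmorphB !rmorphM /= map_polyC /= -cq mul_polyC -scalerAl -scalerBr.
rewrite {1}(divp_eq b^i t^i) addrAC subrr add0r size_scale // leqNgt.
by rewrite ltn_modp t0.
Qed.

(* Over the residue field of the contraction, the image of [Q] is a nonzero prime of a
   principal ideal domain, hence maximal. *)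
Lemma level_maximal (P Q : prime_idealr {poly E}) :
  residue_of P -> residue_of Q -> {subset Q <= P} ->
  (exists b, b \in Q /\ b^i != 0) -> {subset P <= Q}.
Proof using iota_frac.
move=> rP rQ QP exb.
have [|t [tP t0 tgen]] := level_generator rP.
  by have [b [bQ b0]] := exb; exists b; split=> //; apply: QP.
have [g [[gQ g0] gmin]] := minimize (fun b => size b^i) exb.
have [c [q [nzc cgq]]] := tgen g (QP g gQ).
have qtQ : q * t \in Q.
  have -> : q * t = c%:P * g - (c%:P * g - q * t) by ring.
  by rewrite rpredB ?idealMr // map0_in.
have ext x : t \in Q -> x \in P -> x \in Q.
  move=> tQ /tgen[d [u [nzd du]]].
  have : d%:P * x \in Q.
    have -> : d%:P * x = (d%:P * x - u * t) + u * t by ring.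
    by rewrite rpredD ?idealMr // map0_in.
  by rewrite prime_idealrM -rQ (negPf nzd).
(* The product [q * t] lies in [Q]. If [t] does, [Q] contains [P]. Otherwise [q] does, so by
   minimality of [g] its degree is at least that of [g]; then the image of [t] would be a nonzero
   constant, which is impossible for an element of [P]. *)
have [tQ x|tQ] := boolP (t \in Q); first exact: ext.
have qQ : q \in Q by move: qtQ; rewrite prime_idealrM (negPf tQ) orbF.
have eq_map : iota c *: g^i = q^i * t^i.
  apply/eqP; rewrite -subr_eq0 -mul_polyC -map_polyC -!rmorphM -rmorphB /=.
  by rewrite cgq.
have q0 : q^i != 0.
  apply: contraNneq g0 => q0; move/eqP: eq_map.
  by rewrite q0 mul0r scaler_eq0 (negPf nzc).
have size_t : (1 < size t^i)%N.
  rewrite ltnNge; apply/negP => /size1_polyC tc.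
  have : (t`_0)%:P \in P.
    have -> : (t`_0)%:P = t - (t - (t`_0)%:P) by ring.
    by rewrite rpredB // map0_in // rmorphB /= map_polyC tc (coef_map iota) subrr.
  rewrite -rP => t00; case/negP: t0; rewrite tc polyC_eq0 (coef_map iota).
  exact: t00.
have le_gq := gmin _ (conj qQ q0).
have : size g^i = (size q^i + size t^i).-1.
  by rewrite -(size_scale _ nzc) eq_map size_mul.
by move: le_gq size_t => /=; lia.
Qed.

End Level.

(** The zero ideal satisfies this vacuously, so heights zero and one are treated together, without
    chains. *)
Definition height_le1 (A : comNzRingType) (P : prime_idealr A) :=
  forall Q : prime_idealr A, {subset Q <= P} -> (exists q, q \in Q /\ q != 0) ->
  {subset P <= Q}.

(* The maximal ideal of the localization at [P] is generated by a regular
   sequence of length two; multipliers are elements outside [P]. *)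
Definition regular_pair (A : comNzRingType) (P : prime_idealr A) (s t : A) :=
  [/\ s \in P, t \in P, s != 0,
    forall b, b \in P -> exists g u v, g \notin P /\ g * b = u * s + v * t &
    forall c d, t * c = s * d -> exists g e, g \notin P /\ g * c = s * e].

(** Both primes have the same contraction to [E], and the last hypothesis says that [Q] exceeds the
    extension of its contraction; its image over the residue field is therefore nonzero. *)
Lemma level_maximal_coef (E : comNzRingType) (P Q : prime_idealr {poly E}) :
  {subset Q <= P} -> (forall c : E, c%:P \in P -> c%:P \in Q) ->
  (exists b i, b \in Q /\ (b`_i)%:P \notin Q) -> {subset P <= Q}.
Proof.
move=> QP same [b [i [bQ biQ]]].
have [P0 P0E] := contraction (@polyC E : {rmorphism _ -> _}) P.
have [K [iota [iota0 frac]]] := residue_field P0.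
have rP : residue_of iota P by move=> c; rewrite iota0 P0E.
have rQ : residue_of iota Q.
  by move=> c; rewrite iota0 P0E; apply/idP/idP => [/same|/QP].
apply: (level_maximal frac rP rQ QP); exists b; split=> //.
apply: contraNneq biQ => b0; rewrite -rQ -(coef_map iota) b0.
by rewrite coef0.
Qed.

Section TwoLevels.
Variable D : idomainType.
Local Notation E := {poly D}.
Local Notation S := {poly {poly D}}.
Local Notation kap := (@tofrac D : {rmorphism D -> {fraction D}}).

Lemma map_tofrac_neq0 (b : E) : b != 0 -> map_poly kap b != 0.
Proof.
apply: contraNneq => b0; apply/eqP/polyP => i; rewrite coef0.
by apply/eqP; rewrite -tofrac_eq0 -[tofrac _](coef_map kap) b0 coef0.
Qed.

Lemma residue_tofrac (P : prime_idealr E) :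
  (forall d, d%:P \in P -> d = 0) -> residue_of kap P.
Proof.
move=> PD c; rewrite tofrac_eq0; apply/eqP/idP => [->|/PD//].
exact: idealr0.
Qed.

Lemma level_maximal_const (P Q : prime_idealr E) :
  (forall d, d%:P \in P -> d = 0) -> {subset Q <= P} ->
  (exists b, b \in Q /\ b != 0) -> {subset P <= Q}.
Proof.
move=> PD QP [b [bQ b0]].
have QD d : d%:P \in Q -> d = 0 by move/QP/PD.
apply: (level_maximal (@tofrac_frac D) (residue_tofrac PD) (residue_tofrac QD) QP).
by exists b; rewrite map_tofrac_neq0.
Qed.

(** Each coefficient of [q] is divisible by [s] after multiplication by a constant; the product of
    these constants serves all coefficients at once. *)
Lemma two_level_common (q : S) (s : E) (P0 : prime_idealr E) :
  (forall b, b \in P0 -> exists c u, c != 0 /\ c%:P * b = u * s) ->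
  (forall i, q`_i \in P0) -> exists c r, c != 0 /\ c%:P%:P * q = s%:P * r.
Proof.
move=> P0s qP0; have /choice[cu cuP] : forall i : 'I_(size q),
    exists cu : D * E, cu.1 != 0 /\ cu.1%:P * q`_i = cu.2 * s.
  by move=> i; have [c [u h]] := P0s _ (qP0 i); exists (c, u).
exists (\prod_i (cu i).1); exists (\sum_(i < size q)
  ((\prod_(j | j != i) (cu j).1)%:P * (cu i).2)%:P * 'X^i).
split; first by apply/prodf_neq0 => i _; case: (cuP i).
set c := (\prod_i _)%:P%:P; rewrite -[q in LHS]coefK poly_def !mulr_sumr.
apply: eq_bigr => i _; rewrite {}/c.
rewrite -mul_polyC !mulrA -!polyCM; congr (_%:P * _).
rewrite (bigD1 i) //= [X in X%:P]mulrC polyCM -mulrA (cuP i).2.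
by ring.
Qed.

Lemma level_generator_const (P : prime_idealr E) :
  (forall d, d%:P \in P -> d = 0) -> (exists b, b \in P /\ b != 0) ->
  exists s, [/\ s \in P, s != 0 &
    forall b, b \in P -> exists c u, c != 0 /\ c%:P * b = u * s].
Proof.
move=> PD [b [bP b0]].
have [|s [sP s0 sgen]] := level_generator (@tofrac_frac D) (residue_tofrac PD).
  by exists b; rewrite map_tofrac_neq0.
exists s; split=> // [|x /sgen[c [u [c0 cu]]]].
  by apply: contraNneq s0 => ->; rewrite rmorph0.
exists c, u; split; first by move: c0; rewrite tofrac_eq0.
apply/eqP; rewrite -subr_eq0; apply: contraT => /map_tofrac_neq0.
by rewrite cu eqxx.
Qed.

(* If all coefficients of elements of [P] lie in [P /\ D[x]] then, up to constants,
   [P] is generated by one polynomial [s] in [D[x]]; a nonzero [q] in a smaller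
   prime avoiding [s] could be divided by [s] forever. *)
Lemma two_level_cases (P : prime_idealr S) :
  (forall d : D, d%:P%:P \in P -> d = 0) ->
  height_le1 P \/ (exists c, c%:P \in P /\ c != 0) /\
    (exists b i, b \in P /\ (b`_i)%:P \notin P).
Proof.
move=> PD; have [P0 P0E] := contraction (@polyC E : {rmorphism _ -> _}) P.
have [P0nz|] := pselect (exists c, c%:P \in P /\ c != 0); last first.
  move=> P0z; left => Q QP [q [qQ q0]]; apply: level_maximal_coef => //.
    move=> c cP; have -> : c = 0; last by rewrite polyC0 idealr0.
    by apply/eqP; apply: contraT => c0; case: P0z; exists c.
  exists q, (size q).-1; split=> //; apply: contra_notN P0z => /QP lP.
  by exists (lead_coef q); rewrite lead_coef_eq0.
have [ex|coefP] := pselect (exists b i, b \in P /\ (b`_i)%:P \notin P).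
  by right.
left=> Q QP exq.
have {}coefP b i : b \in P -> b`_i \in P0.
  move=> bP; rewrite P0E; apply: contraT => nbi; case: coefP.
  by exists b, i.
have P0D d : d%:P \in P0 -> d = 0 by rewrite P0E => /PD.
have [Q0 Q0E] := contraction (@polyC E : {rmorphism _ -> _}) Q.
have Q0P0 : {subset Q0 <= P0} by move=> c; rewrite P0E Q0E => /QP.
have [Q0nz|Q0z] := pselect (exists b, b \in Q0 /\ b != 0).
  have P0Q0 := level_maximal_const P0D Q0P0 Q0nz.
  move=> b bP; rewrite -[b]coefK poly_def rpred_sum // => i _.
  by rewrite -mul_polyC mulrC idealMr // -Q0E P0Q0 ?coefP.
have [|s [sP0 s0 sgen]] := level_generator_const P0D.
  by have [c [cP c0]] := P0nz; exists c; rewrite P0E.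
have size_s : (1 < size s)%N.
  rewrite ltnNge; apply: contra s0 => /size1_polyC sc.
  by rewrite sc polyC_eq0; apply/eqP/P0D; rewrite -sc.
have sQ : s%:P \notin Q.
  by apply/negP => sQ; apply: Q0z; exists s; rewrite Q0E.
(* The quantity to minimize is the degree in [x] of the leading coefficient: dividing by the
   nonconstant [s] lowers it, while the constant [c] leaves it unchanged. *)
have [q [[qQ q0] qmin]] := minimize (fun q : S => size (lead_coef q)) exq.
have [c [r [c0 cr]]] := two_level_common sgen (fun i => coefP q i (QP q qQ)).
have r0 : r != 0.
  apply: contraNneq q0 => r0; move/eqP: cr.
  by rewrite r0 mulr0 mulf_eq0 !polyC_eq0 (negPf c0).
have rQ : r \in Q.
  have : s%:P * r \in Q by rewrite -cr idealMr.
  by rewrite prime_idealrM (negPf sQ).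
have le_qr := qmin _ (conj rQ r0).
have : size (lead_coef q) = (size s + size (lead_coef r)).-1.
  rewrite -(size_Cmul _ c0) -(size_mul s0) ?lead_coef_eq0 //.
  by have := congr1 lead_coef cr; rewrite !lead_coefM !lead_coefC => ->.
move: le_qr size_s (lead_coef_eq0 r); rewrite (negPf r0) -size_poly_eq0 /=.
by move: (size (lead_coef r)) => n; lia.
Qed.

(** Over the fraction field of [D] this is the classification of primes in two variables: a prime
    that is not of height at most one is maximal, and it is generated by an [s] in [x] alone and a
    [t] that generates it modulo [s]. *)
Lemma two_level_structure (P : prime_idealr S) :
  (forall d : D, d%:P%:P \in P -> d = 0) ->
  height_le1 P \/ (exists s t, regular_pair P s t) /\
    forall Q : prime_idealr S, {subset Q <= P} -> ~ height_le1 Q -> {subset P <= Q}.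
Proof.
move=> PD; have [|[P0nz Pbig]] := two_level_cases PD; [by left|right].
have [P0 P0E] := contraction (@polyC E : {rmorphism _ -> _}) P.
have P0D d : d%:P \in P0 -> d = 0 by rewrite P0E => /PD.
split; last first.
  move=> Q QP hQ; have [|//|[Q0nz Qbig]] := @two_level_cases Q.
    by move=> d /QP/PD.
  have [Q0 Q0E] := contraction (@polyC E : {rmorphism _ -> _}) Q.
  have Q0P0 : {subset Q0 <= P0} by move=> c; rewrite P0E Q0E => /QP.
  apply: level_maximal_coef => // c; rewrite -[c%:P]/(polyC c) -P0E -Q0E.
  apply: level_maximal_const c => //.
  by have [c [cQ c0]] := Q0nz; exists c; rewrite Q0E.
have [|s [sP0 s0 sgen]] := level_generator_const P0D.
  by have [c [cP c0]] := P0nz; exists c; rewrite P0E.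
have [K [iota [iota0 frac]]] := residue_field P0.
have rP : residue_of iota P by move=> c; rewrite iota0 P0E.
have map0_coef b : map_poly iota b = 0 -> forall i, b`_i \in P0.
  by move=> b0 i; rewrite -iota0 -(coef_map iota) b0 coef0.
have [|t [tP t0 tgen]] := level_generator frac rP.
  have [b [i [bP nbi]]] := Pbig; exists b; split=> //.
  by apply: contraNneq nbi => /map0_coef/(_ i); rewrite P0E.
exists s%:P, t; split=> //; first by rewrite -P0E.
- by rewrite polyC_eq0.
- move=> b bP; have [c [q [nzc /map0_coef/(two_level_common sgen)[d [r [d0 dr]]]]]] :=
    tgen b bP.
  exists (d%:P%:P * c%:P), r, (d%:P%:P * q); split.
    rewrite prime_mul_notin //; last by rewrite -rP.
    by apply: contra d0 => /PD ->.
  by rewrite [r * _]mulrC -dr; ring.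
(* Modulo [P0] the element [s] vanishes and [t] does not, so [c] vanishes there; hence [s] divides
   [c] up to a constant. *)
move=> c d tc; have c0 : map_poly iota c = 0.
  have : map_poly iota t * map_poly iota c = 0.
    rewrite -rmorphM tc rmorphM /= map_polyC /=.
    by move: sP0; rewrite -iota0 => /eqP ->; rewrite mul0r.
  by move/eqP; rewrite mulf_eq0 (negPf t0) => /eqP.
have [e [r [e0 er]]] := two_level_common sgen (map0_coef _ c0).
exists e%:P%:P, r; split=> //; by apply: contra e0 => /PD ->.
Qed.

End TwoLevels.

(** * Points of the projective plane *)

Lemma mpoly_rmorph_eq (n : nat) (A B : comNzRingType)
    (f g : {rmorphism {mpoly A[n]} -> B}) :
  (forall c, f c%:MP = g c%:MP) -> (forall i, f 'X_i = g 'X_i) -> f =1 g.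
Proof.
move=> fgC fgX r; rewrite [r]mpolyE !rmorph_sum; apply: eq_bigr => m _.
rewrite -mul_mpolyC !rmorphM /= fgC mpolyXE_id !rmorph_prod; congr (_ * _).
by apply: eq_bigr => i _; rewrite !rmorphXn /= fgX.
Qed.

Lemma poly_rmorph_eq (A B : comNzRingType) (f g : {rmorphism {poly A} -> B}) :
  (forall c, f c%:P = g c%:P) -> f 'X = g 'X -> f =1 g.
Proof.
move=> fgC fgX r; rewrite -[r]coefK poly_def !rmorph_sum; apply: eq_bigr => i _.
by rewrite -mul_polyC !rmorphM !rmorphXn /= fgC fgX.
Qed.

Lemma ordS3 (i j : 'I_3) : [|| j == i, j == ordS i | j == ordS (ordS i)].
Proof. by move: i j; do 2!case=> [[|[|[|//]]] ?]. Qed.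

Lemma ordS3_neq (i : 'I_3) :
  [/\ ordS i != i, ordS (ordS i) != i & ordS (ordS i) != ordS i].
Proof. by move: i; case=> [[|[|[|//]]] ?]. Qed.

Section Iterated.
Variables (k : fieldType) (i : 'I_3).
Local Notation R := {mpoly k[3]}.
Local Notation S := {poly {poly {poly k}}}.

(** [X_i] is innermost, so that [k[X_i]] serves as the ring [D] of constants when [X_i] lies outside
    the point. *)
Definition iter_var (j : 'I_3) : S :=
  if j == i then 'X%:P%:P else if j == ordS i then 'X%:P else 'X.

Definition iter_const : {rmorphism k -> S} :=
  @polyC {poly {poly k}} \o (@polyC {poly k} \o @polyC k).

Definition to_iter : {rmorphism R -> S} := mmap iter_const iter_var.

Definition of_iter1 : {rmorphism {poly k} -> R} :=
  horner_eval ('X_i : R) \o map_poly (@mpolyC 3 k).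

Definition of_iter2 : {rmorphism {poly {poly k}} -> R} :=
  horner_eval ('X_(ordS i) : R) \o map_poly of_iter1.

Definition of_iter : {rmorphism S -> R} :=
  horner_eval ('X_(ordS (ordS i)) : R) \o map_poly of_iter2.

Lemma to_iterC c : to_iter c%:MP = c%:P%:P%:P.
Proof. exact: mmapC. Qed.

Lemma to_iterX j : to_iter 'X_j = iter_var j.
Proof. by rewrite [LHS]mmapX mmap1U. Qed.

Lemma of_iterE p : of_iter p = (map_poly of_iter2 p).['X_(ordS (ordS i))].
Proof. by []. Qed.

Lemma of_iter2E p : of_iter2 p = (map_poly of_iter1 p).['X_(ordS i)].
Proof. by []. Qed.

Lemma of_iter1E p : of_iter1 p = (map_poly (@mpolyC 3 k) p).['X_i].
Proof. by []. Qed.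

Lemma of_iterC p : of_iter p%:P = of_iter2 p.
Proof. by rewrite of_iterE map_polyC hornerC. Qed.

Lemma of_iterX : of_iter 'X = 'X_(ordS (ordS i)).
Proof. by rewrite of_iterE map_polyX hornerX. Qed.

Lemma of_iter2C p : of_iter2 p%:P = of_iter1 p.
Proof. by rewrite of_iter2E map_polyC hornerC. Qed.

Lemma of_iter2X : of_iter2 'X = 'X_(ordS i).
Proof. by rewrite of_iter2E map_polyX hornerX. Qed.

Lemma of_iter1C c : of_iter1 c%:P = c%:MP.
Proof. by rewrite of_iter1E map_polyC hornerC. Qed.

Lemma of_iter1X : of_iter1 'X = 'X_i.
Proof. by rewrite of_iter1E map_polyX hornerX. Qed.

Lemma to_iterK : cancel to_iter of_iter.
Proof.
apply: (@mpoly_rmorph_eq _ _ _ (of_iter \o to_iter : {rmorphism _ -> _}) idfun).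
  by move=> c; rewrite [LHS](congr1 of_iter (to_iterC c)) of_iterC of_iter2C of_iter1C.
move=> j; rewrite [LHS](congr1 of_iter (to_iterX j)) /iter_var.
case: (j =P i) => [->|ni]; first by rewrite of_iterC of_iter2C of_iter1X.
case: (j =P ordS i) => [->|ni']; first by rewrite of_iterC of_iter2X.
rewrite of_iterX.
by have := ordS3 i j; rewrite (introF eqP ni) (introF eqP ni') => /eqP ->.
Qed.

Lemma of_iterK : cancel of_iter to_iter.
Proof.
have [n1 n2 n3] := ordS3_neq i.
apply: (@poly_rmorph_eq _ _ (to_iter \o of_iter : {rmorphism _ -> _}) idfun); last first.
  by rewrite [LHS](congr1 to_iter of_iterX) to_iterX /iter_var (negPf n2) (negPf n3).
move=> c; rewrite [LHS](congr1 to_iter (of_iterC c)); move: c.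
apply: (@poly_rmorph_eq _ _ (to_iter \o of_iter2 : {rmorphism _ -> _})
  (@polyC {poly {poly k}})); last first.
  by rewrite [LHS](congr1 to_iter of_iter2X) to_iterX /iter_var (negPf n1) eqxx.
move=> c; rewrite [LHS](congr1 to_iter (of_iter2C c)); move: c.
apply: (@poly_rmorph_eq _ _ (to_iter \o of_iter1 : {rmorphism _ -> _})
  (@polyC {poly {poly k}} \o @polyC {poly k} : {rmorphism _ -> _})); last first.
  by rewrite [LHS](congr1 to_iter of_iter1X) to_iterX /iter_var eqxx.
by move=> c; rewrite [LHS](congr1 to_iter (of_iter1C c)) to_iterC.
Qed.

End Iterated.

Arguments to_iter {k} i.
Arguments of_iter {k} i.
Arguments of_iter1 {k} i.

Section Transport.
Variables (A B : comNzRingType) (f : {rmorphism A -> B}) (g : {rmorphism B -> A}).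
Hypotheses (fK : cancel f g) (gK : cancel g f).
Variables (p : prime_idealr A) (P : prime_idealr B).
Hypothesis PE : forall x, (x \in P) = (g x \in p).

Let pE x : (x \in p) = (f x \in P). Proof. by rewrite PE fK. Qed.

Lemma transport_height_le1 : height_le1 P -> height_le1 p.
Proof using fK gK PE.
move=> hP Q Qp [q [qQ q0]] x; have [Q' Q'E] := contraction g Q.
rewrite pE => fx; rewrite -[x]fK -Q'E; apply: hP fx => [y|].
  by rewrite Q'E PE => /Qp.
exists (f q); rewrite Q'E fK; split=> //.
by apply: contra q0 => /eqP fq; rewrite -[q]fK fq rmorph0.
Qed.

Lemma transport_regular_pair s t : regular_pair P s t -> regular_pair p (g s) (g t).
Proof using fK gK PE.
case=> [sP tP s0 gen reg]; split; rewrite -?PE //.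
- by apply: contra s0 => /eqP gs; rewrite -[s]gK gs rmorph0.
- move=> b; rewrite pE => /gen[h [u [v [hP e]]]].
  exists (g h), (g u), (g v); rewrite -PE; split=> //.
  by rewrite -[b]fK -!rmorphM e rmorphD !rmorphM.
- move=> c d e; have [|h [r [hP e']]] := reg (f c) (f d).
    by rewrite -[t]gK -[s]gK -!rmorphM e.
  exists (g h), (g r); rewrite -PE; split=> //.
  by rewrite -[c]fK -!rmorphM e'.
Qed.

End Transport.

Section Points.
Variable k : fieldType.
Local Notation R := {mpoly k[3]}.

Lemma dhomogXi n (i : 'I_n) : ('X_i : {mpoly k[n]}) \is 1.-homog.
Proof. by rewrite dhomogX /= mdeg1. Qed.

Lemma dhomogXin n (i : 'I_n) d : ('X_i ^+ d : {mpoly k[n]}) \is d.-homog.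
Proof. by have := dhomogMn d (dhomogXi i); rewrite mul1n. Qed.

Lemma prime_expr (A : comNzRingType) (P : prime_idealr A) x d :
  x ^+ d \in P -> x \in P.
Proof.
elim: d => [|d IHd]; first by rewrite expr0 idealr1.
by rewrite exprS prime_idealrM => /orP[].
Qed.

(** By homogeneity every term of [d] at [X_i] lies in [p]; since [X_i] does not and [p] is prime, a
    nonzero coefficient would put a unit into [p]. *)
Lemma point_const (p : proj_point k 3) i (d : {poly k}) :
  'X_i \notin (p : {pred R}) -> of_iter1 i d \in (p : {pred R}) -> d = 0.
Proof.
rewrite of_iter1E horner_coef; case: p => p hp /= _ Xi dp.
apply/polyP => e; rewrite coef0; apply/eqP; apply: contraT => de.
have := hp e _ dp; rewrite linear_sum /=.
have lt : (e < size (map_poly (@mpolyC 3 k) d))%N.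
  rewrite size_map_poly_id0 ?mpolyC_eq0 ?lead_coef_eq0; last first.
    by apply: contraNneq de => ->; rewrite coef0.
  by rewrite ltnNge; apply: contra de => h; rewrite nth_default.
rewrite (bigD1 (Ordinal lt)) //= big1 ?addr0 => [|j ne]; last first.
  rewrite coef_map /= mul_mpolyC linearZ /= (@pihomog_ne0 _ _ _ j) ?scaler0 //.
  exact: dhomogXin.
rewrite coef_map /= mul_mpolyC pihomog_dE ?rpredZ ?dhomogXin //.
rewrite -mul_mpolyC prime_idealrM => /orP[cp|/prime_expr]; last by rewrite (negPf Xi).
have := idealMr (d`_e)^-1%:MP cp; rewrite -mpolyCM mulVf //.
by rewrite idealr1.
Qed.

Lemma point_structure (p : proj_point k 3) :
  height_le1 p \/ (exists s t, regular_pair p s t) /\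
    forall Q : prime_idealr R, {subset Q <= p} -> ~ height_le1 Q -> {subset p <= Q}.
Proof.
have [i Xi] : exists i, 'X_i \notin (p : {pred R}) by case: p.
have [P PE] := contraction (of_iter i : {rmorphism _ -> {mpoly k[3]}}) p.
have cP := transport_height_le1 (@to_iterK k i) (@of_iterK k i).
have PD (d : {poly k}) : d%:P%:P \in P -> d = 0.
  by rewrite PE of_iterC of_iter2C => /point_const ->.
case: (two_level_structure PD) => [/(cP _ _ PE)|[[s [t st]] Pmax]]; [by left|right].
split.
  exists (of_iter i s), (of_iter i t).
  exact: (transport_regular_pair (@to_iterK k i) (@of_iterK k i)) st.
move=> Q Qp hQ x xp; have [Q' Q'E] := contraction (of_iter i : {rmorphism _ -> {mpoly k[3]}}) Q.
rewrite -[x](@to_iterK k i) -Q'E; apply: Pmax.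
- by move=> y; rewrite Q'E PE => /Qp.
- by move/(cP _ _ Q'E)/hQ.
- by rewrite PE to_iterK.
Qed.

End Points.

Arguments dhomogXin {k n} i d.

Lemma zero_prime (A : idomainType) : exists Z : prime_idealr A, forall x, x \in Z <-> x = 0.
Proof.
apply: mk_prime.
- by split=> // a x y -> ->; rewrite mulr0 addr0.
- by apply/eqP; rewrite oner_eq0.
- by move=> u v /eqP; rewrite mulf_eq0 => /orP[]/eqP; [left|right].
Qed.

(** Otherwise the height of [P] in terms of chains would be zero or one, below the bound imposed by
    the codimension. *)
Lemma codim2_height (A : idomainType) (I : idealr A) (P : prime_idealr A) :
  codim_is I 2 -> {subset I <= P} -> ~ height_le1 P.
Proof.
move=> [_ cod] IP hP.
have [[q [qP q0]]|Pz] := pselect (exists q, q \in P /\ q != 0).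
  suff hgt : height_is P 1 by have := cod P 1%N IP hgt.
  have [Z ZE] := zero_prime A.
  split.
    exists (fun i : 'I_2 => if i == ord0 then Z else P); split=> //.
    case=> [[|[|//]] ?] [[|[|//]] ?] //= _.
    split=> [x /ZE ->|PZ]; first exact: idealr0.
    by have /ZE/eqP := PZ q qP; rewrite (negPf q0).
  move=> n [c [cinc cE]]; rewrite leqNgt; apply/negP => n1.
  have n2 : (n.-1 < n.+1)%N by lia.
  have n3 : (0 < n.+1)%N by [].
  (* In a longer chain the last prime but one is nonzero, since it strictly contains the first; so
     it would contain [P]. *)
  have [_ []] := cinc (Ordinal n2) ord_max ltac:(rewrite /=; lia).
  move=> x; rewrite cE; apply: hP => [y yc|].
    by rewrite -cE; have [sub _] := cinc (Ordinal n2) ord_max ltac:(rewrite /=; lia); apply: sub.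
  apply: contrapT => no.
  have [_ []] := cinc (Ordinal n3) (Ordinal n2) ltac:(rewrite /=; lia).
  move=> y yc; have -> : y = 0; last exact: idealr0.
  by apply/eqP; apply: contraT => y0; case: no; exists y.
suff hgt : height_is P 0 by have := cod P 0%N IP hgt.
split; first by exists (fun _ => P); split=> // -[[|//] ?] [[|//] ?].
move=> n [c [cinc cE]]; rewrite leqNgt; apply/negP => n1.
have n3 : (0 < n.+1)%N by [].
have [_ []] := cinc (Ordinal n3) ord_max n1.
move=> x; rewrite cE => xP; have -> : x = 0; last exact: idealr0.
by apply/eqP; apply: contraT => x0; case: Pz; exists x.
Qed.

(** A prime containing [I] and avoiding all products [g * b ^+ N] lies inside [p]; not being of
    height at most one, it equals [p] and thus contains [b], a contradiction. *)
Lemma point_radical (k : fieldType) (I : idealr {mpoly k[3]}) (p : proj_point k 3) :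
  codim_is I 2 -> {subset I <= p} ->
  (exists s t, regular_pair p s t) /\
  (forall b, b \in (p : {pred _}) ->
     exists g N, g \notin (p : {pred _}) /\ g * b ^+ N \in (I : {pred _})).
Proof.
move=> cod Ip; have := point_structure p.
case=> [/(codim2_height cod Ip)//|[reg pmax]]; split=> // b bp.
apply: contrapT => no.
have [||||Q [IQ QS]] := @prime_avoiding _ (fun x => x \in (I : {pred _}))
  (fun x => exists g N, g \notin (p : {pred _}) /\ x = g * b ^+ N).
- exact: ideal_is_ideal.
- by exists 1, 0%N; rewrite idealr1 expr0 mulr1.
- move=> _ _ [g [N [gp ->]]] [h [M [hp ->]]]; exists (g * h), (N + M)%N.
  by rewrite prime_mul_notin // exprD; split=> //; ring.
- by move=> _ [g [N [gp ->]]] gI; apply: no; exists g, N.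
have Qp : {subset Q <= p}.
  move=> x xQ; apply: contraT => xp; have := QS x; rewrite xQ; apply.
  by exists x, 0%N; rewrite expr0 mulr1.
have /(_ b bp) : {subset p <= Q}.
  by apply: pmax => //; apply: codim2_height cod _ => x /IQ.
by apply/negP/QS; exists 1, 1%N; rewrite idealr1 mul1r expr1.
Qed.

(** * Local generators from the resolution *)

Lemma common_multiplier (A : comNzRingType) (S : A -> Prop) (T : finType)
    (Q : T -> A -> Prop) :
  S 1 -> (forall g h, S g -> S h -> S (g * h)) ->
  (forall i g h, Q i g -> Q i (h * g)) ->
  (forall i, exists g, S g /\ Q i g) -> exists g, S g /\ forall i, Q i g.
Proof.
move=> S1 SM QM /choice[g gP]; exists (\prod_i g i); split.
  by apply: (big_ind S) => // i _; case: (gP i).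
by move=> i; rewrite (bigD1 i) //= mulrC; apply: QM; case: (gP i).
Qed.

Section PrimeMultipliers.
Variables (A : idomainType) (p : prime_idealr A).

Lemma common_prime_multiplier (T : finType) (Q : T -> A -> Prop) :
  (forall i g h, Q i g -> Q i (h * g)) ->
  (forall i, exists g, g \notin p /\ Q i g) ->
  exists g, g \notin p /\ forall i, Q i g.
Proof.
apply: (common_multiplier (S := fun g => g \notin p)); first by rewrite idealr1.
exact: prime_mul_notin.
Qed.

Lemma notin_neq0 g : g \notin p -> g != 0.
Proof. by apply: contraNneq => ->; rewrite idealr0. Qed.

Lemma finite_free_regular (V : lmodType A) (s t : A) (c d : V) :
  (forall c d, t * c = s * d -> exists g e, g \notin p /\ g * c = s * e) ->
  finite_free V -> t *: c = s *: d ->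
  exists g e, g \notin p /\ g *: c = s *: e.
Proof.
move=> reg [n [e [e' e'K eK]]] tcsd.
have [] := @common_prime_multiplier _
  (fun (i : 'I_n) g => exists x, g * e' c 0 i = s * x).
- by move=> i g h [x gx]; exists (h * x); rewrite -mulrA gx mulrCA.
- move=> i; have := reg (e' c 0 i) (e' d 0 i).
  have -> : t * e' c 0 i = s * e' d 0 i.
    have /(congr1 e')/rowP/(_ i) : e (t *: e' c) = e (s *: e' d).
      by rewrite !linearZ_LR !eK.
    by rewrite !e'K !mxE.
  by move=> /(_ erefl)[g [x [gp gx]]]; exists g; split=> //; exists x.
move=> g [gp /choice[x gx]]; exists g, (e (\row_i x i)); split=> //.
rewrite -[c]eK -!linearZ_LR; congr (e _).
by apply/rowP => i; rewrite !mxE gx.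
Qed.

Lemma finite_free_torsion_free (V : lmodType A) (s : A) (c : V) :
  finite_free V -> s != 0 -> s *: c = 0 -> c = 0.
Proof.
move=> [n [e [e' e'K eK]]] s0 sc; rewrite -[c]eK.
suff -> : e' c = 0 by rewrite linear0.
apply/rowP => i; rewrite mxE; apply/eqP.
have /(congr1 e')/rowP/(_ i)/eqP : e (s *: e' c) = e 0 by rewrite linearZ_LR eK sc linear0.
by rewrite !e'K !mxE mulf_eq0 (negPf s0).
Qed.

End PrimeMultipliers.

Section KoszulIdentities.
Variables (A : comNzRingType) (V : lmodType A).

Lemma scaler_swap (a b : A) (v : V) : a *: (b *: v) = b *: (a *: v).
Proof. by rewrite !scalerA mulrC. Qed.

Lemma koszul_regroup (g h s t : A) (a b c d : V) :
  g *: (s *: a + t *: b) - h *: (s *: c + t *: d) =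
  s *: (g *: a - h *: c) + t *: (g *: b - h *: d).
Proof.
rewrite !scalerDr !scalerN !(scaler_swap s) !(scaler_swap t) opprD.
by rewrite addrACA.
Qed.

Lemma koszul_cycle (l s t : A) (c1 c2 e : V) :
  t *: c2 = s *: (- c1) -> l *: c2 = s *: e -> s *: (l *: c1 + t *: e) = 0.
Proof.
move=> tc le; rewrite scalerDr (scaler_swap s t) -le (scaler_swap t) tc.
by rewrite !scalerN scaler_swap subrr.
Qed.

Lemma koszul_cancel (l s t : A) (a b c : V) :
  s *: (l *: a + t *: c) + t *: (l *: b - s *: c) = l *: (s *: a + t *: b).
Proof.
rewrite !scalerDr !scalerN (scaler_swap s l) (scaler_swap t l) (scaler_swap t s).
by rewrite addrACA subrr addr0.
Qed.

End KoszulIdentities.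

Section TorsionChase.
Variables (A : idomainType) (p : prime_idealr A) (m n : nat) (I : idealr A).
Local Notation F := 'rV[A]_m.
Local Notation G := 'rV[A]_n.
Variables (phi : {linear F -> G}) (psi : {linear G -> ideal_mod I}).
Hypothesis cplx2_inj : injective (cplx2 phi).
Hypothesis exact1 : exact_at (cplx2 phi) (cplx1 phi).
Hypothesis exact0 : exact_at (cplx1 phi) (cplx0 psi).
Variables s t : A.
Hypothesis st_reg : regular_pair p s t.

Lemma prime_row_split (v : G) : (forall j, v 0 j \in p) ->
  exists g v1 v2, g \notin p /\ g *: v = s *: v1 + t *: v2.
Proof using st_reg.
move=> vp; have [_ _ _ gen _] := st_reg.
have [] := @common_prime_multiplier _ p _
  (fun (i : 'I_n) g => exists xy : A * A, g * v 0 i = s * xy.1 + t * xy.2).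
- move=> i g h [xy e]; exists (h * xy.1, h * xy.2) => /=.
  by rewrite -mulrA e; ring.
- move=> i; have [g [x [y [gp e]]]] := gen _ (vp i).
  by exists g; split=> //; exists (x, y); rewrite e /=; ring.
move=> g [gp /choice[xy gxy]].
exists g, (\row_i (xy i).1), (\row_i (xy i).2); split=> //.
by apply/rowP => i; rewrite !mxE gxy.
Qed.

Lemma ideal_mod_torsion_free (J : idealr A) (a : A) (x : ideal_mod J) :
  a *: x = 0 -> a != 0 -> x = 0.
Proof.
move=> ax a0; apply: ideal_elt_inj; apply/eqP; rewrite -[ideal_elt 0]/(0 : A).
have /eqP := congr1 (@ideal_elt A J) ax; rewrite ideal_eltZ.
by rewrite -[ideal_elt 0]/(0 : A) mulf_eq0 (negPf a0).
Qed.

(* The image of [w = u /\ u'] lies in [p (F * G)], so [g d2 w = s T1 + t T2] for some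
   [g] outside [p]. Then [(d1 T1, d1 T2)] is a Koszul cycle on [(s, t)], and lifting
   back through the complex puts a multiple of [w] in [(s, t)]. *)
Lemma kernel_minors (u u' : F) :
  (forall j, phi u 0 j \in p) -> (forall j, phi u' 0 j \in p) ->
  forall i j, u 0 i * u' 0 j - u 0 j * u' 0 i \in p.
Proof using cplx2_inj exact1 exact0 st_reg.
have [sp tp s0 gen reg] := st_reg.
move=> /prime_row_split[g [v1 [v2 [gp gE]]]] /prime_row_split[h [v1' [v2' [hp hE]]]] i j.
have [T1 [T2 dw]] : exists T1 T2,
    cplx2 phi ((g * h) *: wedge u u') = s *: T1 + t *: T2.
  exists (g *: tens u v1' - h *: tens u' v1), (g *: tens u v2' - h *: tens u' v2).
  rewrite -koszul_regroup -!tensZr -!tensDr -hE -gE !tensZr !scalerA [h * g]mulrC.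
  by rewrite linearZ_LR cplx2E scalerBr.
have d1w : t *: cplx1 phi T2 = s *: (- cplx1 phi T1).
  have : cplx1 phi (s *: T1 + t *: T2) = 0.
    by rewrite -dw; apply/exact1; exists ((g * h) *: wedge u u').
  by rewrite (linearD (cplx1 phi)) !(linearZ_LR (cplx1 phi)) scalerN => /eqP; rewrite addrC addr_eq0 => /eqP.
have Sfree := sym2_free A n; have Tfree := tensor_free A m n.
have [l [e [lp lE]]] := finite_free_regular reg Sfree d1w.
have e1 : l *: cplx1 phi T1 = - (t *: e).
  apply/eqP; rewrite -subr_eq0 opprK; apply/eqP.
  apply: (finite_free_torsion_free Sfree s0).
  exact: koszul_cycle d1w lE.
(* [s *: e] is a boundary, so [s] kills the image of [e] in [I^2], which is torsion free; hence [e]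
   is a boundary too. *)
have [T3 T3E] : exists T3, cplx1 phi T3 = e.
  apply/exact0/(@ideal_mod_torsion_free _ s) => //.
  rewrite -linearZ_LR -lE -linearZ_LR; apply/exact0.
  by exists (l *: T2).
(* Corrected by [T3], multiples of [T1] and [T2] become cycles, hence boundaries; the two
   corrections cancel in the combination with [s] and [t]. *)
have [w1 w1E] : exists w1, cplx2 phi w1 = l *: T1 + t *: T3.
  by apply/exact1; rewrite (linearD (cplx1 phi)) !(linearZ_LR (cplx1 phi)) e1 T3E addNr.
have [w2 w2E] : exists w2, cplx2 phi w2 = l *: T2 - s *: T3.
  by apply/exact1; rewrite (linearB (cplx1 phi)) !(linearZ_LR (cplx1 phi)) lE T3E addrN.
have wE : (l * (g * h)) *: wedge u u' = s *: w1 + t *: w2.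
  apply: cplx2_inj; rewrite -scalerA (linearZ_LR (cplx2 phi)) dw.
  rewrite (linearD (cplx2 phi)) !(linearZ_LR (cplx2 phi)) w1E w2E.
  exact/esym/koszul_cancel.
have := congr1 (wcoord (i, j)) wE.
rewrite (linearD (wcoord (i, j))) !(linearZ_LR (wcoord (i, j))) wcoordE /= => cE.
have : (l * (g * h)) * (u 0 i * u' 0 j - u 0 j * u' 0 i) \in p.
  rewrite [X in X \in _]cE -[_ *: _]/(s * _) -[t *: _]/(t * _).
  by rewrite rpredD // mulrC idealMr.
by rewrite prime_idealrM; have := prime_mul_notin lp (prime_mul_notin gp hp) => /negPf ->.
Qed.

Lemma residue_rank (K : fieldType) (iota : {rmorphism A -> K}) :
  (forall a, (iota a == 0) = (a \in p)) ->
  (forall x, exists a b, iota b != 0 /\ x = iota a / iota b) ->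
  (m <= (\rank (map_mx iota (lin1_mx phi))).+1)%N.
Proof using cplx2_inj exact1 exact0 st_reg.
move=> iota0 frac; set M := map_mx _ _; rewrite leqNgt; apply/negP => lt.
have ker2 : (1 < \rank (kermx M))%N by rewrite mxrank_ker; lia.
have [W [Wfree WM]] : exists W : 'M_(\rank (kermx M), m), row_free W /\ W *m M = 0.
  exists (row_base (kermx M)); split; first exact: row_base_free.
  by apply/sub_kermxP; rewrite eq_row_base.
move: (\rank (kermx M)) ker2 W Wfree WM => r r2 W Wfree WM.
have [c [N [nzc cN]]] := clear_denominators frac W.
pose i0 := Ordinal (ltnW r2); pose i1 := Ordinal r2.
have rowW i j : iota (N i j) = iota c * W i j.
  by have /matrixP/(_ i j) := cN; rewrite !mxE.
have ker_p i j : phi (row i N) 0 j \in p.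
  rewrite -mul_rV_lin1 -iota0.
  have : row i (iota c *: W) *m M = 0.
    by rewrite -row_mul -scalemxAl WM scaler0 row0.
  rewrite cN -map_row -map_mxM => /rowP/(_ j).
  by rewrite !mxE => ->.
have minors i j : W i0 i * W i1 j = W i0 j * W i1 i.
  have := kernel_minors (ker_p i0) (ker_p i1) i j; rewrite -iota0 rmorphB !rmorphM.
  rewrite ![row _ _ _ _]mxE !rowW subr_eq0 => /eqP E.
  by apply: (mulfI (mulf_neq0 nzc nzc)); rewrite mulrACA E mulrACA.
have Winj (v : 'rV_r) : v *m W = 0 -> v = 0.
  by move/eqP; rewrite mulmx_free_eq0 // => /eqP.
(* Vanishing minors give the row relation [W i1 i *: W i0 = W i0 i *: W i1], so independence of the
   rows kills [W i0 i]. *)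
have W0 i : W i0 i = 0.
  have /Winj/rowP/(_ i1) :
      (W i1 i *: delta_mx 0 i0 - W i0 i *: delta_mx 0 i1) *m W = 0 :> 'rV_m.
    apply/rowP => j; rewrite mulmxBl -!scalemxAl -!rowE !mxE.
    by rewrite [W i1 i * _]mulrC -minors subrr.
  by rewrite !mxE !eqxx /= mulr0 mulr1 sub0r => /eqP; rewrite oppr_eq0 => /eqP.
have /Winj/rowP/(_ i0) : delta_mx 0 i0 *m W = 0 :> 'rV_m.
  by apply/rowP => j; rewrite -rowE !mxE W0.
by rewrite !mxE !eqxx => /eqP; rewrite oner_eq0.
Qed.

End TorsionChase.

Lemma rank_minor (K : fieldType) m n (M : 'M[K]_(m, n)) :
  exists (g : 'I_(\rank M) -> 'I_m) (f : 'I_(\rank M) -> 'I_n),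
    injective f /\ mxsub g f M \in unitmx.
Proof.
pose g := maxrankfun M; pose B := rowsub g M.
have Bf : row_full B^T.
  by rewrite /row_full mxrank_tr; have := maxrowsub_free M; rewrite /row_free.
exists g, (fullrankfun Bf); split; first exact: fullrankfun_inj.
have -> : mxsub g (fullrankfun Bf) M = (rowsub (fullrankfun Bf) B^T)^T.
  by apply/matrixP => i j; rewrite !mxE.
by rewrite unitmx_tr fullrowsub_unit.
Qed.

(** The indices [i] and [j] may coincide when fewer than two values are missed; if none is, [ord0]
    is a mere default. *)
Lemma codim2_complement r n (f : 'I_r -> 'I_n.+1) : injective f -> (n <= r.+1)%N ->
  exists i j, forall l, l \notin codom f -> l = i \/ l = j.
Proof.
move=> finj le; pose C := [set l | l \notin codom f].
have cC : (#|C| <= 2)%N.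
  have := cardsC [set l | l \in codom f].
  have -> : ~: [set l | l \in codom f] = C by apply/setP => l; rewrite !inE.
  rewrite card_ord cardsE card_codom // card_ord; lia.
have CE l : (l \in C) = (l \notin codom f) by rewrite inE.
have [i iC|C0] := pickP [pred l | l \in C]; last first.
  by exists ord0, ord0 => l; rewrite -CE => lC; have := C0 l; rewrite /= lC.
have [j /andP[/= jC ji]|C1] := pickP [pred j in C | j != i]; last first.
  exists i, i => l; rewrite -CE => lC; have := C1 l; rewrite /= lC /=.
  by move/negbFE/eqP; left.
exists i, j => l; rewrite -CE => lC; apply: contrapT => /not_orP[/eqP li /eqP lj].
suff : (2 < #|C|)%N by lia.
rewrite /= in iC; rewrite (cardsD1 i) iC (cardsD1 j) in_setD1 ji jC.
by rewrite (cardsD1 l) !in_setD1 li lj lC.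
Qed.

Section LocalGenerators.
Variables (A : idomainType) (p : prime_idealr A) (m : nat) (I : idealr A).
Variables (phi : {linear 'rV[A]_m -> 'rV[A]_m.+1}).
Variables (psi : {linear 'rV[A]_m.+1 -> ideal_mod I}).
Hypothesis psi_phi0 : forall u, psi (phi u) = 0.
Hypothesis psi_surj : surjective psi.
Variables (K : fieldType) (iota : {rmorphism A -> K}).
Hypothesis iota0 : forall a, (iota a == 0) = (a \in p).
Hypothesis rank_phi : (m <= (\rank (map_mx iota (lin1_mx phi))).+1)%N.

Local Notation y l := (ideal_elt (psi (rv l))).

Lemma psi_sum v : ideal_elt (psi v) = \sum_l v 0 l * y l.
Proof.
rewrite {1}[v]row_sum_rv linear_sum.
elim/big_rec2: _ => [//|l x z _ <-]; rewrite ideal_eltD linearZ_LR.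
by rewrite ideal_eltZ.
Qed.

(** Cramer's rule: the rows of [phi] in a maximal minor that is nonzero at [p] are relations among
    the generators. The adjugate solves them, up to the determinant, for the generators in the minor
    in terms of the at most two others. *)
Lemma local_generators : exists i j g, g \notin p /\
  forall x, x \in I -> exists a b, g * x = a * y i + b * y j.
Proof using psi_phi0 psi_surj iota0 rank_phi.
have [g [f [finj unit]]] := rank_minor (map_mx iota (lin1_mx phi)).
have [i [j ij]] := codim2_complement finj rank_phi.
set Phi := lin1_mx phi in g f finj unit ij *.
pose M := mxsub g f Phi.
exists i, j, (\det M).
have detM : \det M \notin p.
  rewrite -iota0 -det_map_mx map_mxsub.
  by move: unit; rewrite unitmxE unitfE.
split=> // z zI; have [v vE] := psi_surj (IdealMod (zI : z \in ideal_pred I)).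
pose inJ x := exists a b, x = a * y i + b * y j.
have inJD x x' : inJ x -> inJ x' -> inJ (x + x').
  by move=> [a [b ->]] [a' [b' ->]]; exists (a + a'), (b + b'); ring.
have inJM c x : inJ x -> inJ (c * x).
  by move=> [a [b ->]]; exists (c * a), (c * b); ring.
have inJ0 : inJ 0 by exists 0, 0; ring.
have inJ_sum (T : finType) (P : pred T) (F : T -> A) :
    (forall l, P l -> inJ (F l)) -> inJ (\sum_(l | P l) F l).
  by move=> FJ; apply: (big_ind inJ).
have yJ l : l \notin codom f -> inJ (y l).
  by move=> /ij[->|->]; [exists 1, 0 | exists 0, 1]; ring.
have MyJ a : inJ (\sum_b M a b * y (f b)).
  have := psi_sum (phi (rv (g a))); rewrite psi_phi0 -[ideal_elt 0]/(0 : A).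
  have PhiE l : phi (rv (g a)) 0 l = Phi (g a) l by rewrite -mul_rV_lin1 -rowE mxE.
  rewrite (bigID (mem (codom f))) /= => /esym/eqP; rewrite addr_eq0 => /eqP.
  have -> : \sum_(l | l \in codom f) phi (rv (g a)) 0 l * y l =
      \sum_b M a b * y (f b).
    rewrite (reindex_omap f (fun l => [pick b | f b == l])); last first.
      move=> l /codomP[b ->]; case: pickP => [b' /eqP <- //|/(_ b)].
      by rewrite eqxx.
    apply: eq_big => [b|b _]; last by rewrite PhiE !mxE.
    by rewrite codom_f /=; case: pickP => [b' /eqP/finj -> |/(_ b)]; rewrite !eqxx.
  move=> ->; rewrite -mulN1r; apply/inJM/inJ_sum => l lf.
  by apply/inJM/yJ.
have yfJ b : inJ (\det M * y (f b)).
  have -> : \det M * y (f b) = \sum_a \adj M b a * \sum_b' M a b' * y (f b').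
    have E b' : \sum_a \adj M b a * M a b' = \det M *+ (b == b').
      by have /matrixP/(_ b b') := mul_adj_mx M; rewrite [LHS]mxE [RHS]mxE.
    transitivity (\sum_b' (\sum_a \adj M b a * M a b') * y (f b')).
      rewrite (bigD1 b) //= E eqxx mulr1n big1 ?addr0 // => b' ne.
      by rewrite E eq_sym (negPf ne) mulr0n mul0r.
    under eq_bigr do rewrite mulr_suml.
    rewrite exchange_big; apply: eq_bigr => a _; rewrite mulr_sumr.
    by apply: eq_bigr => b' _; rewrite mulrA.
  by apply: inJ_sum => a _; apply/inJM.
have -> : z = \sum_l v 0 l * y l by rewrite -psi_sum vE.
change (inJ (\det M * \sum_l v 0 l * y l)).
rewrite mulr_sumr; apply: inJ_sum => l _; rewrite mulrCA; apply/inJM.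
have [/codomP[b ->]//|lf] := boolP (l \in codom f).
by apply/inJM/yJ.
Qed.

End LocalGenerators.

Section LocalRegular.
Variables (A : idomainType) (p : prime_idealr A) (I : idealr A).
Variables s t : A.
Hypothesis st_reg : regular_pair p s t.
Hypothesis radical : forall b, b \in p -> exists g N, g \notin p /\ g * b ^+ N \in I.
Hypothesis Ip : {subset I <= p}.

(** Factors [t] are cancelled modulo [s] one at a time; then the exponent of [s] is lowered by
    dividing the relation by [s]. *)
Lemma regular_pair_powers M N c d : t ^+ M * c = s ^+ N * d ->
  exists g e, g \notin p /\ g * c = s ^+ N * e.
Proof using st_reg.
have [sp tp s0 gen reg] := st_reg.
have regt K u v : t ^+ K * u = s * v -> exists g e, g \notin p /\ g * u = s * e.
  elim: K u v => [|K IHK] u v.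
    by rewrite expr0 mul1r => ->; exists 1, v; rewrite idealr1 mul1r.
  rewrite exprS -mulrA => /reg[g [e [gp]]]; rewrite mulrCA => /IHK[h [e' [hp he]]].
  by exists (h * g), e'; rewrite prime_mul_notin // -mulrA.
elim: N c d => [|N IHN] c d.
  by move=> _; exists 1, c; rewrite idealr1 expr0 !mul1r.
rewrite exprS -mulrA => /[dup] E /regt[g [e [gp ge]]].
have : t ^+ M * e = s ^+ N * (g * d).
  apply: (mulfI s0); rewrite mulrCA -ge [t ^+ M * _]mulrCA E; ring.
move/IHN => [h [e' [hp he]]]; exists (h * g), e'.
by rewrite prime_mul_notin // -!mulrA ge mulrCA he.
Qed.

Variables x y : A.
Hypotheses (xI : x \in I) (yI : y \in I).
Variable g : A.
Hypothesis gp : g \notin p.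
Hypothesis gen : forall z, z \in I -> exists a b, g * z = a * x + b * y.

(* [I] contains a regular pair [(S, T)], and it kills the first Koszul homology of
   [(x, y)]; a cycle [(c, a)] is thus a boundary after division by [S]. *)
Lemma local_regular : x != 0 /\
  forall c a, c * y = a * x -> exists h e, h \notin p /\ h * c = e * x.
Proof using st_reg radical Ip xI yI gp gen.
have [sp tp s0 _ _] := st_reg.
have [g1 [N [g1p SI]]] := radical sp; have [g2 [M [g2p TI]]] := radical tp.
set S := g1 * s ^+ N in SI; set T := g2 * t ^+ M in TI.
have S0 : S != 0 by rewrite mulf_neq0 ?expf_neq0 // (notin_neq0 g1p).
have regST c d : T * c = S * d -> exists h e, h \notin p /\ h * c = S * e.
  rewrite /T /S => E; have [|h [e [hp he]]] := @regular_pair_powers M N (g2 * c) (g1 * d).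
    by rewrite mulrA [t ^+ M * _]mulrC E; ring.
  exists (g1 * (h * g2)), e; rewrite !prime_mul_notin //.
  by rewrite -!mulrA he; split=> //; ring.
have g0 := notin_neq0 gp.
have [a1 [a2 SE]] := gen SI; have [b1 [b2 TE]] := gen TI.
have x0 : x != 0.
  (* If [x] were zero, [g * S] and [g * T] would both be multiples of [y]; regularity of [(S, T)]
     would then make [y] divide an element outside [p]. *)
  apply/eqP => x0; have [|h [e [hp he]]] := regST a2 b2.
    apply: (mulfI g0); have -> : g * (T * a2) = g * T * a2 by ring.
    have -> : g * (S * b2) = g * S * b2 by ring.
    rewrite SE TE x0; ring.
  have : h * g = e * y.
    apply: (mulfI S0); have -> : S * (h * g) = h * (g * S) by ring.
    by rewrite SE x0 mulr0 add0r mulrA he mulrA.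
  have hgp := prime_mul_notin hp gp => E.
  by move: hgp; rewrite E idealMr // Ip.
split=> // c a ca.
(* By [c * y = a * x], multiplying [c] by [g * S] or [g * T], which are combinations of [x] and [y],
   gives a multiple of [x]; [tA] and [tB] are the cofactors. *)
pose tA := a1 * c + a2 * a; pose tB := b1 * c + b2 * a.
have Sc : g * S * c = tA * x.
  rewrite SE /tA; have -> : (a1 * x + a2 * y) * c = a1 * x * c + a2 * (c * y) by ring.
  by rewrite ca; ring.
have Tc : g * T * c = tB * x.
  rewrite TE /tB; have -> : (b1 * x + b2 * y) * c = b1 * x * c + b2 * (c * y) by ring.
  by rewrite ca; ring.
have [|h [e [hp he]]] := regST tA tB.
  apply: (mulIf x0); apply: (mulfI g0).
  have -> : g * (T * tA * x) = g * T * (tA * x) by ring.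
  have -> : g * (S * tB * x) = g * S * (tB * x) by ring.
  by rewrite -Sc -Tc; ring.
exists (h * g), e; rewrite prime_mul_notin //; split=> //.
apply: (mulfI S0); have -> : S * (e * x) = S * e * x by ring.
rewrite -he; have -> : h * tA * x = h * (tA * x) by ring.
by rewrite -Sc; ring.
Qed.

End LocalRegular.

(** * Stalks *)

Section IdealGen.
Variable A : comNzRingType.

(** Coefficients indexed by [nat] keep their type when the sequence is truncated. *)
Lemma in_ideal_genP (s : seq A) x :
  in_ideal_gen s x <-> exists c : nat -> A, x = \sum_(i < size s) c i * s`_i.
Proof.
split=> [[c ->]|[c ->]]; last by exists (fun i => c i).
exists (fun i => if insub i is Some j then c j else 0).
by apply: eq_bigr => i _; rewrite valK.
Qed.

Lemma in_ideal_gen_takeP (s : seq A) i x : (i <= size s)%N ->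
  in_ideal_gen (take i s) x <-> exists c : nat -> A, x = \sum_(j < i) c j * s`_j.
Proof.
move=> le; rewrite in_ideal_genP size_takel //.
by split=> -[c ->]; exists c; apply: eq_bigr => j _; rewrite nth_take.
Qed.

End IdealGen.

Section Components.
Variables (k : fieldType) (n : nat).
Local Notation R := {mpoly k[n]}.
Local Notation piH := (@pihomog n k mdeg).

Lemma sum_components (f : R) : exists K, forall L, (K <= L)%N -> f = \sum_(d < L) piH d f.
Proof. by exists (mmeasure mdeg f) => L le; apply: pihomog_partitionE. Qed.

Lemma pihomog_mul_homog d e (a f : R) : f \is d.-homog ->
  piH e (a * f) = if (d <= e)%N then piH (e - d) a * f else 0.
Proof.
move=> hf; have [K aK] := sum_components a.
have -> : piH e (a * f) = \sum_(i < (K + e).+1) piH e (piH i a * f).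
  rewrite -(raddf_sum (@pihomog n k mdeg e)) -mulr_suml -aK //.
  by rewrite leqW ?leq_addr.
have hi i : piH i a * f \is (i + d).-homog by rewrite dhomogM // pihomogP.
case: ifP => [le|/negbT nle]; last first.
  by apply: big1 => i _; rewrite (pihomog_ne0 _ (hi i)) //; lia.
have lt : (e - d < (K + e).+1)%N by lia.
rewrite (bigD1 (Ordinal lt)) //= big1 ?addr0 => [|i ne].
  by rewrite pihomog_dE //; have := hi (e - d)%N; rewrite subnK.
rewrite (pihomog_ne0 _ (hi i)) //; apply: contra ne => /eqP E.
by rewrite -val_eqE /=; lia.
Qed.

(** The cofactor has degree [e - d], or is zero if [e < d]; describing it by its products with forms
    of degree [d] covers both cases without subtraction. *)
Lemma pihomog_mulr d e (a f : R) : f \is d.-homog ->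
  exists a', piH e (a * f) = a' * f /\ forall h, h \is d.-homog -> a' * h \is e.-homog.
Proof.
move=> hf; rewrite (pihomog_mul_homog e a hf); case: ifP => le.
  exists (piH (e - d) a); split=> // h hh.
  by rewrite -[e in e.-homog](subnK le) dhomogM // pihomogP.
by exists 0; rewrite mul0r; split=> // h _; rewrite mul0r dhomog0.
Qed.

Lemma pihomog_mull d e (a f : R) : f \is d.-homog -> piH (e + d) (a * f) = piH e a * f.
Proof. by move=> hf; rewrite (pihomog_mul_homog _ _ hf) leq_addl addnK. Qed.

Lemma component_notin (p : idealr R) (f : R) : f \notin (p : {pred R}) ->
  exists e, piH e f \notin (p : {pred R}).
Proof.
move=> fp; apply: contrapT => no; case/negP: fp; have [K fK] := sum_components f.
rewrite (fK K (leqnn K)) rpred_sum // => i _; apply: contraT => ni.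
by case: no; exists i.
Qed.

Definition homog_mult (p : prime_idealr R) (g : R) :=
  (exists d, g \is d.-homog) /\ g \notin (p : {pred R}).

Lemma homog_mult1 p : homog_mult p 1.
Proof. by split; [exists 0%N; apply: dhomog1 | rewrite idealr1]. Qed.

Lemma homog_multM p g h : homog_mult p g -> homog_mult p h -> homog_mult p (g * h).
Proof.
move=> [[d hg] gp] [[e hh] hp]; split; last exact: prime_mul_notin.
by exists (d + e)%N; apply: dhomogM.
Qed.

Lemma homog_mult_prod p (T : finType) (P : pred T) (F : T -> R) :
  (forall i, P i -> homog_mult p (F i)) -> homog_mult p (\prod_(i | P i) F i).
Proof.
by move=> FS; apply: (big_ind (homog_mult p)) => //; [exact: homog_mult1 | exact: homog_multM].
Qed.

End Components.

Lemma frac_clear (K : fieldType) r (a b : K) (u v f h : 'I_r -> K) :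
  b != 0 -> (forall i, v i != 0) -> (forall i, h i != 0) ->
  a / b = \sum_i u i / v i * (f i / h i) ->
  (\prod_i (v i * h i)) * a = \sum_i b * u i * (\prod_(j | j != i) (v j * h j)) * f i.
Proof.
move=> b0 v0 h0 /(canRL (divfK b0)) ->; rewrite mulrA mulr_sumr mulr_suml.
apply: eq_bigr => i _; rewrite (bigD1 i) //=.
set P := \prod_(_ | _) _; have vi := v0 i; have hi := h0 i.
by field; rewrite vi hi.
Qed.

Lemma frac_cancel (K : fieldType) (d f h x : K) : h != 0 ->
  d * f / x = d * h / x * (f / h).
Proof.
by move=> h0; move: (x^-1) => y; field.
Qed.

Section Stalks.
Variables (k : fieldType) (n : nat) (p : proj_point k n).
Local Notation R := {mpoly k[n]}.
Local Notation "x %:F" := (@tofrac R x).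
Local Notation piH := (@pihomog n k mdeg).
Local Notation hmult := (homog_mult p).

Lemma local_valD (x y : local_ring p) : local_val (x + y) = local_val x + local_val y.
Proof. by []. Qed.

Lemma local_valM (x y : local_ring p) : local_val (x * y) = local_val x * local_val y.
Proof. by []. Qed.

Lemma local_val_sum r (x : 'I_r -> local_ring p) :
  local_val (\sum_i x i) = \sum_i local_val (x i).
Proof. by elim/big_rec2: _ => // i y z _ <-. Qed.

Lemma local_val_inj : injective (@local_val k n p).
Proof. exact: val_inj. Qed.

Lemma local_elt d (f g : R) : f \is d.-homog -> g \is d.-homog ->
  g \notin (p : {pred R}) -> exists x : local_ring p, local_val x = f%:F / g%:F.
Proof.
move=> hf hg gp; have xP : f%:F / g%:F \in local_pred p.
  by apply/local_predP; exists d, f, g.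
by exists (LocalElt xP).
Qed.

Lemma local_frac (x : local_ring p) : exists fg : R * R,
  [/\ exists d, fg.1 \is d.-homog /\ fg.2 \is d.-homog,
      hmult fg.2 & local_val x = fg.1%:F / fg.2%:F].
Proof.
case: x => x /= /local_predP[d [f [g [hf hg gp ->]]]]; exists (f, g) => /=.
by split=> //; [exists d | split=> //; exists d].
Qed.

Lemma hmult_neq0 g : hmult g -> g%:F != 0.
Proof. by case=> _; apply: tofrac_neq0. Qed.

Lemma tofrac_inj : injective (@tofrac R).
Proof. by move=> x y /eqP; rewrite tofrac_eq => /eqP. Qed.

Lemma local_clear r (a b : R) (c : 'I_r -> local_ring p) (f h : 'I_r -> R) :
  hmult b -> (forall i, hmult (h i)) ->
  a%:F / b%:F = \sum_i local_val (c i) * ((f i)%:F / (h i)%:F) ->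
  exists g e, hmult g /\ g * a = \sum_i e i * f i.
Proof.
move=> bS hS E; have /choice[uv uvP] := fun i => local_frac (c i).
pose v i := (uv i).2; have vS i : hmult (v i) by case: (uvP i).
exists (\prod_i (v i * h i)).
exists (fun i => b * (uv i).1 * \prod_(j | j != i) (v j * h j)); split.
  by apply: homog_mult_prod => i _; apply: homog_multM.
apply: tofrac_inj; rewrite rmorphM rmorph_prod rmorph_sum /=.
under eq_bigr do rewrite rmorphM /=.
under [RHS]eq_bigr do rewrite !rmorphM rmorph_prod /=.
rewrite (@frac_clear _ _ a%:F b%:F (fun i => (uv i).1%:F) (fun i => (v i)%:F)
  (fun i => (f i)%:F) (fun i => (h i)%:F)) ?hmult_neq0 //.
- apply: eq_bigr => i _; congr (_ * _ * _).
  by apply: eq_bigr => j _; rewrite rmorphM.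
- by move=> i; apply: hmult_neq0.
- by move=> i; apply: hmult_neq0.
by rewrite E; apply: eq_bigr => i _; case: (uvP i) => _ _ ->.
Qed.

Variable I : idealr R.

Lemma coordinate_notin : exists i, forall d, hmult ('X_i ^+ d).
Proof.
have [i Xi] : exists i, 'X_i \notin (p : {pred R}) by case: p.
exists i => d; split; last by apply: contra Xi => /prime_expr.
by exists d; apply: dhomogXin.
Qed.

Section FromStalk.
Variable s : seq (local_ring p).
Hypothesis I_homog : homogeneous_ideal I.
Hypothesis s_reg : regular_seq s.
Hypothesis s_gen : forall x, in_stalk I x <-> in_ideal_gen s x.

Lemma stalk_generators : exists F H : nat -> R, forall i, (i < size s)%N ->
  [/\ exists d, F i \is d.-homog /\ H i \is d.-homog, F i \in (I : {pred R}),
      hmult (H i) & local_val s`_i = (F i)%:F / (H i)%:F].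
Proof using s_gen.
have /choice[FH FHP] : forall i : nat, exists fh : R * R, (i < size s)%N ->
   [/\ exists d, fh.1 \is d.-homog /\ fh.2 \is d.-homog, fh.1 \in (I : {pred R}),
      hmult fh.2 & local_val s`_i = fh.1%:F / fh.2%:F].
  move=> i; have [lt|ge] := ltnP i (size s); last by exists (0, 0).
  have /s_gen[d [f [g [hf hg fI gp E]]]] : in_ideal_gen s s`_i.
    exists (fun j => (j == Ordinal lt)%:R); rewrite (bigD1 (Ordinal lt)) //=.
    by rewrite eqxx mul1r big1 ?addr0 // => j /negPf ->; rewrite mul0r.
  exists (f, g) => _ /=; split=> //; first by exists d.
  by split=> //; exists d.
by exists (fun i => (FH i).1), (fun i => (FH i).2).
Qed.

(** Carries the regular sequence from the local ring to numerators in [R]. An arbitrary element of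
    [R] is handled one component at a time, each made into a fraction of degree zero by a power of a
    variable outside [p]. *)
Lemma stalk_multipliers : exists F : nat -> R,
  [/\ forall i, (i < size s)%N -> F i \in (I : {pred R}),
    forall x, x \in (I : {pred R}) ->
      exists g (c : nat -> R), hmult g /\ g * x = \sum_(i < size s) c i * F i &
    forall i c, (i < size s)%N -> (exists d : nat -> R, c * F i = \sum_(j < i) d j * F j) ->
      exists g (e : nat -> R), hmult g /\ g * c = \sum_(j < i) e j * F j].
Proof using I_homog s_reg s_gen.
have [F [H FH]] := stalk_generators; have [l XS] := coordinate_notin.
have nat_fun r (e : 'I_r -> R) : exists e' : nat -> R, forall i : 'I_r, e' i = e i.
  by exists (fun i => if insub i is Some j then e j else 0) => i; rewrite valK.
pose J r x := exists c : nat -> R, x = \sum_(i < r) c i * F i.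
have JM r a x : J r x -> J r (a * x).
  move=> [c ->]; exists (fun i => a * c i); rewrite mulr_sumr.
  by apply: eq_bigr => i _; rewrite mulrA.
have JD r x y : J r x -> J r y -> J r (x + y).
  move=> [c ->] [c' ->]; exists (fun i => c i + c' i); rewrite -big_split.
  by apply: eq_bigr => i _; rewrite mulrDl.
have J0 r : J r 0 by exists (fun=> 0); rewrite big1 // => i _; rewrite mul0r.
have collect r x : (forall d, exists g, hmult g /\ J r (g * piH d x)) ->
    exists g, hmult g /\ J r (g * x).
  move=> comp; have [K xK] := sum_components x.
  have [] := @common_multiplier _ hmult 'I_K (fun d g => J r (g * piH d x)).
  - exact: homog_mult1.
  - exact: homog_multM.
  - by move=> d g h Jg; rewrite -mulrA; apply: JM.
  - by move=> d; apply: comp.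
  move=> g [gS Jg]; exists g; split=> //; rewrite (xK K (leqnn K)) mulr_sumr.
  by apply: (big_ind (J r)) => [||d _]; [exact: J0 | exact: JD | exact: Jg].
have from_local r d a (c : nat -> local_ring p) : (r <= size s)%N ->
    a%:F / ('X_l ^+ d)%:F = local_val (\sum_(i < r) c i * s`_i) ->
    exists g, hmult g /\ J r (g * a).
  move=> le E; have lts (i : 'I_r) : (i < size s)%N by apply: leq_trans le.
  have [|||g [e [gS ge]]] := @local_clear r a ('X_l ^+ d) (fun i => c i)
    (fun i => F i) (fun i => H i).
  - exact: XS.
  - by move=> i; case: (FH i (lts i)).
  - rewrite E local_val_sum; apply: eq_bigr => i _; rewrite local_valM.
    by case: (FH i (lts i)) => _ _ _ ->.
  exists g; split=> //; have [e' e'E] := nat_fun _ e; exists e'.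
  by rewrite ge; apply: eq_bigr => i _; rewrite e'E.
exists F; split=> [i lt|x xI|i c lt [d cF]]; first by case: (FH i lt).
  suff [g [gS [e ge]]] : exists g, hmult g /\ J (size s) (g * x) by exists g, e.
  apply: collect => d; have xd : piH d x \in (I : {pred R}) by apply: I_homog.
  have [y yE] := local_elt (pihomogP _ d x) (dhomogXin l d) (proj2 (XS d)).
  have /s_gen/in_ideal_genP[e ye] : in_stalk I y.
    by exists d, (piH d x), ('X_l ^+ d); split=> //;
      [exact: pihomogP | exact: dhomogXin | exact: (proj2 (XS d))].
  by apply: (@from_local _ d _ e) => //; rewrite -yE ye.
suff [g [gS [e ge]]] : exists g, hmult g /\ J i (g * c) by exists g, e.
apply: collect => e.
have [[D [hFi hHi]] FiI HiS si] := FH i lt.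
have degs (j : 'I_i) : exists d, F j \is d.-homog /\ H j \is d.-homog.
  by case: (FH j (ltn_trans (ltn_ord j) lt)).
(* With [D] the degree of [F i], the component of degree [e + D] of the relation isolates the
   component of degree [e] of [c]. *)
have /choice[d' d'P] : forall j : 'I_i, exists d', piH (e + D) (d j * F j) = d' * F j /\
    d' * H j \is (e + D).-homog.
  move=> j; have [Dj [hF hH]] := degs j.
  by have [d' [E hd']] := pihomog_mulr (e + D) (d j) hF; exists d'; split=> //; apply: hd'.
have cE : piH e c * F i = \sum_(j < i) d' j * F j.
  rewrite -(pihomog_mull _ _ hFi) cF linear_sum.
  by apply: eq_bigr => j _; case: (d'P j).
have [y yE] := local_elt (pihomogP _ e c) (dhomogXin l e) (proj2 (XS e)).
have den : H i * 'X_l ^+ e \is (e + D).-homog by rewrite addnC dhomogM // dhomogXin.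
have denS : hmult (H i * 'X_l ^+ e) by apply: homog_multM.
have /choice[z zE] : forall j : 'I_i, exists z : local_ring p,
    local_val z = (d' j * H j)%:F / (H i * 'X_l ^+ e)%:F.
  by move=> j; have [_ hd] := d'P j; exact: local_elt hd den (proj2 denS).
have [sreg _] := s_reg.
have /(in_ideal_gen_takeP _ (ltnW lt))[u uE] : in_ideal_gen (take i s) y.
  apply: (sreg i lt); apply/(in_ideal_gen_takeP _ (ltnW lt)).
  exists (fun j => if insub j is Some j' then z j' else 0).
  apply: local_val_inj; rewrite local_valM local_val_sum si yE mulf_div.
  rewrite -!tofracM [F i * _]mulrC cE rmorph_sum mulr_suml.
  apply: eq_bigr => j _; rewrite valK local_valM zE.
  case: (FH j (ltn_trans (ltn_ord j) lt)) => _ _ HjS ->.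
  have := frac_cancel (d' j)%:F (F j)%:F (H i * 'X_l ^+ e)%:F (hmult_neq0 HjS).
  by rewrite -!tofracM.
by apply: (@from_local i e _ u (ltnW lt)); rewrite -yE uE.
Qed.

End FromStalk.
End Stalks.

Lemma in_ideal_gen0 (A : comNzRingType) (x : A) : in_ideal_gen [::] x <-> x = 0.
Proof.
rewrite in_ideal_genP; split=> [[c ->]|->]; first by rewrite big_ord0.
by exists (fun=> 0); rewrite big_ord0.
Qed.

Lemma in_ideal_gen1 (A : comNzRingType) (s x : A) :
  in_ideal_gen [:: s] x <-> exists c, x = c * s.
Proof.
rewrite in_ideal_genP; split=> -[c ->].
  by exists (c 0%N); rewrite big_ord_recl big_ord0 addr0.
by exists (fun=> c); rewrite big_ord_recl big_ord0 addr0.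
Qed.

Lemma in_ideal_gen2 (A : comNzRingType) (s t x : A) :
  in_ideal_gen [:: s; t] x <-> exists c d, x = c * s + d * t.
Proof.
rewrite in_ideal_genP; split=> [[c ->]|[c [d ->]]].
  by exists (c 0%N), (c 1%N); rewrite !big_ord_recl big_ord0 addr0.
by exists (fun i => if i is 0%N then c else d); rewrite !big_ord_recl big_ord0 addr0.
Qed.

Lemma addn_rotate i e1 e2 d : (i + (e1 + e2 + d) = i + e2 + d + e1)%N.
Proof. by lia. Qed.

Section FracIdentities.
Variable K : fieldType.
Implicit Types f g t a b x y u v w z : K.

Lemma frac_combination f g t a b f1 f2 x1 x2 :
  t != 0 -> g != 0 -> x1 != 0 -> x2 != 0 -> t * f = a * f1 + b * f2 ->
  f / g = a * x1 / (t * g) * (f1 / x1) + b * x2 / (t * g) * (f2 / x2).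
Proof.
move=> t0 g0 x10 x20 e; apply: (mulfI t0).
rewrite [LHS]mulrA e; field.
by rewrite t0 g0 x10 x20.
Qed.

Lemma frac_cross f1 f2 x1 x2 u v w z :
  v != 0 -> z != 0 -> x1 != 0 -> x2 != 0 ->
  f2 / x2 * (u / v) = w / z * (f1 / x1) -> u * z * x1 * f2 = w * v * x2 * f1.
Proof.
move=> v0 z0 x10 x20 /(congr1 (fun y => y * (v * z * x1 * x2))) e.
transitivity (f2 / x2 * (u / v) * (v * z * x1 * x2)); first by field; rewrite v0 x20.
by rewrite e; field; rewrite z0 x10.
Qed.

Lemma frac_of_cross h u v z x1 e f1 :
  h != 0 -> v != 0 -> z != 0 -> x1 != 0 -> h * (u * z * x1) = e * f1 ->
  u / v = e * x1 / (h * z * x1 * v) * (f1 / x1).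
Proof.
move=> h0 v0 z0 x10 E; apply: (mulfI (mulf_neq0 (mulf_neq0 h0 z0) x10)).
transitivity (h * (u * z * x1) / v); first by field.
by rewrite E; field; rewrite h0 v0 z0 x10.
Qed.

Lemma frac_sum c d f1 f2 g1 g2 x1 x2 : g1 != 0 -> g2 != 0 -> x1 != 0 -> x2 != 0 ->
  c / g1 * (f1 / x1) + d / g2 * (f2 / x2) =
  (c * g2 * x2 * f1 + d * g1 * x1 * f2) / (g1 * x1 * (g2 * x2)).
Proof. by move=> g10 g20 x10 x20; field; rewrite g10 g20 x10 x20. Qed.

End FracIdentities.

Section TwoGenerators.
Variables (k : fieldType) (n : nat) (p : proj_point k n) (I : idealr {mpoly k[n]}).
Local Notation R := {mpoly k[n]}.
Local Notation "x %:F" := (@tofrac R x).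
Local Notation piH := (@pihomog n k mdeg).
Local Notation hmult := (homog_mult p).
Hypothesis Ip : {subset I <= p}.
Variables (f1 f2 : R) (d1 d2 : nat).
Hypotheses (hf1 : f1 \is d1.-homog) (hf2 : f2 \is d2.-homog).
Hypotheses (f1I : f1 \in (I : {pred R})) (f2I : f2 \in (I : {pred R})).
Hypothesis gen : exists g, g \notin (p : {pred R}) /\
  forall x, x \in (I : {pred R}) -> exists a b, g * x = a * f1 + b * f2.
Hypothesis f10 : f1 != 0.
Hypothesis reg : forall c a, c * f2 = a * f1 ->
  exists h e, h \notin (p : {pred R}) /\ h * c = e * f1.

(** The regular sequence consists of [f1] and [f2] divided by powers of a variable outside [p]. A
    multiplier is replaced by one of its components outside [p], and the relation by its component
    of matching degree. *)
Lemma two_generators_lci : exists s : seq (local_ring p),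
  regular_seq s /\ (forall x, in_stalk I x <-> in_ideal_gen s x).
Proof using Ip hf1 hf2 f1I f2I gen f10 reg.
have [l XS] := coordinate_notin p.
have hX d : ('X_l ^+ d : R) \is d.-homog by apply: dhomogXin.
have X0 d : ('X_l ^+ d)%:F != 0 by apply: (hmult_neq0 (XS d)).
have [s1 s1E] := local_elt hf1 (hX d1) (proj2 (XS d1)).
have [s2 s2E] := local_elt hf2 (hX d2) (proj2 (XS d2)).
have F0 g : g \notin (p : {pred R}) -> g%:F != 0 by apply: tofrac_neq0.
have stalkP x : in_stalk I x <-> in_ideal_gen [:: s1; s2] x.
  rewrite in_ideal_gen2; split=> [[d [f [g [hf hg fI gp xE]]]]|[c1 [c2 ->]]].
    have [t [tp tgen]] := gen; have [a [b ab]] := tgen f fI.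
    have [e ep] := component_notin tp.
    have [a' [aE ha]] := pihomog_mulr (e + d) a hf1.
    have [b' [bE hb]] := pihomog_mulr (e + d) b hf2.
    have E : piH e t * f = a' * f1 + b' * f2.
      by rewrite -(pihomog_mull _ _ hf) ab pihomogD aE bE.
    have hden : piH e t * g \is (e + d).-homog by rewrite dhomogM // pihomogP.
    have denp := prime_mul_notin ep gp.
    have [c1 c1E] := local_elt (ha _ (hX d1)) hden denp.
    have [c2 c2E] := local_elt (hb _ (hX d2)) hden denp.
    exists c1, c2; apply: local_val_inj.
    rewrite local_valD !local_valM s1E s2E c1E c2E xE !tofracM.
    apply: (frac_combination (F0 _ ep) (F0 _ gp) (X0 d1) (X0 d2)).
    by have := congr1 (@tofrac R) E; rewrite tofracD !tofracM.
  have [[u1 v1] /= [[e1 [hu1 hv1]] v1S c1E]] := local_frac c1.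
  have [[u2 v2] /= [[e2 [hu2 hv2]] v2S c2E]] := local_frac c2.
  exists ((e1 + d1) + (e2 + d2))%N,
    (u1 * v2 * 'X_l ^+ d2 * f1 + u2 * v1 * 'X_l ^+ d1 * f2),
    (v1 * 'X_l ^+ d1 * (v2 * 'X_l ^+ d2)).
  have XdS1 := homog_multM v1S (XS d1); have XdS2 := homog_multM v2S (XS d2).
  split.
  - rewrite rpredD //.
      have -> : u1 * v2 * 'X_l ^+ d2 * f1 = (u1 * f1) * (v2 * 'X_l ^+ d2) by ring.
      by rewrite !dhomogM.
    have -> : u2 * v1 * 'X_l ^+ d1 * f2 = (v1 * 'X_l ^+ d1) * (u2 * f2) by ring.
    by rewrite !dhomogM.
  - by rewrite !dhomogM.
  - by rewrite rpredD // idealMr.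
  - exact: (proj2 (homog_multM XdS1 XdS2)).
  - rewrite local_valD !local_valM s1E s2E c1E c2E.
    rewrite (frac_sum _ _ _ _ (hmult_neq0 v1S) (hmult_neq0 v2S) (X0 d1) (X0 d2)).
    by rewrite tofracD !tofracM.
exists [:: s1; s2]; split=> //; split=> [[|[|//]] _ x|].
- move=> /= /in_ideal_gen0/(congr1 (@local_val _ _ _)).
  rewrite local_valM s1E => /eqP E; apply/in_ideal_gen0/local_val_inj/eqP.
  move: E; rewrite -[local_val 0]/(0 : {fraction R}) !mulf_eq0 invr_eq0 (negPf (X0 _)) orbF.
  by rewrite tofrac_eq0 (negPf f10).
- move=> /= /in_ideal_gen1[c /(congr1 (@local_val _ _ _)) sx]; apply/in_ideal_gen1.
  have [[u v] /= [[e1 [hu hv]] vS xE]] := local_frac x.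
  have [[w z] /= [[e2 [hw hz]] zS cE]] := local_frac c.
  move: sx; rewrite !local_valM s1E s2E xE cE.
  move=> /(frac_cross (hmult_neq0 vS) (hmult_neq0 zS) (X0 d1) (X0 d2)).
  rewrite -!tofracM => /tofrac_inj/reg[h [e [hp hE]]].
  have [i ip] := component_notin hp.
  have hc : u * z * 'X_l ^+ d1 \is (e1 + e2 + d1).-homog by rewrite !dhomogM.
  have [e' [eE he]] := pihomog_mulr (i + (e1 + e2 + d1)) e hf1.
  have E : piH i h * (u * z * 'X_l ^+ d1) = e' * f1.
    by rewrite -(pihomog_mull _ _ hc) hE.
  have hden : piH i h * z * 'X_l ^+ d1 * v \is (i + (e1 + e2 + d1)).-homog.
    rewrite addn_rotate.
    by rewrite !dhomogM // pihomogP.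
  have denp : piH i h * z * 'X_l ^+ d1 * v \notin (p : {pred R}).
    by do !apply: prime_mul_notin => //; [case: zS | case: (XS d1) | case: vS].
  have [q qE] := local_elt (he _ (hX d1)) hden denp.
  exists q; apply: local_val_inj; rewrite local_valM s1E qE xE !tofracM.
  apply: (frac_of_cross (F0 _ ip) (hmult_neq0 vS) (hmult_neq0 zS) (X0 d1)).
  by have := congr1 (@tofrac R) E; rewrite !tofracM.
move=> /stalkP[d [f [g [hf hg fI gp /eqP]]]].
rewrite -[local_val 1]/(1 : {fraction R}) eq_sym -subr_eq0.
have -> : f%:F / g%:F - 1 = (f%:F - g%:F) / g%:F by rewrite mulrBl divff ?F0.
rewrite mulf_eq0 invr_eq0 (negPf (F0 _ gp)) orbF subr_eq0 tofrac_eq => /eqP fg.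
by move: gp; rewrite -fg Ip.
Qed.

End TwoGenerators.

(** * Ideals of linear type *)

Section IdealSum.
Variables (A : comNzRingType) (I : idealr A).

Lemma ideal_elt0 : ideal_elt (0 : ideal_mod I) = 0.
Proof. by []. Qed.

Lemma ideal_elt_sum r (c : 'I_r -> ideal_mod I) :
  ideal_elt (\sum_i c i) = \sum_i ideal_elt (c i).
Proof. by elim/big_rec2: _ => // i y z _ <-; rewrite ideal_eltD. Qed.

Lemma ideal_scaleC (x y : ideal_mod I) : ideal_elt x *: y = ideal_elt y *: x.
Proof. by apply: ideal_elt_inj; rewrite !ideal_eltZ mulrC. Qed.

Lemma sym2_to_sqZ x (s : sym2 (ideal_mod I)) :
  ideal_elt (sym2_to_sq I (x *: s)) = x * ideal_elt (sym2_to_sq I s).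
Proof. by rewrite (linearZ_LR (sym2_to_sq I)) ideal_eltZ. Qed.

(** On a product [a.b]: moving scalars within [I], [x^2 (a.b) = (x a).(x b) = (a x).(b x) = ab
    (x.x)]. *)
Lemma sym2_square (x : ideal_mod I) (s : sym2 (ideal_mod I)) :
  (ideal_elt x * ideal_elt x) *: s = ideal_elt (sym2_to_sq I s) *: sym2_mul x x.
Proof.
elim/sym2_ind: s => [a b|s t IHs IHt]; last first.
  by rewrite (linearD (sym2_to_sq I)) ideal_eltD scalerDr scalerDl IHs IHt.
rewrite sym2_to_sqE -scalerA -sym2_mulZr -sym2_mulZl ideal_scaleC.
by rewrite [ideal_elt x *: b]ideal_scaleC sym2_mulZl sym2_mulZr scalerA.
Qed.

End IdealSum.

Lemma sym2_to_sq_surj (A : comNzRingType) (I : idealr A) :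
  surjective (sym2_to_sq I).
Proof.
case=> x xP; have /ideal_prodP[r [a [b [abI xE]]]] := xP.
have aI i : a i \in ideal_pred I by case/andP: (abI i).
have bI i : b i \in ideal_pred I by case/andP: (abI i).
exists (\sum_i sym2_mul (IdealMod (aI i)) (IdealMod (bI i))).
apply: ideal_elt_inj; rewrite (linear_sum (sym2_to_sq I)) ideal_elt_sum [RHS]xE.
by apply: eq_bigr => i _; rewrite sym2_to_sqE.
Qed.

Section QuasiRegular.
Variables (A : comNzRingType) (I : idealr A) (S : A -> Prop).
Hypothesis S1 : S 1.
Hypothesis SM : forall g h, S g -> S h -> S (g * h).
Variables (r : nat) (F : nat -> ideal_mod I).
Local Notation f i := (ideal_elt (F i)).

Definition span_first l (x : A) := exists c : nat -> A, x = \sum_(j < l) c j * f j.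
Local Notation J := span_first.

Hypothesis F_reg : forall i c, (i < r)%N -> J i (c * f i) -> exists g, S g /\ J i (g * c).

Lemma span_firstM l a x : J l x -> J l (a * x).
Proof.
move=> [c ->]; exists (fun j => a * c j); rewrite mulr_sumr.
by apply: eq_bigr => j _; rewrite mulrA.
Qed.

Lemma span_firstD l x y : J l x -> J l y -> J l (x + y).
Proof.
move=> [c ->] [d ->]; exists (fun j => c j + d j); rewrite -big_split.
by apply: eq_bigr => j _; rewrite mulrDl.
Qed.

Lemma span_firstN l x : J l x -> J l (- x).
Proof. by rewrite -mulN1r; apply: span_firstM. Qed.

Lemma span_first_sum l x (c : 'I_l -> A) : x = \sum_j c j * f j -> J l x.
Proof.
move=> ->; exists (fun j => if insub j is Some i then c i else 0).
by apply: eq_bigr => j _; rewrite valK.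
Qed.

Lemma span_firstS l x : J l.+1 x <-> exists y c, J l y /\ x = y + c * f l.
Proof.
split=> [[c ->]|[y [c [[d ->] ->]]]].
  by exists (\sum_(j < l) c j * f j), (c l); rewrite big_ord_recr; split=> //; exists c.
exists (fun j => if (j < l)%N then d j else c); rewrite big_ord_recr /= ltnn.
by congr (_ + _); apply: eq_bigr => j _; rewrite ltn_ord.
Qed.

Lemma common_span (T : finType) l (c : T -> A) :
  (forall i, exists g, S g /\ J l (g * c i)) -> exists g, S g /\ forall i, J l (g * c i).
Proof using S1 SM.
apply: (common_multiplier (Q := fun i g => J l (g * c i))) => // i g h Jg.
by rewrite -mulrA; apply: span_firstM.
Qed.

(** Regularity puts a multiple of the last coefficient into [J l]; expanding it there absorbs the
    last term into the others, and the shorter relation is treated by induction. *)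
Lemma regular_koszul l (c : nat -> A) : (l <= r)%N -> \sum_(i < l) c i * f i = 0 ->
  exists g, S g /\ forall i : 'I_l, J l (g * c i).
Proof using S1 SM F_reg.
elim: l c => [|l IHl] c le; first by exists 1; split=> // -[].
rewrite big_ord_recr /= => /eqP; rewrite addrC addr_eq0 => /eqP cl.
have [|g [Sg [d dE]]] := @F_reg l (c l) le.
  by rewrite cl; apply: span_firstN; exists c.
have [||h [Sh hJ]] := IHl (fun i => g * c i + d i * f l); first exact: ltnW.
  transitivity (g * (\sum_(i < l) c i * f i) + (\sum_(i < l) d i * f i) * f l).
    by rewrite mulr_sumr mulr_suml -big_split; apply: eq_bigr => i _ /=; ring.
  by rewrite -dE -mulrA cl mulrN addrN.
exists (h * g); split=> [|i]; first exact: SM.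
apply/span_firstS; have [lt|ge] := ltnP i l; last first.
  have -> : i = ord_max by apply/val_inj => /=; have := ltn_ord i; lia.
  exists (h * (g * c l)), 0; rewrite mul0r addr0 -mulrA; split=> //.
  by rewrite dE; apply: span_firstM; exists d.
exists (h * (g * c i + d i * f l)), (- (h * d i)); split; last by ring.
exact: (hJ (Ordinal lt)).
Qed.

(* A regular sequence generates an ideal of linear type; only degree two is needed. *)
Lemma regular_sym2 l (x : nat -> ideal_mod I) : (l <= r)%N ->
  (forall i, (i < l)%N -> J l (ideal_elt (x i))) ->
  \sum_(i < l) ideal_elt (x i) * f i = 0 ->
  exists g, S g /\ g *: (\sum_(i < l) sym2_mul (x i) (F i)) = 0.
Proof using S1 SM F_reg.
elim: l x => [|l IHl] x le xJ; first by exists 1; rewrite big_ord0 scaler0.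
(* Each [x i] is reduced modulo [f l]; by symmetry of the product, the multiples of [F l] that are
   removed can be collected in [y], the partner of [F l]. *)
have /choice[c cP] : forall i : 'I_l, exists c, J l (ideal_elt (x i - c *: F l)).
  move=> i; have /span_firstS[y [c [yJ E]]] := xJ i (ltnW (ltn_ord i)).
  exists c; rewrite ideal_eltD -scaleNr ideal_eltZ E; move: yJ.
  by have -> : y + c * f l + - c * f l = y by ring.
have [x' [x'J xE]] : exists x' : 'I_l -> ideal_mod I,
    (forall i, J l (ideal_elt (x' i))) /\ forall i : 'I_l, x i = x' i + c i *: F l.
  by exists (fun i : 'I_l => x i - c i *: F l); split=> // i; rewrite subrK.
pose y := x l + \sum_(i < l) c i *: F i.
have sym_total : \sum_(i < l.+1) sym2_mul (x i) (F i) =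
    \sum_(i < l) sym2_mul (x' i) (F i) + sym2_mul y (F l).
  rewrite big_ord_recr sym2_mulDl sym2_mul_suml addrCA -big_split addrC.
  congr (_ + _); apply: eq_bigr => i _.
  by rewrite xE sym2_mulDl !sym2_mulZl [sym2_mul (F l) _]sym2_mulC.
have val_total : \sum_(i < l.+1) ideal_elt (x i) * f i =
    \sum_(i < l) ideal_elt (x' i) * f i + ideal_elt y * f l.
  rewrite big_ord_recr ideal_eltD ideal_elt_sum mulrDl mulr_suml addrCA -big_split addrC.
  congr (_ + _); apply: eq_bigr => i _.
  by rewrite xE ideal_eltD !ideal_eltZ /=; ring.
rewrite val_total => /eqP; rewrite addrC addr_eq0 => /eqP yF.
have x'F : J l (\sum_(i < l) ideal_elt (x' i) * f i).
  by apply: span_first_sum.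
have [|g [Sg [e eE]]] := @F_reg l (ideal_elt y) le.
  by rewrite yF; apply: span_firstN.
have eE' : g *: y = \sum_(i < l) e i *: F i.
  apply: ideal_elt_inj; rewrite ideal_eltZ eE ideal_elt_sum.
  by apply: eq_bigr => i _; rewrite ideal_eltZ.
have [e0 e0E] : exists e0 : nat -> A, forall i : 'I_l, e0 i = g * ideal_elt (x' i) + e i * f l.
  exists (fun j => if insub j is Some i then g * ideal_elt (x' i) + e i * f l else 0) => i.
  by rewrite valK.
have [||h [Sh hJ]] := @regular_koszul l e0; first exact: ltnW.
  transitivity (g * (\sum_(i < l) ideal_elt (x' i) * f i) +
      (\sum_(i < l) e i * f i) * f l).
    rewrite mulr_sumr mulr_suml -big_split; apply: eq_bigr => i _.
    by rewrite e0E /=; ring.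
  by rewrite -eE -mulrA yF mulrN addrN.
(* The induction hypothesis asks for left factors in [J l], so the coefficients [e i] of [g *: y]
   have to be brought there too. *)
have heJ (i : 'I_l) : exists k, S k /\ J l (k * (h * e i)).
  apply: F_reg => //.
  have -> : h * e i * f l = h * e0 i - (h * g) * ideal_elt (x' i) by rewrite e0E; ring.
  apply: span_firstD; first exact: hJ.
  by apply/span_firstN/span_firstM/x'J.
have [k [Sk kJ]] := common_span heJ.
have /choice[z zP] : forall i : 'I_l, exists z : ideal_mod I,
    ideal_elt z = k * (h * e i) /\ J l (ideal_elt z).
  move=> i; have [d dE] := kJ i; exists (\sum_(j < l) d j *: F j).
  have zE : ideal_elt (\sum_(j < l) d j *: F j) = k * (h * e i).
    by rewrite ideal_elt_sum dE; apply: eq_bigr => j _; rewrite ideal_eltZ.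
  by split=> //; rewrite zE; exists d.
pose G := k * h * g.
(* As [g *: y] is a combination of the [F i], the term [G *: (y . F l)] is the sum of the
   [(f l *: z i) . F i]; folded into the other terms it leaves a sum of length [l]. *)
have [x2 x2E] : exists x2 : nat -> ideal_mod I, forall i : 'I_l, x2 i = G *: x' i + f l *: z i.
  exists (fun j => if insub j is Some i then G *: x' i + f l *: z i else 0) => i.
  by rewrite valK.
have [||g2 [Sg2 g20]] := IHl x2 (ltnW le).
- move=> i lt; rewrite (x2E (Ordinal lt)) ideal_eltD !ideal_eltZ.
  by apply: span_firstD; apply: span_firstM; [exact: x'J | case: (zP (Ordinal lt))].
- transitivity (G * (\sum_(i < l) ideal_elt (x' i) * f i) +
      k * h * f l * (\sum_(i < l) e i * f i)).
    rewrite !mulr_sumr -big_split; apply: eq_bigr => i _.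
    by rewrite x2E ideal_eltD !ideal_eltZ (zP i).1 /=; ring.
  rewrite -eE; have -> : k * h * f l * (g * ideal_elt y) = G * (ideal_elt y * f l).
    by rewrite /G; ring.
  by rewrite yF mulrN addrN.
exists (g2 * G); split; first by do !apply: SM.
rewrite -scalerA -[RHS]g20; congr (_ *: _).
rewrite sym_total scalerDr.
have -> : G *: sym2_mul y (F l) = \sum_(i < l) f l *: sym2_mul (z i) (F i).
  rewrite /G -scalerA -sym2_mulZl eE' sym2_mul_suml scaler_sumr; apply: eq_bigr => i _.
  rewrite sym2_mulZl scalerA -mulrA -(zP i).1 -sym2_mulZr ideal_scaleC sym2_mulZr.
  by rewrite sym2_mulC.
rewrite scaler_sumr -big_split; apply: eq_bigr => i _.
by rewrite x2E sym2_mulDl !sym2_mulZl.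
Qed.

Hypothesis F_gen : forall x, x \in I -> exists g, S g /\ J r (g * x).

Lemma sym2_local_kernel (s : sym2 (ideal_mod I)) : sym2_to_sq I s = 0 ->
  exists g, S g /\ g *: s = 0.
Proof using S1 SM F_reg F_gen.
(* One multiplier expands [a] in the [F i], a second one brings [b] into [J r], as [regular_sym2]
   requires of left factors. *)
have [g [Sg [x [xJ sE]]]] : exists g, S g /\ exists x : nat -> ideal_mod I,
    (forall i, (i < r)%N -> J r (ideal_elt (x i))) /\
    g *: s = \sum_(i < r) sym2_mul (x i) (F i).
  elim/sym2_ind: s => [a b|s t [g [Sg [x [xJ xE]]]] [h [Sh [y [yJ yE]]]]]; last first.
    exists (g * h); split; first exact: SM.
    exists (fun i => h *: x i + g *: y i); split.
      by move=> i lt; rewrite ideal_eltD !ideal_eltZ; apply: span_firstD;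
        apply: span_firstM; [exact: xJ | exact: yJ].
    have -> : (g * h) *: (s + t) = h *: (g *: s) + g *: (h *: t).
      by rewrite scalerDr !scalerA [h * g]mulrC.
    rewrite xE yE !scaler_sumr -big_split.
    by apply: eq_bigr => i _; rewrite sym2_mulDl !sym2_mulZl.
  have [g [Sg [c cE]]] := F_gen (ideal_eltP a).
  have [h [Sh hJ]] := F_gen (ideal_eltP b).
  exists (g * h); split; first exact: SM.
  exists (fun i => c i *: (h *: b)); split.
    by move=> i _; rewrite !ideal_eltZ; apply: span_firstM.
  rewrite [g * h]mulrC -scalerA -sym2_mulZl.
  have -> : g *: a = \sum_(i < r) c i *: F i.
    apply: ideal_elt_inj; rewrite ideal_eltZ cE ideal_elt_sum.
    by apply: eq_bigr => i _; rewrite ideal_eltZ.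
  rewrite sym2_mul_suml scaler_sumr; apply: eq_bigr => i _.
  by rewrite !sym2_mulZl scaler_swap [sym2_mul (F i) b]sym2_mulC.
move=> s0; have [|h [Sh h0]] := @regular_sym2 r x (leqnn r) xJ.
  have : ideal_elt (sym2_to_sq I (g *: s)) = 0 by rewrite sym2_to_sqZ s0 mulr0.
  rewrite sE (linear_sum (sym2_to_sq I)) ideal_elt_sum => {2}<-.
  by apply: eq_bigr => i _; rewrite sym2_to_sqE.
by exists (h * g); split; [exact: SM | rewrite -scalerA sE].
Qed.

End QuasiRegular.

(** * Elements supported at the irrelevant ideal *)

Section HomogeneousCore.
Variables (k : fieldType) (n : nat).
Local Notation R := {mpoly k[n]}.
Local Notation piH := (@pihomog n k mdeg).

Lemma pihomog_mul_in (P : idealr R) e (a f : R) :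
  (forall d, piH d f \in (P : {pred R})) -> piH e (a * f) \in (P : {pred R}).
Proof.
move=> fP; have [K fK] := sum_components f.
have -> : piH e (a * f) = \sum_(i < K) piH e (a * piH i f).
  by rewrite -(raddf_sum (@pihomog n k mdeg e)) -mulr_sumr -fK.
rewrite rpred_sum // => i _; rewrite (pihomog_mul_homog _ _ (pihomogP _ i f)).
by case: ifP => _; [apply: idealMr | apply: idealr0].
Qed.

Lemma first_component (P : idealr R) (f : R) :
  ~ (forall d, piH d f \in (P : {pred R})) ->
  exists d, piH d f \notin (P : {pred R}) /\
    forall e, (e < d)%N -> piH e f \in (P : {pred R}).
Proof.
move=> nf; have ex : exists d, piH d f \notin (P : {pred R}).
  by apply: contrapT => no; apply: nf => d; apply: contraT => nd; case: no; exists d.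
exists (ex_minn ex); case: ex_minnP => d nd dmin; split=> // e lt.
by apply: contraT => /dmin; rewrite leqNgt lt.
Qed.

(** Primality is tested on lowest components: if [d] and [e] are the first degrees in which [u] and
    [v] leave [P], every other contribution to degree [d + e] of the product lies in [P]. *)
Lemma homogeneous_core (P : prime_idealr R) :
  exists Q : prime_idealr R, forall f,
    f \in (Q : {pred R}) <-> forall d, piH d f \in (P : {pred R}).
Proof.
apply: mk_prime.
- split=> [d|a x y xP yP d]; first by rewrite pihomog0 idealr0.
  by rewrite pihomogD rpredD ?pihomog_mul_in.
- by move/(_ 0%N); rewrite pihomog_dE ?dhomog1 // idealr1.
move=> u v uvP; apply: contrapT => /not_orP[/first_component[d [ud umin]]].
move=> /first_component[e [ve vmin]].
have [K uK] := sum_components u.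
have E : piH (d + e) (v * u) = \sum_(i < (K + d).+1) piH (d + e) (v * piH i u).
  rewrite -(raddf_sum (@pihomog n k mdeg _)) -mulr_sumr -uK //.
  by rewrite leqW ?leq_addr.
have ltd : (d < (K + d).+1)%N by rewrite ltnS leq_addl.
have : piH e v * piH d u \in (P : {pred R}).
  have -> : piH e v * piH d u = piH (d + e) (v * u) -
      \sum_(i < (K + d).+1 | i != Ordinal ltd) piH (d + e) (v * piH i u).
    rewrite E (bigD1 (Ordinal ltd)) //= addrK.
    by rewrite addnC (pihomog_mull _ _ (pihomogP _ d u)).
  rewrite rpredB //; first by rewrite mulrC.
  rewrite rpred_sum // => i ne; rewrite (pihomog_mul_homog _ _ (pihomogP _ i u)).
  case: ifP => le; last exact: idealr0.
  have [lt|ge] := ltnP i d; first by rewrite idealMr ?umin.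
  rewrite mulrC idealMr // vmin //.
  have : (i : nat) != d by apply: contra ne => /eqP E'; apply/eqP/val_inj.
  by move: ge le; clear; lia.
by rewrite prime_idealrM (negPf ud) (negPf ve).
Qed.

(* Otherwise some prime containing [J] avoids the powers of ['X_i], and its largest
   homogeneous subideal is a point at which [J] contains no unit. *)
Lemma irrelevant_annihilated (J : R -> Prop) :
  is_ideal J ->
  (forall p : proj_point k n, exists g, homog_mult p g /\ J g) ->
  forall i, exists d, J ('X_i ^+ d).
Proof.
move=> JI loc i; apply: contrapT => no.
have [||||P [JP XP]] := @prime_avoiding R J (fun x => exists d, x = 'X_i ^+ d).
- exact: JI.
- by exists 0%N; rewrite expr0.
- by move=> _ _ [d ->] [e ->]; exists (d + e)%N; rewrite exprD.
- by move=> _ [d ->] Jd; apply: no; exists d.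
have [Q QP] := homogeneous_core P.
have XiP : 'X_i \notin (P : {pred R}) by apply: XP; exists 1%N.
have XiQ : 'X_i \notin (Q : {pred R}).
  apply/negP => /QP/(_ 1%N); rewrite pihomog_dE; first exact/negP.
  by have := dhomogXin (k := k) i 1; rewrite expr1.
have hQ : homogeneous_ideal Q.
  move=> d f /QP fP; apply/QP => e.
  have [->|ne] := eqVneq d e; first by rewrite pihomog_id.
  by rewrite (pihomog_ne0 ne (pihomogP _ d f)) idealr0.
have [g [[[d hg] gQ] Jg]] := loc (ProjPoint hQ (ex_intro _ i XiQ)).
case/negP: gQ; apply/QP => e; have [<-|ne] := eqVneq d e.
  by rewrite pihomog_dE // JP.
by rewrite (pihomog_ne0 ne hg) idealr0.
Qed.

End HomogeneousCore.

(** At a point of [V(I)] the regular sequence is used. At any other point [I] contains a form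
    outside [p], and its square kills the kernel by [sym2_square]. *)
Lemma lci_local_kernel (k : fieldType) (n : nat) (I : idealr {mpoly k[n]})
    (p : proj_point k n) (s : sym2 (ideal_mod I)) :
  homogeneous_ideal I -> local_complete_intersection I -> sym2_to_sq I s = 0 ->
  exists g, homog_mult p g /\ g *: s = 0.
Proof.
move=> hI lci s0.
have [Ip|/existsNP[x /not_implyP[xI /negP xp]]] := pselect {subset I <= p}.
  have [q [qreg qgen]] := lci p Ip.
  have [f [fI fgen freg]] := stalk_multipliers hI qreg qgen.
  have [F FE] : exists F : nat -> ideal_mod I, forall i, (i < size q)%N ->
      ideal_elt (F i) = f i.
    have /choice[F FP] : forall i, exists y : ideal_mod I, (i < size q)%N -> ideal_elt y = f i.
      move=> i; have [lt|_] := ltnP i (size q); last by exists 0.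
      by exists (IdealMod (fI i lt : f i \in ideal_pred I)).
    by exists F.
  have sumE l c : (l <= size q)%N ->
      \sum_(j < l) c j * ideal_elt (F j) = \sum_(j < l) c j * f j.
    move=> le; apply: eq_bigr => j _; rewrite FE //.
    exact: leq_trans (ltn_ord j) le.
  apply: (@sym2_local_kernel _ _ (homog_mult p) _ _ (size q) F) => //.
  - exact: homog_mult1.
  - exact: homog_multM.
  - move=> i c lt [d]; rewrite FE // sumE ?(ltnW lt) // => cE.
    have [|g [e [gS ge]]] := freg i c lt; first by exists d.
    by exists g; split=> //; exists e; rewrite sumE ?(ltnW lt).
  - move=> y yI; have [g [c [gS gc]]] := fgen y yI.
    by exists g; split=> //; exists c; rewrite sumE.
have [e ep] := component_notin xp.
have eI : pihomog mdeg e x \in ideal_pred I by apply: hI.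
exists (pihomog mdeg e x * pihomog mdeg e x); split.
  by apply: homog_multM; split=> //; exists e; apply: pihomogP.
by rewrite (sym2_square (IdealMod eI)) s0 ideal_elt0 scale0r.
Qed.

Section FreeLift.
Variables (A : comNzRingType) (V : lmodType A).
Hypothesis Vfree : finite_free V.

Lemma finite_free_divide (s t : A) (c d : V) :
  (forall c d, t * c = s * d -> exists e, c = s * e) ->
  t *: c = s *: d -> exists e, c = s *: e.
Proof using Vfree.
move=> reg E; have [n [e [e' e'K eK]]] := Vfree.
have /choice[x xE] : forall i, exists x, e' c 0 i = s * x.
  move=> i; apply: (reg _ (e' d 0 i)).
  have /(congr1 e')/rowP/(_ i) : e (t *: e' c) = e (s *: e' d).
    by rewrite !(linearZ_LR e) !eK.
  by rewrite !e'K !mxE.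
exists (e (\row_i x i)); rewrite -[c]eK -(linearZ_LR e); congr (e _).
by apply/rowP => i; rewrite !mxE xE.
Qed.

Lemma finite_free_divide2 (s t r : A) (c u v : V) :
  (forall c u v, r * c = t * u + s * v -> exists x y, c = t * x + s * y) ->
  r *: c = t *: u + s *: v -> exists x y, c = t *: x + s *: y.
Proof using Vfree.
move=> reg E; have [n [e [e' e'K eK]]] := Vfree.
have /choice[xy xyE] : forall i, exists xy : A * A, e' c 0 i = t * xy.1 + s * xy.2.
  move=> i; have [|x [y xyE]] := reg (e' c 0 i) (e' u 0 i) (e' v 0 i).
    have /(congr1 e')/rowP/(_ i) : e (r *: e' c) = e (t *: e' u + s *: e' v).
      by rewrite (linearD e) !(linearZ_LR e) !eK.
    by rewrite !e'K !mxE.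
  by exists (x, y).
exists (e (\row_i (xy i).1)), (e (\row_i (xy i).2)).
rewrite -!(linearZ_LR e) -(linearD e) -[c]eK; congr (e _).
by apply/rowP => i; rewrite !mxE xyE.
Qed.

End FreeLift.

Section Variables3.
Variable k : fieldType.
Local Notation S := {poly {poly {poly k}}}.
Local Notation R := {mpoly k[3]}.

Lemma poly_coef0_dvd (A : comNzRingType) (a : {poly A}) : a`_0 = 0 ->
  exists q, a = 'X * q.
Proof.
move=> a0; have /factor_theorem[q ->] : root a 0 by rewrite /root horner_coef0 a0.
by exists q; rewrite polyC0 subr0 mulrC.
Qed.

Lemma polyC_X_regular (A : comNzRingType) (t : A) (a b : {poly A}) :
  (forall x, t * x = 0 -> x = 0) -> t%:P * a = 'X * b -> exists q, a = 'X * q.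
Proof.
move=> treg /(congr1 (fun p : {poly A} => p`_0)); rewrite coefCM coefXM eqxx.
by move/treg/poly_coef0_dvd.
Qed.

Lemma polyX_eq0 (A : comNzRingType) (x : {poly A}) : 'X * x = 0 -> x = 0.
Proof.
by move=> E; apply/polyP => i; have := congr1 (fun p : {poly A} => p`_i.+1) E;
  rewrite coefXM !coef0.
Qed.

Let var0 : iter_var k ord0 ord0 = 'X%:P%:P. Proof. by []. Qed.
Let var1 : iter_var k ord0 (ordS ord0) = 'X%:P. Proof. by []. Qed.
Let var2 : iter_var k ord0 (ordS (ordS ord0)) = 'X. Proof. by []. Qed.

Lemma X_regular2 (a b : R) : 'X_(ordS ord0) * a = 'X_(ordS (ordS ord0)) * b ->
  exists c, a = 'X_(ordS (ordS ord0)) * c.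
Proof.
move=> /(congr1 (to_iter ord0)); rewrite !rmorphM !to_iterX var1 var2.
move/(polyC_X_regular (@polyX_eq0 _))=> [q E]; exists (of_iter ord0 q).
by rewrite -[LHS](to_iterK ord0) E rmorphM of_iterX.
Qed.

(** The constant coefficient in the outermost variable removes the last term, and the relation left
    over concerns two variables only. *)
Lemma X_regular3 (w u v : R) :
  'X_ord0 * w = 'X_(ordS ord0) * u + 'X_(ordS (ordS ord0)) * v ->
  exists x y, w = 'X_(ordS ord0) * x + 'X_(ordS (ordS ord0)) * y.
Proof.
move=> /(congr1 (to_iter ord0)); rewrite rmorphD !rmorphM !to_iterX var0 var1 var2.
move: (to_iter _ w) (to_iterK ord0 w) (to_iter _ u) (to_iter _ v) => {}w <- {}u {}v.
move=> /(congr1 (fun p : S => p`_0)); rewrite coefD coefXM eqxx addr0 !coefCM.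
move/(polyC_X_regular (@polyX_eq0 _)) => [q E].
have [|r rE] := @poly_coef0_dvd _ (w - (w`_0)%:P).
  by rewrite coefB coefC eqxx subrr.
exists (of_iter ord0 q%:P), (of_iter ord0 r).
rewrite -[w in LHS](subrK (w`_0)%:P) rE E !rmorphD !rmorphM of_iterX.
by rewrite [of_iter _ 'X%:P]of_iterC of_iter2X addrC.
Qed.

End Variables3.

Section KoszulChase.
Variables (A : idomainType) (V2 V1 V0 : lmodType A).
Variables (d2 : {linear V2 -> V1}) (d1 : {linear V1 -> V0}).
Hypotheses (free2 : finite_free V2) (free1 : finite_free V1) (free0 : finite_free V0).
Hypothesis d2_inj : injective d2.
Hypothesis exact1 : exact_at d2 d1.
Variables s t r : A.
Hypothesis s0 : s != 0.
Hypothesis reg2 : forall a b, t * a = s * b -> exists c, a = s * c.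
Hypothesis reg3 : forall w u v, r * w = t * u + s * v -> exists x y, w = t * x + s * y.

Lemma koszul_triple (V : lmodType A) (a b c : V) :
  r *: (t *: a - s *: b) - t *: (r *: a - s *: c) + s *: (r *: b - t *: c) = 0.
Proof.
rewrite !scalerDr !scalerN !scalerA [t * r]mulrC [s * r]mulrC [s * t]mulrC.
by rewrite opprB [X in X + _]addrC !subrKA subrr.
Qed.

(* By the depth formula, the cokernel of a complex of length two has no nonzero
   element killed by a regular sequence of length three. *)
Lemma cokernel_socle (x : V0) :
  (exists a, d1 a = s *: x) -> (exists b, d1 b = t *: x) ->
  (exists c, d1 c = r *: x) -> exists y, d1 y = x.
Proof using free2 free1 free0 d2_inj exact1 s0 reg2 reg3.
move=> [a aE] [b bE] [c cE].
have comm (u v : A) y z : d1 y = u *: x -> d1 z = v *: x ->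
    exists w, d2 w = v *: y - u *: z.
  move=> yE zE; apply/exact1; rewrite linearB !(linearZ_LR d1).
  by rewrite yE zE !scalerA mulrC subrr.
have [w1 w1E] := comm _ _ _ _ aE bE; have [w2 w2E] := comm _ _ _ _ aE cE.
have [w3 w3E] := comm _ _ _ _ bE cE.
(* The Koszul identity for the three relations holds after [d2], hence already in [V2]. *)
have wE : r *: w1 = t *: w2 + s *: (- w3).
  apply: d2_inj; rewrite linearD !(linearZ_LR d2) linearN w1E w2E w3E scalerN.
  apply/eqP; rewrite -subr_eq0 opprD opprK addrA.
  by apply/eqP/koszul_triple.
(* Writing [w1] as [t *: u + s *: v] corrects [a] and [b] by boundaries until [t] times the first
   equals [s] times the second; the quotient of the corrected [a] by [s] is the preimage of [x]. *)
have [u [v uvE]] := finite_free_divide2 free2 reg3 wE.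
have E : t *: (a - d2 u) = s *: (b + d2 v).
  apply/eqP; rewrite -subr_eq0 !scalerDr scalerN opprD addrACA -w1E uvE.
  by rewrite linearD !(linearZ_LR d2) -opprD subrr.
have [y yE] := finite_free_divide free1 reg2 E.
exists y; apply/eqP; rewrite -subr_eq0; apply/eqP.
apply: (finite_free_torsion_free free0 s0).
rewrite scalerBr -linearZ_LR -yE linearB aE.
have -> : d1 (d2 u) = 0 by apply/exact1; exists u.
by rewrite subr0 subrr.
Qed.

End KoszulChase.

Section Socle.
Variables (A : comNzRingType) (V : lmodType A).

Lemma annihilator_ideal (v : V) : is_ideal (fun a : A => a *: v = 0).
Proof.
split=> [|c x y xv yv]; first exact: scale0r.
by rewrite scalerDl -scalerA xv yv scaler0 addr0.
Qed.

Lemma annihilator_step (a : A) (v : V) :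
  v != 0 -> (exists d, a ^+ d *: v = 0) ->
  exists d, a ^+ d *: v != 0 /\ a *: (a ^+ d *: v) = 0.
Proof.
move=> v0 [d]; elim: d => [|d IHd].
  by rewrite expr0 scale1r => /eqP; rewrite (negPf v0).
have [/eqP/IHd//|nz E] := boolP (a ^+ d *: v == 0).
by exists d; rewrite nz scalerA -exprS.
Qed.

(** For [a], [b] and [c] in turn, the element is multiplied by the last power that does not kill it;
    earlier annihilations persist. *)
Lemma socle_element (a b c : A) (v : V) : v != 0 ->
  (exists d, a ^+ d *: v = 0) -> (exists d, b ^+ d *: v = 0) ->
  (exists d, c ^+ d *: v = 0) ->
  exists u : V, [/\ u != 0, a *: u = 0, b *: u = 0 & c *: u = 0].
Proof.
move=> v0 /(annihilator_step v0)[i [v1 av]] [j bv] [l cv].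
have [|i' [v2 bv']] := @annihilator_step b _ v1.
  by exists j; rewrite scaler_swap bv scaler0.
have [|i'' [v3 cv']] := @annihilator_step c _ v2.
  by exists l; rewrite scaler_swap [c ^+ l *: _]scaler_swap cv !scaler0.
exists (c ^+ i'' *: (b ^+ i' *: (a ^+ i *: v))); split=> //.
  by rewrite scaler_swap [a *: _]scaler_swap av !scaler0.
by rewrite scaler_swap bv' scaler0.
Qed.

End Socle.

(** * The equivalences *)

Section Equivalences.
Variables (A : idomainType) (m : nat) (I : idealr A).
Variables (phi : {linear 'rV[A]_m -> 'rV[A]_m.+1}).
Variables (psi : {linear 'rV[A]_m.+1 -> ideal_mod I}).
Hypothesis phi_inj : injective phi.
Hypothesis exact_phi_psi : exact_at phi psi.
Hypothesis psi_surj : surjective psi.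

Lemma sym2_map_surj : surjective (sym2_map psi).
Proof using psi_surj.
elim/sym2_ind=> [x y|_ _ [u <-] [v <-]].
  have [g gE] := psi_surj x; have [h hE] := psi_surj y.
  by exists (sym2_mul g h); rewrite sym2_mapE gE hE.
by exists (u + v); rewrite (linearD (sym2_map psi)).
Qed.

Lemma sym2_no_socle s t r (x : sym2 (ideal_mod I)) :
  s != 0 -> (forall a b, t * a = s * b -> exists c, a = s * c) ->
  (forall w u v, r * w = t * u + s * v -> exists x y, w = t * x + s * y) ->
  s *: x = 0 -> t *: x = 0 -> r *: x = 0 -> x = 0.
Proof using phi_inj exact_phi_psi psi_surj.
move=> s0 reg2 reg3 sx tx rx; have [g gE] := sym2_map_surj x.
have ex := sym2_right_exact exact_phi_psi psi_surj.
rewrite -gE; apply/ex.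
have lift c : c *: x = 0 -> exists a, cplx1 phi a = c *: g.
  by move=> cx; apply/ex; rewrite (linearZ_LR (sym2_map psi)) gE.
apply: (cokernel_socle (ext2_free A m) (tensor_free A m m.+1) (sym2_free A m.+1)
  (cplx2_inj phi_inj) (exact_cplx2_cplx1 phi_inj exact_phi_psi) s0 reg2 reg3); exact: lift.
Qed.

Lemma sym2_depth_pos s t r (x : sym2 (ideal_mod I)) :
  s != 0 -> (forall a b, t * a = s * b -> exists c, a = s * c) ->
  (forall w u v, r * w = t * u + s * v -> exists x y, w = t * x + s * y) ->
  (exists d, s ^+ d *: x = 0) -> (exists d, t ^+ d *: x = 0) ->
  (exists d, r ^+ d *: x = 0) -> x = 0.
Proof using phi_inj exact_phi_psi psi_surj.
move=> s0 reg2 reg3 sx tx rx; apply/eqP; apply: contraT => nz.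
have [u [u0 su tu ru]] := socle_element nz sx tx rx.
have u00 := sym2_no_socle s0 reg2 reg3 su tu ru.
by rewrite u00 eqxx in u0.
Qed.

Lemma injective_bijective : (forall s, sym2_to_sq I s = 0 -> s = 0) ->
  bijective (sym2_to_sq I).
Proof.
move=> inj; have [g gK] := choice (@sym2_to_sq_surj A I).
exists g => [s|//]; apply/eqP; rewrite -subr_eq0; apply/eqP/inj.
by rewrite (linearB (sym2_to_sq I)) gK subrr.
Qed.

Lemma bijective_torsion_free : bijective (sym2_to_sq I) ->
  torsion_free (sym2 (ideal_mod I)).
Proof.
move=> /bij_inj inj c s cs; have [->|c0] := eqVneq c 0; [by left | right].
apply: inj; rewrite (linear0 (sym2_to_sq I)).
by apply: (@ideal_mod_torsion_free _ _ c); rewrite // -(linearZ_LR (sym2_to_sq I)) cs linear0.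
Qed.

Lemma torsion_free_resolution : (exists x, x \in I /\ x != 0) ->
  torsion_free (sym2 (ideal_mod I)) ->
  free_resolution2 (cplx2 phi) (cplx1 phi) (cplx0 psi).
Proof using phi_inj exact_phi_psi psi_surj.
move=> [x [xI x0]] tf.
have inj s : sym2_to_sq I s = 0 -> s = 0.
  move=> s0; have := sym2_square (IdealMod (xI : x \in ideal_pred I)) s.
  rewrite s0 ideal_elt0 scale0r => /tf[/eqP|//].
  by rewrite mulf_eq0 orbb -[ideal_elt _]/x (negPf x0).
split; first by split; [exact: ext2_free | exact: tensor_free | exact: sym2_free].
split; [exact: cplx2_inj | exact: exact_cplx2_cplx1 exact_phi_psi | |].
  move=> v; have ex := sym2_right_exact exact_phi_psi psi_surj v.
  by split=> [/inj/ex//|/ex E]; rewrite [LHS](congr1 _ E) (linear0 (sym2_to_sq I)).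
move=> y; have [s <-] := sym2_to_sq_surj y; have [v <-] := sym2_map_surj s.
by exists v.
Qed.

Lemma resolution_local_generators (p : prime_idealr A) s t :
  injective (cplx2 phi) -> exact_at (cplx2 phi) (cplx1 phi) ->
  exact_at (cplx1 phi) (cplx0 psi) -> regular_pair p s t ->
  (forall b, b \in p -> exists g N, g \notin p /\ g * b ^+ N \in I) ->
  {subset I <= p} -> exists i j x y,
  [/\ x = ideal_elt (psi (rv i)), y = ideal_elt (psi (rv j)),
      exists g, g \notin p /\ forall z, z \in I -> exists a b, g * z = a * x + b * y,
      x != 0 & forall c a, c * y = a * x -> exists h e, h \notin p /\ h * c = e * x].
Proof using exact_phi_psi psi_surj.
move=> inj2 ex1 ex0 st rad Ip.
have [K [iota [iota0 frac]]] := residue_field p.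
have rk := residue_rank inj2 ex1 ex0 st iota0 frac.
have psi_phi0 u : psi (phi u) = 0 by apply/exact_phi_psi; exists u.
have [i [j [g [gp gen]]]] := local_generators psi_phi0 psi_surj iota0 rk.
have [x0 reg] := local_regular st rad Ip (ideal_eltP _) (ideal_eltP _) gp gen.
by exists i, j, (ideal_elt (psi (rv i))), (ideal_elt (psi (rv j))); split=> //; exists g.
Qed.

(* The points enter only through their prime ideals, and local complete
   intersections only through the consequences used on each side; this keeps
   the module-theoretic part over an abstract domain. *)
Lemma resolution_equivalences (lci : Prop) (T : Type) (q : T -> prime_idealr A) s t r :
  (exists x, x \in I /\ x != 0) ->
  s != 0 -> (forall a b, t * a = s * b -> exists c, a = s * c) ->
  (forall w u v, r * w = t * u + s * v -> exists x y, w = t * x + s * y) ->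
  (lci -> forall x : sym2 (ideal_mod I), sym2_to_sq I x = 0 ->
    [/\ exists d, s ^+ d *: x = 0, exists d, t ^+ d *: x = 0 & exists d, r ^+ d *: x = 0]) ->
  (forall p : T, {subset I <= q p} -> (exists u v, regular_pair (q p) u v) /\
    forall b, b \in q p -> exists g N, g \notin q p /\ g * b ^+ N \in I) ->
  ((forall p : T, {subset I <= q p} -> exists i j x y,
    [/\ x = ideal_elt (psi (rv i)), y = ideal_elt (psi (rv j)),
      exists g, g \notin q p /\ forall z, z \in I -> exists a b, g * z = a * x + b * y,
      x != 0 & forall c a, c * y = a * x -> exists h e, h \notin q p /\ h * c = e * x]) ->
   lci) ->
  [<-> lci; bijective (sym2_to_sq I); torsion_free (sym2 (ideal_mod I));
       free_resolution2 (cplx2 phi) (cplx1 phi) (cplx0 psi)].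
Proof using phi_inj exact_phi_psi psi_surj.
move=> nz s0 reg2 reg3 ann loc gen_lci; tfae.
- move=> h; apply: injective_bijective => x x0; have [sx tx rx] := ann h x x0.
  exact: sym2_depth_pos s0 reg2 reg3 sx tx rx.
- exact: bijective_torsion_free.
- exact: torsion_free_resolution.
move=> [_ [inj2 ex1 ex0 _]]; apply: gen_lci => p Ip.
have [[u [v uv]] rad] := loc p Ip.
exact: resolution_local_generators inj2 ex1 ex0 uv rad Ip.
Qed.

End Equivalences.

Lemma codim2_nonzero (A : idomainType) (I : idealr A) :
  codim_is I 2 -> exists x, x \in I /\ x != 0.
Proof.
move=> cod; apply: contrapT => no.
have [Z ZE] := zero_prime A.
apply: (codim2_height (P := Z) cod) => [x xI|Q QZ [q [/QZ/ZE ->]]]; last by rewrite eqxx.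
by apply/ZE/eqP; apply: contraT => x0; case: no; exists x.
Qed.

Lemma basis_homogeneous (k : fieldType) n (I : idealr {mpoly k[n]}) m
    (a : 'I_m -> int) (psi : {linear 'rV[{mpoly k[n]}]_m -> ideal_mod I}) i :
  (forall d v, free_homog a d v -> zhomog d (ideal_elt (psi v))) ->
  exists d, ideal_elt (psi (rv i)) \is d.-homog.
Proof.
move=> /(_ (a i) (rv i)) h; have /h : free_homog a (a i) (rv i : 'rV[{mpoly k[n]}]_m).
  move=> j; rewrite rvE; have [->|_] := eqVneq i j; first by rewrite subrr /= dhomog1.
  by case: (a i - a j) => e /=; rewrite ?dhomog0 ?eqxx.
case: (a i) => d /=; first by exists d.
(* A generator of negative degree maps to zero, which is homogeneous of every degree. *)
by move/eqP => ->; exists 0%N; rewrite dhomog0.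
Qed.

Lemma mpolyX_neq0 (k : fieldType) n (i : 'I_n) : 'X_i != 0 :> {mpoly k[n]}.
Proof. by rewrite -msupp_eq0 msuppX. Qed.

Theorem theorem3p1 (k : fieldType) (I : idealr {mpoly k[3]})
    (I_homog : homogeneous_ideal I)
    (I_CM : cohen_macaulay {ideal_quot I})
    (I_codim2 : codim_is I 2)
    (m : nat) (b : 'I_m -> int) (a : 'I_m.+1 -> int)
    (phi : {linear 'rV[{mpoly k[3]}]_m -> 'rV[{mpoly k[3]}]_m.+1})
    (psi : {linear 'rV[{mpoly k[3]}]_m.+1 -> ideal_mod I})
    (FG_res : hilbert_burch_resolution b a phi psi) :
  [<-> local_complete_intersection I;
       bijective (sym2_to_sq I);
       torsion_free (sym2 (ideal_mod I));
       free_resolution2 (cplx2 phi) (cplx1 phi) (cplx0 psi)].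
Proof.
have [_ psi_homog [phi_inj exact_phi_psi psi_surj]] := FG_res.
(* The regular sequence [s, t, r] consists of the variables in reverse order, with [s] the outermost
   one in the iterated polynomial ring. *)
apply: (@resolution_equivalences {mpoly k[3]} m I phi psi phi_inj exact_phi_psi psi_surj
  _ (proj_point k 3) (@point_ideal k 3) _ _ _ (codim2_nonzero I_codim2)
  (mpolyX_neq0 _ _) (@X_regular2 k) (@X_regular3 k)).
(* The annihilator of [s] contains a form outside each point, hence a power of each variable. *)
- move=> lci s s0.
  have ann := irrelevant_annihilated (annihilator_ideal s)
    (fun p => lci_local_kernel p I_homog lci s0).
  by split; apply: ann.
- by move=> p; apply: point_radical.
move=> gens p Ip; have [i [j [x [y [xE yE gen x0 reg]]]]] := gens p Ip.
have [d hx] := basis_homogeneous i psi_homog; have [e hy] := basis_homogeneous j psi_homog.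
rewrite -xE in hx; rewrite -yE in hy.
have xI : x \in (I : {pred {mpoly k[3]}}) by rewrite xE ideal_eltP.
have yI : y \in (I : {pred {mpoly k[3]}}) by rewrite yE ideal_eltP.
exact: (two_generators_lci Ip hx hy xI yI gen x0 reg).
Qed.
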